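(* Let $\ell\ge2$ and let $\dot{\mathfrak g}=\{X\in M_{2\ell+4}(\mathbb C)\mid X^T=-X\}$, the simple Lie algebra of type $D_{\ell+2}$. Put $$\sigma_0=\mathrm{Ad}\Big(-E_{2\ell+3,2\ell+3}-E_{2\ell+4,2\ell+4}+\sum_{i=1}^{2\ell+2}E_{ii}\Big),\quad \sigma_1=\mathrm{Ad}\Big(-E_{2\ell+2,2\ell+2}+E_{2\ell+3,2\ell+3}-E_{2\ell+4,2\ell+4}+\sum_{i=1}^{2\ell+1}E_{ii}\Big).$$ Then $\dot{\mathfrak g}_{(\overline0,\overline0)}$ is the simple Lie algebra of type $B_\ell$; each of the three spaces $\dot{\mathfrak g}_{(\overline0,\overline1)},\dot{\mathfrak g}_{(\overline1,\overline0)},\dot{\mathfrak g}_{(\overline1,\overline1)}$ is, as a $\dot{\mathfrak g}_{(\overline0,\overline0)}$-module, the direct sum of a 1-dimensional trivial and a $(2\ell+1)$-dimensional irreducible representation; and the set $R$ of non-isotropic roots of the twisted 2-toroidal Lie algebra $\mathfrak g(\sigma_0,\sigma_1)$ is the extended affine root system $B_\ell^{(2,2)}$: $$R=\{\alpha+m\delta_0+n\delta_1\mid\alpha\in R(B_\ell)\text{ short},\ m,n\in\mathbb Z\}\cup\{\alpha+2m\delta_0+2n\delta_1\mid\alpha\in R(B_\ell)\text{ long},\ m,n\in\mathbb Z\},$$ where $R(B_\ell)$ is the root system of $\dot{\mathfrak g}_{(\overline0,\overline0)}$ with respect to its Cartan subalgebra $\dot{\mathfrak h}_{\overline0}$.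
   Context: $E_{ij}$ are matrix units and $\mathrm{Ad}(A)(X)=AXA^{-1}$. Work over $\mathbb C$. Let $\dot{\mathfrak g}$ be a simple finite-dimensional Lie algebra with Killing form $(\cdot,\cdot)$, and $\sigma_0,\sigma_1$ commuting automorphisms of finite orders $n_0,n_1$ (order 1 allowed). Put $\epsilon_j=\exp(2\pi i/n_j)$ and, for $p,q\in\mathbb Z$, $\dot{\mathfrak g}_{(\overline p,\overline q)}=\{g\in\dot{\mathfrak g}\mid\sigma_0(g)=\epsilon_0^p g,\ \sigma_1(g)=\epsilon_1^q g\}$, where $\overline p=p \bmod n_0$, $\overline q=q\bmod n_1$. Let $\mathcal R=\mathbb C[t_0^{\pm1},t_1^{\pm1}]$, $\mathcal K=\Omega^1_{\mathcal R}/d\mathcal R$, $k_i=t_i^{-1}dt_i$, and let $\mathcal K(\Sigma)\subset\mathcal K$ be spanned by the elements $t_0^{n_0a}t_1^{n_1b}k_i$ ($a,b\in\mathbb Z$, $i=0,1$). The twisted 2-toroidal Lie algebra is $$\mathfrak g(\sigma_0,\sigma_1)=\bigoplus_{m,n\in\mathbb Z}\dot{\mathfrak g}_{(\overline m,\overline n)}\otimes t_0^mt_1^n\ \oplus\ \mathcal K(\Sigma)\ \oplus\ \mathbb Cd_0\oplus\mathbb Cd_1,$$ with bracket $[g_1\otimes f_1,g_2\otimes f_2]=[g_1,g_2]\otimes f_1f_2+(g_1,g_2)f_2\,df_1$; $\mathcal K(\Sigma)$ commutes with itself and with all $g\otimes f$; $d_j=t_j\partial/\partial t_j$ acts by $[d_j,g\otimes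 t_0^{r_0}t_1^{r_1}]=r_j\,g\otimes t_0^{r_0}t_1^{r_1}$, $[d_j,t_0^{r_0}t_1^{r_1}k_i]=r_j\,t_0^{r_0}t_1^{r_1}k_i$; and $[d_0,d_1]=0$. Let $\dot{\mathfrak h}_{\overline 0}$ be a Cartan subalgebra of the reductive algebra $\dot{\mathfrak g}_{(\overline 0,\overline 0)}$ and $\mathfrak h=\dot{\mathfrak h}_{\overline 0}\oplus\mathbb Cd_0\oplus\mathbb Cd_1\oplus\mathbb Ck_0\oplus\mathbb Ck_1$. Elements of $\dot{\mathfrak h}_{\overline 0}^*$ are extended to $\mathfrak h$ by $0$ on all $d_i,k_i$; $\delta_i\in\mathfrak h^*$ is defined by $\delta_i(d_j)=\delta_{ij}$ and zero on $\dot{\mathfrak h}_{\overline 0}$ and all $k_j$. Let $V=\dot{\mathfrak h}_{\overline 0}^*\oplus\mathbb C\delta_0\oplus\mathbb C\delta_1$ with the bilinear form $(\cdot,\cdot)_V$ which on $\dot{\mathfrak h}_{\overline 0}^*$ is dual to the restriction of the Killing form to $\dot{\mathfrak h}_{\overline 0}$ and has $\delta_0,\delta_1$ in its radical. Then $R$ is the set of $\beta\in V$ with $(\beta,\beta)_V\ne0$ whose weight space in $\mathfrak g(\sigma_0,\sigma_1)$ under the adjoint action of $\mathfrak h$ is nonzero. *)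

(* Defs.v *)
From HB Require Import structures.
From mathcomp Require Import all_boot all_order all_algebra.
From mathcomp Require Import finmap.
From mathcomp Require Import complex.
From mathcomp Require Import ring zify.
From mathcomp Require Import all_classical all_reals all_analysis.

Set Implicit Arguments.
Unset Strict Implicit.
Unset Printing Implicit Defensive.

Import Order.TTheory GRing.Theory Num.Theory.

Local Open Scope classical_set_scope.
Local Open Scope ring_scope.

HB.mixin Record Lmodule_isLieAlgebra (K : fieldType) L of GRing.Lmodule K L := {
  lie : L -> L -> L;
  lie_linearl : forall y, linear (lie^~ y);
  lie_linearr : forall x, linear (lie x);
  liexx : forall x, lie x x = 0;
  lie_jacobi : forall x y z,
    lie x (lie y z) + lie y (lie z x) + lie z (lie x y) = 0 }.

#[short(type="lieAlgType")]
HB.structure Definition LieAlgebra (K : fieldType) :=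
  {L of Lmodule_isLieAlgebra K L & GRing.Lmodule K L}.

#[short(type="vectLieAlgType")]
HB.structure Definition VectLieAlgebra (K : fieldType) :=
  {L of LieAlgebra K L & Vector K L}.

Section LieTheory.
Variables (K : fieldType) (L : lieAlgType K).
Implicit Types x y z : L.

Lemma lieDl x y z : lie (x + y) z = lie x z + lie y z.
Proof. by have := lie_linearl z 1 x y; rewrite !scale1r. Qed.
Lemma lieDr x y z : lie z (x + y) = lie z x + lie z y.
Proof. by have := lie_linearr z 1 x y; rewrite !scale1r. Qed.
Lemma lie0x x : lie 0 x = 0.
Proof. by apply: (addrI (lie 0 x)); rewrite -lieDl !addr0. Qed.
Lemma liex0 x : lie x 0 = 0.
Proof. by apply: (addrI (lie x 0)); rewrite -lieDr !addr0. Qed.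
Lemma lieZl a x y : lie (a *: x) y = a *: lie x y.
Proof. by have := lie_linearl y a x 0; rewrite !addr0 lie0x addr0. Qed.
Lemma lieZr a x y : lie x (a *: y) = a *: lie x y.
Proof. by have := lie_linearr x a y 0; rewrite !addr0 liex0 addr0. Qed.
Lemma lieC x y : lie x y = - lie y x.
Proof.
apply/eqP; rewrite -addr_eq0; have := liexx (x + y).
by rewrite lieDl !lieDr !liexx addr0 add0r => ->.
Qed.
Lemma lieNl x y : lie (- x) y = - lie x y.
Proof. by rewrite -scaleN1r lieZl scaleN1r. Qed.
Lemma lieNr x y : lie x (- y) = - lie x y.
Proof. by rewrite -scaleN1r lieZr scaleN1r. Qed.
End LieTheory.

Section SubalgebraTheory.
Variables (K : fieldType) (L : vectLieAlgType K).
Implicit Types (g h I U W : {vspace L}) (x y : L).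

(* the span of all brackets [u, w], u in U, w in W *)
Definition lie_prodv U W : {vspace L} :=
  <<[seq lie u w | u <- vbasis U, w <- vbasis W]>>%VS.

Definition subalgebra g : Prop := (lie_prodv g g <= g)%VS.

Definition abelian_lie g : Prop := lie_prodv g g = 0%VS.

Definition ideal_of g I : Prop := (I <= g)%VS /\ (lie_prodv g I <= I)%VS.

Definition simple_lie g : Prop :=
  [/\ subalgebra g, ~ abelian_lie g &
      forall I, ideal_of g I -> I = 0%VS \/ I = g].

Definition nilpotent_lie g : Prop :=
  exists n, iter n (lie_prodv g) g = 0%VS.

Definition normalizer_of g h x : Prop :=
  x \in g /\ forall y, y \in h -> lie x y \in h.

Definition cartan_subalgebra g h : Prop :=
  [/\ (h <= g)%VS, subalgebra h, nilpotent_lie h &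
      forall x, normalizer_of g h x -> x \in h].

(* g-submodules of L under the adjoint action of the subalgebra g *)
Definition adj_submodule g U : Prop := (lie_prodv g U <= U)%VS.

Definition adj_trivial g U : Prop :=
  forall x u, x \in g -> u \in U -> lie x u = 0.

Definition adj_irreducible g U : Prop :=
  [/\ adj_submodule g U, U <> 0%VS &
      forall W, (W <= U)%VS -> adj_submodule g W -> W = 0%VS \/ W = U].

(* the trace form of the adjoint representation of g on itself;
   meaningful for x, y in a subalgebra g *)
Definition killing g x y : K :=
  \sum_(i < \dim g) coord (vbasis g) i (lie x (lie y (vbasis g)`_i)).

(* functionals on h; K^o is K as a module over itself *)
Local Notation dualv h := 'Hom(subvs_of h, K^o).

(* The form on the dual of h induced by a form kappa that is nondegenerate
   on h: (alpha, beta) = kappa t_alpha t_beta, where t_alpha in h represents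
   alpha through kappa. *)
Definition dual_vec (kappa : L -> L -> K) h (alpha : dualv h) : subvs_of h :=
  xget 0 [set t | forall s : subvs_of h, kappa (vsval t) (vsval s) = alpha s].

Definition dual_form (kappa : L -> L -> K) h (alpha beta : dualv h) : K :=
  kappa (vsval (dual_vec kappa alpha)) (vsval (dual_vec kappa beta)).

Definition lie_root g h (alpha : dualv h) : Prop :=
  alpha <> 0 /\
  exists x, [/\ x \in g, x <> 0 &
    forall t : subvs_of h, lie (vsval t) x = (alpha t : K) *: x].

(* The roots of (g, h) have a base alpha_1, ..., alpha_n with
   2 (alpha_i, alpha_j) / (alpha_j, alpha_j) = A i j. *)
Definition has_cartan_matrix g h n (A : 'M[int]_n) : Prop :=
  exists base : 'I_n -> dualv h,
  [/\ basis_of fullv [seq base i | i <- enum 'I_n],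
      forall i, lie_root g (base i),
      forall alpha, lie_root g alpha -> exists c : 'I_n -> nat,
        let beta := \sum_i base i *+ c i in alpha = beta \/ alpha = - beta &
      forall i j, 2 * dual_form (killing g) (base i) (base j)
        / dual_form (killing g) (base j) (base j) = (A i j)%:~R].

Definition simple_lie_of_type g n (A : 'M[int]_n) : Prop :=
  simple_lie g /\ exists2 h, cartan_subalgebra g h & has_cartan_matrix g h A.

End SubalgebraTheory.

(* nodes 0, ..., l-1; the last simple root is the short one *)
Definition cartanB l : 'M[int]_l :=
  \matrix_(i, j)
    if i == j then 2
    else if (i.+2 == l) && (j.+1 == l) then - 2
    else if (i.+1 == j) || (j.+1 == i) then - 1
    else 0.

(* Squared lengths are positive rationals, hence comparable for the partial
   order of C. *)
Section RootLengths.
Variables (K : numFieldType) (L : vectLieAlgType K).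

Definition short_root (g h : {vspace L}) (alpha : 'Hom(subvs_of h, K^o)) : Prop :=
  lie_root g alpha /\ exists2 beta : 'Hom(subvs_of h, K^o), lie_root g beta &
    dual_form (killing g) alpha alpha < dual_form (killing g) beta beta.

Definition long_root (g h : {vspace L}) (alpha : 'Hom(subvs_of h, K^o)) : Prop :=
  lie_root g alpha /\ exists2 beta : 'Hom(subvs_of h, K^o), lie_root g beta &
    dual_form (killing g) beta beta < dual_form (killing g) alpha alpha.

End RootLengths.

Section KillingTheory.
Variables (K : fieldType) (L : vectLieAlgType K).
Implicit Types (x y z : L).

Let tr (f : L -> L) : K :=
  \sum_(i < \dim {:L}) coord (vbasis {:L}) i (f (vbasis {:L})`_i).

Let tr_lin (f g : L -> L) : linear f -> linear g -> tr (f \o g) = tr (g \o f).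
Proof.
move=> lf lg.
pose lfm := GRing.isLinear.Build K L L _ f lf.
pose f' : {linear L -> L} := HB.pack f lfm.
pose lgm := GRing.isLinear.Build K L L _ g lg.
pose g' : {linear L -> L} := HB.pack g lgm.
have E (p q : {linear L -> L}) : tr (p \o q) =
  \sum_(i < \dim {:L}) \sum_(j < \dim {:L})
   coord (vbasis {:L}) j (q (vbasis {:L})`_i)
   * coord (vbasis {:L}) i (p (vbasis {:L})`_j).
  apply: eq_bigr => i _ /=.
  rewrite {1}(coord_vbasis (memvf (q (vbasis {:L})`_i))) !linear_sum /=.
  by apply: eq_bigr => j _; rewrite !linearZ.
rewrite (E f' g') (E g' f') exchange_big /=.
by apply: eq_bigr => i _; apply: eq_bigr => j _; rewrite mulrC.
Qed.

Let killE x y : killing {:L} x y = tr (lie x \o lie y).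
Proof. by []. Qed.

Lemma killingC x y : killing {:L} x y = killing {:L} y x.
Proof. by rewrite !killE; apply: tr_lin; apply: lie_linearr. Qed.

Lemma killing_linearr x : linear (killing {:L} x : L -> K^o).
Proof.
move=> a u v; rewrite /killing scaler_sumr -big_split /=.
by apply: eq_bigr => i _; rewrite lieDl lieZl lieDr lieZr linearP.
Qed.

Lemma killing_linearl y : linear (killing {:L} ^~ y : L -> K^o).
Proof. by move=> a u v; rewrite !(killingC _ y) killing_linearr. Qed.

Lemma killing_invariant x y z :
  killing {:L} (lie x y) z = killing {:L} x (lie y z).
Proof.
have lieJ u v w : lie (lie u v) w = lie u (lie v w) - lie v (lie u w).
  have := lie_jacobi u v w; rewrite (lieC w (lie u v)) (lieC w u) lieNr.
  by move/eqP; rewrite subr_eq0 => /eqP.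
have trB f g h : (forall v, f v = g v - h v) -> tr f = tr g - tr h.
  move=> E; rewrite /tr -sumrB; apply: eq_bigr => i _.
  by rewrite E linearB.
rewrite !killE.
rewrite (trB (lie (lie x y) \o lie z) (lie x \o (lie y \o lie z)) ((lie y \o lie x) \o lie z)); last first.
  by move=> v /=; rewrite lieJ.
rewrite (trB (lie x \o lie (lie y z)) (lie x \o (lie y \o lie z)) (lie x \o (lie z \o lie y))); last first.
  by move=> v /=; rewrite lieJ lieDr lieNr.
congr (_ - _); rewrite (_ : (_ \o _) \o _ = lie y \o (lie x \o lie z)) //.
rewrite (tr_lin (lie_linearr y)) // => a u v /=.
by rewrite !lieDr !lieZr.
Qed.

End KillingTheory.

Section Orthogonal.
Variables (K : fieldType) (N : nat).

Definition skew_space : {vspace 'M[K]_N} :=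
  lker (linfun (fun X : 'M[K]_N => X^T + X)).

Fact skew_sum_linear : linear (fun X : 'M[K]_N => X^T + X).
Proof. by move=> a X Y; rewrite !linearP /= scalerDr addrACA. Qed.

Lemma skew_spaceP (X : 'M[K]_N) : reflect (X^T = - X) (X \in skew_space).
Proof.
pose lm := GRing.isLinear.Build K _ _ _ _ skew_sum_linear.
pose f : {linear 'M[K]_N -> 'M[K]_N} := HB.pack (fun X : 'M[K]_N => X^T + X) lm.
rewrite /skew_space memv_ker -[X in linfun X]/(f : _ -> _) lfunE /= addr_eq0.
exact: eqP.
Qed.

(* so_N = {X | X^T = - X} with the commutator bracket *)
Definition so : Type := subvs_of skew_space.

HB.instance Definition _ := Vector.copy so (subvs_of skew_space).

Implicit Types X Y Z : so.

Lemma so_trmx X : (vsval X)^T = - vsval X.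
Proof. exact/skew_spaceP/subvsP. Qed.

Definition so_lie X Y : so :=
  vsproj skew_space (vsval X *m vsval Y - vsval Y *m vsval X).

Lemma so_lieE X Y : vsval (so_lie X Y) = vsval X *m vsval Y - vsval Y *m vsval X.
Proof.
rewrite vsprojK //; apply/skew_spaceP.
by rewrite linearB /= !trmx_mul !so_trmx !mulNmx !mulmxN !opprK opprB.
Qed.

Let so_valP a X Y : vsval (a *: X + Y : so) = a *: vsval X + vsval Y.
Proof. by []. Qed.
Let so_valD X Y : vsval (X + Y : so) = vsval X + vsval Y.
Proof. by []. Qed.
Let so_valN X : vsval (- X : so) = - vsval X.
Proof. by []. Qed.
Let so_val0 : vsval (0 : so) = 0.
Proof. by []. Qed.

Fact so_lie_linearl Y : linear (so_lie^~ Y).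
Proof.
move=> a X Z; apply: val_inj; rewrite [LHS]so_lieE [RHS]so_valP !so_lieE.
rewrite so_valP mulmxDl mulmxDr -scalemxAl -scalemxAr scalerBr opprD.
by rewrite addrACA.
Qed.

Fact so_liexx X : so_lie X X = 0.
Proof. by apply: val_inj; rewrite [LHS]so_lieE subrr. Qed.

Fact so_lie_linearr X : linear (so_lie X).
Proof.
have C U V : so_lie U V = - so_lie V U.
  by apply: val_inj; rewrite [LHS]so_lieE [RHS]so_valN so_lieE opprB.
by move=> a Y Z; rewrite C so_lie_linearl opprD -scalerN -!C.
Qed.

Fact so_lie_jacobi X Y Z :
  so_lie X (so_lie Y Z) + so_lie Y (so_lie Z X) + so_lie Z (so_lie X Y) = 0.
Proof.
apply: val_inj; rewrite [LHS]so_valD so_valD [RHS]so_val0 !so_lieE.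
rewrite !(mulmxBr, mulmxBl) !mulmxA !opprB.
set x := vsval X; set y := vsval Y; set z := vsval Z.
set p1 := x *m y *m z; set p2 := x *m z *m y; set p3 := y *m z *m x.
set p4 := z *m y *m x; set p5 := y *m x *m z; set p6 := z *m x *m y.
apply/matrixP => i j; rewrite !mxE.
ring.
Qed.

HB.instance Definition _ := Lmodule_isLieAlgebra.Build K so
  so_lie_linearl so_lie_linearr so_liexx so_lie_jacobi.

End Orthogonal.

Notation Z2 := (int * int)%type.

(* V[t_0^{+-1}, t_1^{+-1}]: finitely supported functions Z^2 -> V, where
   x (m, n) is the coefficient of t_0^m t_1^n *)
Section Laurent.
Variables (K : fieldType) (V : lmodType K).

Definition finsupp_pred : {pred Z2 -> V} :=
  fun x => `[< finite_set [set r | x r <> 0] >].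

Fact finsupp_submod_closed : submod_closed finsupp_pred.
Proof.
split; first by apply/asboolP; rewrite (_ : mkset _ = set0) // -subset0 => r /=.
move=> a x y /asboolP fx /asboolP fy; apply/asboolP.
apply: sub_finite_set (_ : finite_set ([set r | x r <> 0] `|` [set r | y r <> 0])).
  move=> r /=; apply: contra_notP; rewrite not_orP !notK => -[xr yr].
  by rewrite (_ : _ r = a *: x r + y r) // xr yr scaler0 addr0.
by rewrite finite_setU.
Qed.
HB.instance Definition _ :=
  GRing.isSubmodClosed.Build K (Z2 -> V) finsupp_pred finsupp_submod_closed.

Record laurent : Type := Laurent {
  coeff :> Z2 -> V; _ : coeff \in finsupp_pred }.

HB.instance Definition _ := [isSub for coeff].
HB.instance Definition _ := [Choice of laurent by <:].
HB.instance Definition _ := [SubChoice_isSubLmodule of laurent by <:].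

Implicit Types x y : laurent.

Lemma laurentP x y : x =1 y -> x = y.
Proof. by move=> E; apply/val_inj/funext. Qed.

Lemma laurent_fin x : finite_set [set r | x r <> 0].
Proof. exact/asboolP/(valP x). Qed.

Lemma coeffP a x y r : (a *: x + y) r = a *: x r + y r.
Proof. by []. Qed.

Fact mono_subproof r (v : V) :
  (fun p : Z2 => if p == r then v else 0) \in finsupp_pred.
Proof.
apply/asboolP/(sub_finite_set _ (finite_set1 r)) => p /=.
by case: eqP.
Qed.

(* v t^r *)
Definition mono r v : laurent := Laurent (mono_subproof r v).

Lemma monoE r v p : mono r v p = if p == r then v else 0.
Proof. by []. Qed.

Lemma mono_is_linear r : linear (mono r).
Proof.
move=> a u v; apply: laurentP => p; rewrite coeffP !monoE.
by case: eqP => // _; rewrite scaler0 addr0.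
Qed.

End Laurent.

HB.instance Definition _ (K : fieldType) (V : lmodType K) r :=
  GRing.isLinear.Build K V (laurent V) _ (@mono K V r) (@mono_is_linear K V r).

Section LinearExtension.
Variables (K : fieldType) (V W : lmodType K) (F : Z2 -> V -> W).

(* the linear extension of v t^r |-> F r v *)
Definition lin_ext (x : laurent V) : W := \sum_(r \in [set: Z2]) F r (x r).

Hypothesis linF : forall r, linear (F r).

Let F0 r : F r 0 = 0.
Proof. by have := linF r (-1) 0 0; rewrite !scaleN1r !addNr. Qed.

Lemma lin_extE (A : {fset Z2}) (x : laurent V) :
  (forall r, r \notin A -> x r = 0) -> lin_ext x = \sum_(r <- A) F r (x r).
Proof. by move=> xA; rewrite /lin_ext (fsbigTE A) // => r /xA ->. Qed.

Lemma laurent_supp (x : laurent V) :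
  exists A : {fset Z2}, forall r, r \notin A -> x r = 0.
Proof.
have [A AE] := finite_fsetP.1 (laurent_fin x); exists A => r rA.
by apply: contrapT => xr; have : [set` A] r; [rewrite -AE | exact/negP].
Qed.

Lemma lin_ext_is_linear : linear lin_ext.
Proof.
move=> a x y; have [A xA] := laurent_supp x; have [B yB] := laurent_supp y.
have inU (C D : {fset Z2}) r : r \notin (C `|` D)%fset -> r \notin C /\ r \notin D.
  by rewrite in_fsetU negb_or => /andP.
rewrite (@lin_extE (A `|` B)%fset x) => [|r /inU[/xA]] //.
rewrite (@lin_extE (A `|` B)%fset y) => [|r /inU[_ /yB]] //.
rewrite (@lin_extE (A `|` B)%fset) => [|r /inU[/xA xr /yB yr]]; last first.
  by rewrite coeffP xr yr scaler0 addr0.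
by rewrite scaler_sumr -big_split /=; apply: eq_bigr => r _; rewrite -linF.
Qed.

Lemma lin_ext_mono r v : lin_ext (mono r v) = F r v.
Proof.
rewrite (@lin_extE [fset r]%fset) ?big_seq_fset1 ?monoE ?eqxx // => p.
by rewrite inE monoE => /negPf ->.
Qed.

End LinearExtension.

Lemma laurent_mono (K : fieldType) (V : lmodType K) (x : laurent V) :
  exists A : {fset Z2}, x = \sum_(r <- A) mono r (x r).
Proof.
have [A xA] := laurent_supp x; exists A.
have E (s : seq Z2) p : (\sum_(r <- s) mono r (x r)) p = \sum_(r <- s) mono r (x r) p.
  by elim: s => [|r s IH]; rewrite ?big_nil // !big_cons -IH.
apply: laurentP => p; rewrite E; have [pA|/[dup] pA /xA xp] := boolP (p \in A).
  rewrite (big_fsetD1 p) // monoE eqxx big1_seq; first by rewrite [RHS]addr0.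
  by move=> r; rewrite !inE monoE eq_sym => /andP[_ /andP[/negPf -> _]].
rewrite big1_seq // => r /andP[_ rA]; rewrite monoE.
by case: eqP => // pr; rewrite pr rA in pA.
Qed.

Lemma laurent_ind (K : fieldType) (V : lmodType K) (P : laurent V -> Prop) :
  P 0 -> (forall x y, P x -> P y -> P (x + y)) ->
  (forall r v, P (mono r v)) -> forall x, P x.
Proof.
move=> P0 PD Pm x; have [A ->] := laurent_mono x.
by elim/big_ind: _.
Qed.

(* Omega^1 of R = K[t_0^{+-1}, t_1^{+-1}] is the free R-module on k_0 and k_1,
   where k_i = t_i^{-1} dt_i; the coefficient (a, b) at r stands for
   t^r (a k_0 + b k_1). *)
Notation Omega K := (laurent (K^o * K^o)%type).

Section Kahler.
Variable K : fieldType.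

(* f1 df0 for f0 = t^r, f1 = t^s, as d(t^r) = t^r (r_0 k_0 + r_1 k_1) *)
Definition mono_dmono (r s : Z2) : Omega K :=
  mono (r + s) (r.1%:~R : K^o, r.2%:~R : K^o).

Definition d_laurent (f : laurent K^o) : Omega K :=
  lin_ext (fun r (c : K^o) => (c : K) *: mono_dmono r 0) f.

Fact d_laurent_is_linear : linear d_laurent.
Proof. by apply: lin_ext_is_linear => r a u v; rewrite scalerDl scalerA. Qed.

Definition exact_pred : {pred Omega K} := fun w => `[< exists f, w = d_laurent f >].

Fact exact_submod_closed : submod_closed exact_pred.
Proof.
split.
  apply/asboolP; exists 0; have := d_laurent_is_linear (-1) 0 0.
  by rewrite scaler0 addr0 scaleN1r addNr.
move=> a x y /asboolP[f ->] /asboolP[g ->]; apply/asboolP.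
by exists (a *: f + g); rewrite d_laurent_is_linear.
Qed.
HB.instance Definition _ :=
  GRing.isSubmodClosed.Build K (Omega K) exact_pred exact_submod_closed.

(* Omega^1 / dR; the library quotient is only a group, so we add scaling *)
Definition dkahler : Type := Quotient.quot exact_pred.
HB.instance Definition _ := GRing.Zmodule.on dkahler.

Definition kclass (w : Omega K) : dkahler := (\pi_(Quotient.quot exact_pred) w)%qT.

Definition dkahler_scale (a : K) (z : dkahler) : dkahler :=
  kclass (a *: repr (z : Quotient.quot exact_pred)).

Fact kclass_is_zmod_morphism : zmod_morphism kclass.
Proof. by move=> u v; rewrite /kclass raddfB. Qed.
HB.instance Definition _ := GRing.isZmodMorphism.Build (Omega K) dkahler
  kclass kclass_is_zmod_morphism.

Lemma kclassP z : exists w, z = kclass w.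
Proof. by exists (repr (z : Quotient.quot exact_pred)); rewrite /kclass reprK. Qed.

Lemma kclass_eq0 w : kclass w = 0 <-> exists f, w = d_laurent f.
Proof.
rewrite -[0](raddf0 kclass); split=> [/eqP|wd].
  by rewrite /kclass -Quotient.idealrBE subr0 => /asboolP.
by apply/eqP; rewrite /kclass -Quotient.idealrBE subr0; apply/asboolP.
Qed.

Let scale_kclass a w : dkahler_scale a (kclass w) = kclass (a *: w).
Proof.
apply/eqP; rewrite /dkahler_scale /kclass -Quotient.idealrBE -scalerBr.
by rewrite rpredZ // Quotient.idealrBE reprK.
Qed.

Fact dkahler_scaleA a b z :
  dkahler_scale a (dkahler_scale b z) = dkahler_scale (a * b) z.
Proof. by have [w ->] := kclassP z; rewrite !scale_kclass scalerA. Qed.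
Fact dkahler_scale1 : left_id 1 dkahler_scale.
Proof. by move=> z; have [w ->] := kclassP z; rewrite scale_kclass scale1r. Qed.
Fact dkahler_scaleDr : right_distributive dkahler_scale +%R.
Proof.
move=> a y z; have [u ->] := kclassP y; have [v ->] := kclassP z.
by rewrite -raddfD !scale_kclass scalerDr raddfD.
Qed.
Fact dkahler_scaleDl z : {morph dkahler_scale^~ z : a b / a + b}.
Proof.
by move=> a b; have [w ->] := kclassP z; rewrite !scale_kclass scalerDl raddfD.
Qed.
HB.instance Definition _ := GRing.Zmodule_isLmodule.Build K dkahler
  dkahler_scaleA dkahler_scale1 dkahler_scaleDr dkahler_scaleDl.

Fact kclass_is_scalable : scalable kclass.
Proof. by move=> a w; rewrite -scale_kclass. Qed.
HB.instance Definition _ := GRing.isScalable.Build K (Omega K) dkahler _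
  kclass kclass_is_scalable.

(* the class of t^r (a k_0 + b k_1) *)
Definition tk (r : Z2) (a b : K) : dkahler := kclass (mono r (a : K^o, b : K^o)).

End Kahler.

Section Linear0.
Variables (K : fieldType) (V W : lmodType K) (f : V -> W).
Hypothesis lf : linear f.
Lemma lin_eq0 : f 0 = 0.
Proof. by have := lf (-1) 0 0; rewrite scaler0 addr0 scaleN1r addNr. Qed.
Lemma lin_eqD u v : f (u + v) = f u + f v.
Proof. by have := lf 1 u v; rewrite !scale1r. Qed.
Lemma lin_eqZ a u : f (a *: u) = a *: f u.
Proof. by have := lf a u 0; rewrite !addr0 lin_eq0 addr0. Qed.
Lemma lin_eqN u : f (- u) = - f u.
Proof. by rewrite -scaleN1r lin_eqZ scaleN1r. Qed.
Lemma lin_eqB u v : f (u - v) = f u - f v.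
Proof. by rewrite lin_eqD lin_eqN. Qed.
End Linear0.

Section BilinearExtension.
Variables (K : fieldType) (U V W : lmodType K) (B : Z2 -> Z2 -> U -> V -> W).

(* the bilinear extension of (u t^r, v t^s) |-> B r s u v *)
Definition bilin_ext (x : laurent U) (y : laurent V) : W :=
  lin_ext (fun r u => lin_ext (fun s v => B r s u v) y) x.

Hypothesis linBr : forall r s u, linear (B r s u).
Hypothesis linBl : forall r s v, linear ((B r s)^~ v).

Let linF r y : linear (fun u => lin_ext (fun s v => B r s u v) y).
Proof.
move=> a u u'; have linr w := lin_ext_is_linear (fun s => linBr r s w).
elim/laurent_ind: y => [|y z IHy IHz|s v].
- by rewrite !(lin_eq0 (linr _)) scaler0 addr0.
- by rewrite !(lin_eqD (linr _)) IHy IHz scalerDr addrACA.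
- by rewrite !lin_ext_mono // linBl.
Qed.

Lemma bilin_ext_linearr x : linear (bilin_ext x).
Proof.
move=> a y z; rewrite /bilin_ext.
have lx y' := lin_ext_is_linear (fun r => @linF r y').
elim/laurent_ind: x => [|x x' IHx IHx'|r u].
- by rewrite !(lin_eq0 (lx _)) scaler0 addr0.
- by rewrite !(lin_eqD (lx _)) IHx IHx' scalerDr addrACA.
- by rewrite !lin_ext_mono // lin_ext_is_linear.
Qed.

Lemma bilin_ext_linearl y : linear (bilin_ext^~ y).
Proof. exact: lin_ext_is_linear. Qed.

Lemma bilin_ext_mono r s u v : bilin_ext (mono r u) (mono s v) = B r s u v.
Proof. by rewrite /bilin_ext !lin_ext_mono. Qed.

End BilinearExtension.

Section Degree.
Variables (K : fieldType) (V : lmodType K).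

(* action of a_0 d_0 + a_1 d_1 with d_j = t_j d/dt_j *)
Definition degree (a : K^o * K^o) (x : laurent V) : laurent V :=
  lin_ext (fun r v => (a.1 * r.1%:~R + a.2 * r.2%:~R : K) *: mono r v) x.

Let linF (a : K^o * K^o) r :
  linear (fun v : V => (a.1 * r.1%:~R + a.2 * r.2%:~R : K) *: mono r v).
Proof. by move=> c u v; rewrite linearP scalerDr !scalerA mulrC. Qed.

Lemma degree_is_linear a : linear (degree a).
Proof. exact/lin_ext_is_linear. Qed.

Lemma degree_mono a r v :
  degree a (mono r v) = (a.1 * r.1%:~R + a.2 * r.2%:~R : K) *: mono r v.
Proof. exact: lin_ext_mono. Qed.

Lemma degree_linearl x : linear (degree^~ x).
Proof.
move=> c a b; elim/laurent_ind: x => [|x y IHx IHy|r v].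
- by rewrite !(lin_eq0 (degree_is_linear _)) scaler0 addr0.
- by rewrite !(lin_eqD (degree_is_linear _)) IHx IHy scalerDr addrACA.
- rewrite !degree_mono scalerA -scalerDl; congr (_ *: _) => /=.
  by rewrite /GRing.scale /=; ring.
Qed.

Lemma degreeC a b x : degree a (degree b x) = degree b (degree a x).
Proof.
elim/laurent_ind: x => [|x y IHx IHy|r v].
- by rewrite !(lin_eq0 (degree_is_linear _)).
- by rewrite !(lin_eqD (degree_is_linear _)) IHx IHy.
- rewrite !degree_mono !(lin_eqZ (degree_is_linear _)) !degree_mono !scalerA.
  by rewrite mulrC.
Qed.

End Degree.

Section DegreeKahler.
Variable K : fieldType.

Lemma degree_exact a (f : laurent K^o) :
  degree a (d_laurent f) = d_laurent (degree a f).
Proof.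
have ld := @d_laurent_is_linear K; have lg V := @degree_is_linear K V a.
elim/laurent_ind: f => [|x y IHx IHy|r v].
- by rewrite !(lin_eq0 ld, lin_eq0 (lg _)).
- by rewrite !(lin_eqD ld, lin_eqD (lg _)) IHx IHy.
- rewrite degree_mono (lin_eqZ ld) /d_laurent lin_ext_mono; last first.
    by move=> s c u u'; rewrite scalerDl scalerA.
  by rewrite (lin_eqZ (lg _)) degree_mono !scalerA /mono_dmono !addr0 mulrC.
Qed.

Definition dkahler_degree a (z : dkahler K) : dkahler K :=
  kclass (degree a (repr (z : Quotient.quot (exact_pred (K:=K))))).

Lemma dkahler_degreeE a w : dkahler_degree a (kclass w) = kclass (degree a w).
Proof.
apply/eqP; rewrite -subr_eq0 -raddfB /=; apply/eqP/kclass_eq0.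
rewrite -(lin_eqB (degree_is_linear a)).
suff /kclass_eq0[f ->] : kclass (repr (kclass w : Quotient.quot (exact_pred (K:=K))) - w) = 0.
  by exists (degree a f); rewrite degree_exact.
by rewrite raddfB /= {1}/kclass reprK subrr.
Qed.

Lemma dkahler_degree_is_linear a : linear (dkahler_degree a).
Proof.
move=> c y z; have [u ->] := kclassP y; have [v ->] := kclassP z.
by rewrite -linearP !dkahler_degreeE degree_is_linear linearP.
Qed.

Lemma dkahler_degree_linearl z : linear (dkahler_degree^~ z).
Proof.
by have [u ->] := kclassP z => c a b; rewrite !dkahler_degreeE degree_linearl linearP.
Qed.

Lemma dkahler_degreeC a b z :
  dkahler_degree a (dkahler_degree b z) = dkahler_degree b (dkahler_degree a z).
Proof. by have [u ->] := kclassP z; rewrite !dkahler_degreeE degreeC. Qed.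

End DegreeKahler.

(* Characteristic zero: [X, X] = 0 uses 2 <> 0, as f df = d(f^2) / 2. *)
Section Toroidal.
Variables (K : numFieldType) (L : vectLieAlgType K).
Implicit Types (x y z : laurent L).

Definition loop_lie x y : laurent L :=
  bilin_ext (fun r s u v => mono (r + s) (lie u v)) x y.

(* (g1, g2) f2 df1 for g1 (x) f1 and g2 (x) f2 *)
Definition cocycle x y : dkahler K :=
  bilin_ext (fun r s u v => killing {:L} u v *: kclass (mono_dmono K r s)) x y.

Let ll_r r s (u : L) : linear (fun v => mono (r + s : Z2) (lie u v)).
Proof. by move=> a v w; rewrite lie_linearr linearP. Qed.
Let ll_l r s (v : L) : linear (fun u => mono (r + s : Z2) (lie u v)).
Proof. by move=> a u w; rewrite lie_linearl linearP. Qed.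
Let cc_r r s (u : L) :
  linear (fun v => killing {:L} u v *: kclass (mono_dmono K r s)).
Proof. by move=> a v w; rewrite killing_linearr scalerDl scalerA. Qed.
Let cc_l r s (v : L) :
  linear (fun u => killing {:L} u v *: kclass (mono_dmono K r s)).
Proof. by move=> a u w; rewrite killing_linearl scalerDl scalerA. Qed.

Lemma loop_lie_linearr x : linear (loop_lie x).
Proof. exact: bilin_ext_linearr. Qed.
Lemma loop_lie_linearl y : linear (loop_lie^~ y).
Proof. exact: bilin_ext_linearl. Qed.
Lemma loop_lie_mono r s u v :
  loop_lie (mono r u) (mono s v) = mono (r + s) (lie u v).
Proof. exact: bilin_ext_mono. Qed.
Lemma cocycle_linearr x : linear (cocycle x).
Proof. exact: bilin_ext_linearr. Qed.
Lemma cocycle_linearl y : linear (cocycle^~ y).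
Proof. exact: bilin_ext_linearl. Qed.
Lemma cocycle_mono r s u v :
  cocycle (mono r u) (mono s v) = killing {:L} u v *: kclass (mono_dmono K r s).
Proof. exact: bilin_ext_mono. Qed.

Let LE : ((forall x, loop_lie x 0 = 0) * (forall y, loop_lie 0 y = 0)) *
  ((forall x, cocycle x 0 = 0) * (forall y, cocycle 0 y = 0)) *
  ((forall a, degree a (0 : laurent L) = 0) * (forall a, dkahler_degree a (0 : dkahler K) = 0)).
Proof.
split; [split|]; split=> t; first exact: lin_eq0 (loop_lie_linearr t).
- exact: lin_eq0 (loop_lie_linearl t).
- exact: lin_eq0 (cocycle_linearr t).
- exact: lin_eq0 (cocycle_linearl t).
- exact: lin_eq0 (degree_is_linear t).
- exact: lin_eq0 (dkahler_degree_is_linear t).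
Qed.
Let LD : ((forall x y z, loop_lie x (y + z) = loop_lie x y + loop_lie x z) *
   (forall x y z, loop_lie (y + z) x = loop_lie y x + loop_lie z x)) *
  ((forall x y z, cocycle x (y + z) = cocycle x y + cocycle x z) *
   (forall x y z, cocycle (y + z) x = cocycle y x + cocycle z x)) *
  ((forall a y z, degree a (y + z : laurent L) = degree a y + degree a z) *
   (forall a u v, dkahler_degree a (u + v : dkahler K) = dkahler_degree a u + dkahler_degree a v)).
Proof.
split; [split|]; split=> t u v; first exact: lin_eqD (loop_lie_linearr t) u v.
- exact: lin_eqD (loop_lie_linearl t) u v.
- exact: lin_eqD (cocycle_linearr t) u v.
- exact: lin_eqD (cocycle_linearl t) u v.
- exact: lin_eqD (degree_is_linear t) u v.
- exact: lin_eqD (dkahler_degree_is_linear t) u v.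
Qed.
Let LZ : ((forall x c z, loop_lie x (c *: z) = c *: loop_lie x z) *
   (forall x c z, loop_lie (c *: z) x = c *: loop_lie z x)) *
  ((forall x c z, cocycle x (c *: z) = c *: cocycle x z) *
   (forall x c z, cocycle (c *: z) x = c *: cocycle z x)) *
  ((forall a c z, degree a (c *: z : laurent L) = c *: degree a z) *
   (forall a c v, dkahler_degree a (c *: v : dkahler K) = c *: dkahler_degree a v)).
Proof.
split; [split|]; split=> t u v; first exact: lin_eqZ (loop_lie_linearr t) u v.
- exact: lin_eqZ (loop_lie_linearl t) u v.
- exact: lin_eqZ (cocycle_linearr t) u v.
- exact: lin_eqZ (cocycle_linearl t) u v.
- exact: lin_eqZ (degree_is_linear t) u v.
- exact: lin_eqZ (dkahler_degree_is_linear t) u v.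
Qed.
Let LN : ((forall x z, loop_lie x (- z) = - loop_lie x z) *
   (forall x z, loop_lie (- z) x = - loop_lie z x)) *
  ((forall x z, cocycle x (- z) = - cocycle x z) *
   (forall x z, cocycle (- z) x = - cocycle z x)) *
  ((forall a z, degree a (- z : laurent L) = - degree a z) *
   (forall a v, dkahler_degree a (- v : dkahler K) = - dkahler_degree a v)).
Proof. by do ![split] => t u; rewrite -!scaleN1r !LZ. Qed.

Let mdd r s c : (c : K) *: kclass (mono_dmono K r s) = 
  kclass (mono (r + s) (c * r.1%:~R : K^o, c * r.2%:~R : K^o)).
Proof. by rewrite -linearZ /mono_dmono -linearZ. Qed.

Let exact0 r c : kclass (mono r (c * r.1%:~R : K^o, c * r.2%:~R : K^o)) = 0.
Proof.
have := mdd r 0 c; rewrite addr0 => <-; rewrite -linearZ; apply/kclass_eq0.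
exists (mono r (c : K^o)); rewrite /d_laurent lin_ext_mono //.
by move=> s a u v; rewrite scalerDl scalerA.
Qed.

Lemma loop_lieC x y : loop_lie x y = - loop_lie y x.
Proof.
elim/laurent_ind: x => [|x x' IHx IHx'|r u].
- by rewrite !LE oppr0.
- by rewrite !LD IHx IHx' opprD.
elim/laurent_ind: y => [|y y' IHy IHy'|s v].
- by rewrite !LE oppr0.
- by rewrite !LD IHy IHy' opprD.
by rewrite !loop_lie_mono lieC linearN addrC.
Qed.

Lemma cocycleC x y : cocycle x y = - cocycle y x.
Proof.
elim/laurent_ind: x => [|x x' IHx IHx'|r u].
- by rewrite !LE oppr0.
- by rewrite !LD IHx IHx' opprD.
elim/laurent_ind: y => [|y y' IHy IHy'|s v].
- by rewrite !LE oppr0.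
- by rewrite !LD IHy IHy' opprD.
rewrite !cocycle_mono (killingC v); apply/eqP; rewrite -addr_eq0 !mdd.
rewrite (addrC s r) -2!linearD; apply/eqP.
rewrite -[RHS](exact0 (r + s) (killing {:L} u v)); congr (kclass (mono _ _)).
by rewrite /= !intrD; congr pair; rewrite /= -mulrDr.
Qed.

Lemma loop_liexx x : loop_lie x x = 0.
Proof.
elim/laurent_ind: x => [|x x' IHx IHx'|r u].
- by rewrite !LE.
- by rewrite !LD IHx IHx' addr0 add0r (loop_lieC x' x) addNr.
by rewrite loop_lie_mono liexx linear0.
Qed.

Lemma cocyclexx x : cocycle x x = 0.
Proof.
elim/laurent_ind: x => [|x x' IHx IHx'|r u].
- by rewrite !LE.
- by rewrite !LD IHx IHx' addr0 add0r (cocycleC x' x) addNr.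
rewrite cocycle_mono mdd -[RHS](exact0 (r + r) (killing {:L} u u / 2)).
by congr (kclass (mono _ _)); rewrite /= !intrD; congr pair; field.
Qed.

Lemma loop_lie_jacobi x y z : loop_lie x (loop_lie y z)
  + loop_lie y (loop_lie z x) + loop_lie z (loop_lie x y) = 0.
Proof.
have AC (V : zmodType) (a b c a' b' c' : V) : a + b + c = 0 -> a' + b' + c' = 0 ->
    (a + a') + (b + b') + (c + c') = 0.
  by move=> E E'; rewrite (addrACA a) (addrACA (a + b)) E E' addr0.
elim/laurent_ind: x => [|x x' IHx IHx'|r u].
- by rewrite !LE !addr0.
- by rewrite !LD; apply: AC.
elim/laurent_ind: y => [|y y' IHy IHy'|s v].
- by rewrite !LE !addr0.
- by rewrite !LD; apply: AC.
elim/laurent_ind: z => [|z z' IHz IHz'|p w].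
- by rewrite !LE !addr0.
- by rewrite !LD; apply: AC.
rewrite !loop_lie_mono (addrC p r) (addrCA s r p) (addrC p (r + s)) -(addrA r).
by rewrite -!linearD lie_jacobi linear0.
Qed.

Lemma cocycle_jacobi x y z : cocycle x (loop_lie y z)
  + cocycle y (loop_lie z x) + cocycle z (loop_lie x y) = 0.
Proof.
have AC (V : zmodType) (a b c a' b' c' : V) : a + b + c = 0 -> a' + b' + c' = 0 ->
    (a + a') + (b + b') + (c + c') = 0.
  by move=> E E'; rewrite (addrACA a) (addrACA (a + b)) E E' addr0.
elim/laurent_ind: x => [|x x' IHx IHx'|r u].
- by rewrite !LE !addr0.
- by rewrite !LD; apply: AC.
elim/laurent_ind: y => [|y y' IHy IHy'|s v].
- by rewrite !LE !addr0.
- by rewrite !LD; apply: AC.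
elim/laurent_ind: z => [|z z' IHz IHz'|p w].
- by rewrite !LE !addr0.
- by rewrite !LD; apply: AC.
rewrite !loop_lie_mono !cocycle_mono.
rewrite (killingC v) (killing_invariant w) (killingC w) (killing_invariant u).
rewrite !mdd (addrC p r) (addrCA s r p) (addrC p (r + s)) -(addrA r).
set c := killing _ _ _; rewrite -!linearD.
rewrite -[RHS](exact0 (r + (s + p)) c); congr (kclass (mono _ _)).
by congr pair; rewrite /= !intrD !mulrDr addrA.
Qed.

Lemma degree_loop a x y :
  degree a (loop_lie x y) = loop_lie (degree a x) y + loop_lie x (degree a y).
Proof.
elim/laurent_ind: x => [|x x' IHx IHx'|r u].
- by rewrite !LE addr0.
- by rewrite !LD IHx IHx' addrACA.
elim/laurent_ind: y => [|y y' IHy IHy'|s v].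
- by rewrite !LE addr0.
- by rewrite !LD IHy IHy' addrACA.
rewrite !(loop_lie_mono, degree_mono, LZ) -scalerDl; congr (_ *: _).
by rewrite /= !intrD; ring.
Qed.

Lemma degree_cocycle a x y : dkahler_degree a (cocycle x y) =
  cocycle (degree a x) y + cocycle x (degree a y).
Proof.
elim/laurent_ind: x => [|x x' IHx IHx'|r u].
- by rewrite !LE addr0.
- by rewrite !LD IHx IHx' addrACA.
elim/laurent_ind: y => [|y y' IHy IHy'|s v].
- by rewrite !LE addr0.
- by rewrite !LD IHy IHy' addrACA.
rewrite !(cocycle_mono, degree_mono, LZ) -scalerDl dkahler_degreeE.
rewrite degree_mono linearZ /= !scalerA mulrC; congr (_ * _ *: _).
by rewrite /= !intrD; ring.
Qed.

(* (x, z, (a0, a1)) stands for x + z + a0 d_0 + a1 d_1 in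
   L[t_0^{+-1}, t_1^{+-1}] + Omega^1 / dR + K d_0 + K d_1 *)
Definition toroidal : Type := (laurent L * dkahler K * (K^o * K^o))%type.
HB.instance Definition _ :=
  GRing.Lmodule.copy toroidal (laurent L * dkahler K * (K^o * K^o))%type.

Definition tor_lie (X Y : toroidal) : toroidal :=
  (loop_lie X.1.1 Y.1.1 + degree X.2 Y.1.1 - degree Y.2 X.1.1,
   cocycle X.1.1 Y.1.1 + dkahler_degree X.2 Y.1.2 - dkahler_degree Y.2 X.1.2,
   0).

Let tor_eq (X Y : toroidal) :
  X.1.1 = Y.1.1 -> X.1.2 = Y.1.2 -> X.2 = Y.2 -> X = Y.
Proof. by case: X Y => [[x z] a] [[y w] b] /= -> -> ->. Qed.

Let torP c (X Y : toroidal) : (((c *: X + Y : toroidal).1.1 = c *: X.1.1 + Y.1.1) *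
  ((c *: X + Y : toroidal).1.2 = c *: X.1.2 + Y.1.2) * ((c *: X + Y : toroidal).2 = c *: X.2 + Y.2)).
Proof. by []. Qed.
Let torD (X Y : toroidal) : (((X + Y : toroidal).1.1 = X.1.1 + Y.1.1) *
  ((X + Y : toroidal).1.2 = X.1.2 + Y.1.2) * ((X + Y : toroidal).2 = X.2 + Y.2)).
Proof. by []. Qed.
Let torN (X : toroidal) : (((- X : toroidal).1.1 = - X.1.1) *
  ((- X : toroidal).1.2 = - X.1.2) * ((- X : toroidal).2 = - X.2)).
Proof. by []. Qed.
Let tor0 : (((0 : toroidal).1.1 = 0) * ((0 : toroidal).1.2 = 0) * ((0 : toroidal).2 = 0)).
Proof. by []. Qed.
Let torlE X Y : (((tor_lie X Y).1.1 =
    loop_lie X.1.1 Y.1.1 + degree X.2 Y.1.1 - degree Y.2 X.1.1) *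
  ((tor_lie X Y).1.2 =
    cocycle X.1.1 Y.1.1 + dkahler_degree X.2 Y.1.2 - dkahler_degree Y.2 X.1.2) *
  ((tor_lie X Y).2 = 0)).
Proof. by []. Qed.

Fact tor_lie_linearl Y : linear (tor_lie^~ Y).
Proof.
move=> c X X'; rewrite -[LHS]/(tor_lie (c *: X + X') Y).
rewrite -[RHS]/(c *: tor_lie X Y + tor_lie X' Y).
have E (V : lmodType K) (p q r p' q' r' : V) :
    c *: p + p' + (c *: q + q') - (c *: r + r') = c *: (p + q - r) + (p' + q' - r').
  by rewrite (addrACA (c *: p)) opprD (addrACA (_ + _) _ (- _)) scalerBr scalerDr.
apply: tor_eq; rewrite torP !torlE ?torP.
- by rewrite loop_lie_linearl degree_linearl degree_is_linear E.
- by rewrite cocycle_linearl dkahler_degree_linearl dkahler_degree_is_linear E.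
- by rewrite scaler0 addr0.
Qed.

Let tor_lieC X Y : tor_lie X Y = - tor_lie Y X.
Proof.
have E (V : zmodType) (p q r : V) : - p + q - r = - (p + r - q).
  by rewrite opprB opprD [RHS]addrCA addrA.
apply: tor_eq; rewrite torN !torlE.
- by rewrite loop_lieC E.
- by rewrite cocycleC E.
- by rewrite oppr0.
Qed.

Fact tor_lie_linearr X : linear (tor_lie X).
Proof.
by move=> a Y Z; rewrite tor_lieC tor_lie_linearl opprD -scalerN -!tor_lieC.
Qed.

Fact tor_liexx X : tor_lie X X = 0.
Proof.
by apply: tor_eq; rewrite tor0 torlE ?loop_liexx ?cocyclexx ?add0r ?subrr.
Qed.

Fact tor_lie_jacobi X Y Z :
  tor_lie X (tor_lie Y Z) + tor_lie Y (tor_lie Z X) + tor_lie Z (tor_lie X Y) = 0.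
Proof.
have E (V : zmodType) (A1 A2 A3 p q r s t e f g h : V) : A1 + A2 + A3 = 0 ->
    A1 + p - q + (r + s + e - f) + (A2 + g - s + (- p + t + h - e))
      + (A3 - r - t + (- g + q + f - h)) = 0.
  move=> EA; rewrite !addrA.
  rewrite [LHS](AC 21 ((1*8*15)*(2*11)*(19*3)*(4*16)*(5*10)*(6*14)*(20*7)*(9*18)
    *(12*17)*(13*21)))%AC.
  by rewrite /= EA !subrr !addr0.
have d0 (V : lmodType K) (x : laurent V) : degree 0 x = 0.
  exact: lin_eq0 (degree_linearl x).
have k0 (w : dkahler K) : dkahler_degree 0 w = 0.
  exact: lin_eq0 (dkahler_degree_linearl w).
apply: tor_eq; rewrite !torD !torlE tor0 ?d0 ?k0 ?subr0 ?addr0 //.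
- move: X.1.1 Y.1.1 Z.1.1 X.2 Y.2 Z.2 => x y u a b c.
  rewrite !LD.2.1 !LN.2.1 !LD.1.1.1 !LN.1.1.1 !degree_loop.
  rewrite (loop_lieC (degree b u)) (loop_lieC (degree c x)) (loop_lieC u (degree a y)).
  rewrite (degreeC b a) (degreeC c a) (degreeC c b).
  exact/E/loop_lie_jacobi.
- move: X.1.1 Y.1.1 Z.1.1 X.2 Y.2 Z.2 X.1.2 Y.1.2 Z.1.2 => x y u a b c z w v.
  rewrite !LD.2.2 !LN.2.2 !LD.1.2.1 !LN.1.2.1 !degree_cocycle.
  rewrite (cocycleC (degree b u)) (cocycleC (degree c x)) (cocycleC u (degree a y)).
  rewrite (dkahler_degreeC b a) (dkahler_degreeC c a) (dkahler_degreeC c b).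
  exact/E/cocycle_jacobi.
Qed.

HB.instance Definition _ := Lmodule_isLieAlgebra.Build K toroidal
  tor_lie_linearl tor_lie_linearr tor_liexx tor_lie_jacobi.

End Toroidal.

Definition spanned (K : fieldType) (V : lmodType K) (S : set V) : set V :=
  [set v | exists s : seq (K * V),
    (forall q, q \in s -> S q.2) /\ v = \sum_(q <- s) q.1 *: q.2].

Section Twisted.
Variables (R : realType) (L : vectLieAlgType R[i]).
Local Notation C := R[i].
Implicit Types (s : 'End(L)) (m n p q : int) (h : {vspace L}).

(* exp (2 pi i / n) *)
Definition root_of_unity (n : nat) : C :=
  (cos (2 * pi / n%:R) +i* sin (2 * pi / n%:R))%C.

Definition is_aut_order s (n : nat) : Prop :=
  [/\ (0 < n)%N, forall x, iter n s x = x &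
      forall k, (0 < k < n)%N -> exists x, iter k s x <> x].

(* the default 0 is irrelevant for automorphisms of finite order *)
Definition aut_order s : nat := xget 0%N (is_aut_order s).

Lemma aut_orderE s (n : nat) : is_aut_order s n -> aut_order s = n.
Proof.
move=> sn; rewrite /aut_order; case: xgetP => [m _ sm|/(_ n)//].
case: sm sn => m0 ms mmin [n0 ns nmin].
case: (ltngtP m n) => // [mn|nm].
- have /nmin[x] : (0 < m < n)%N by rewrite m0.
  by rewrite ms.
- have /mmin[x] : (0 < n < m)%N by rewrite n0.
  by rewrite ns.
Qed.

(* the joint eigenspace of g for the eigenvalues eps_0^p, eps_1^q *)
Definition grading s0 s1 p q : {vspace L} :=
  (passmx.leigenspace s0 (root_of_unity (aut_order s0) ^ p)
   :&: passmx.leigenspace s1 (root_of_unity (aut_order s1) ^ q))%VS.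

Definition kahler_sigma s0 s1 : set (dkahler C) :=
  spanned [set z | exists a b : int,
    let r : Z2 := (a *+ aut_order s0, b *+ aut_order s1) in
    z = tk r 1 0 \/ z = tk r 0 1].

(* g(sigma_0, sigma_1) as a subspace of the untwisted toroidal algebra *)
Definition twisted_toroidal s0 s1 : set (toroidal L) :=
  [set X : toroidal L | (forall m n, (X.1.1 : laurent L) (m, n) \in grading s0 s1 m n)
           /\ kahler_sigma s0 s1 X.1.2].

(* t + a_0 d_0 + a_1 d_1 + c_0 k_0 + c_1 k_1, the elements of the
   commutative subalgebra of g(sigma_0, sigma_1) attached to h *)
Definition tor_cartan h (t : subvs_of h) (a0 a1 c0 c1 : C) : toroidal L :=
  (mono 0 (vsval t), tk 0 c0 c1, (a0 : C^o, a1 : C^o)).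

(* (alpha, (b0, b1)) stands for alpha + b0 delta_0 + b1 delta_1 *)
Definition weightV h : Type := ('Hom(subvs_of h, C^o) * (C^o * C^o))%type.
HB.instance Definition _ h :=
  GRing.Lmodule.copy (weightV h) ('Hom(subvs_of h, C^o) * (C^o * C^o))%type.

Definition inV h (alpha : 'Hom(subvs_of h, C^o)) : weightV h := (alpha, 0).
Definition delta0 h : weightV h := (0, (1 : C^o, 0 : C^o)).
Definition delta1 h : weightV h := (0, (0 : C^o, 1 : C^o)).

(* the value of beta on t + a_0 d_0 + a_1 d_1 + c_0 k_0 + c_1 k_1 *)
Definition weight_eval h (beta : weightV h) (t : subvs_of h) (a0 a1 : C) : C :=
  beta.1 t + beta.2.1 * a0 + beta.2.2 * a1.

Definition formV h (beta gamma : weightV h) : C :=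
  dual_form (killing {:L}) beta.1 gamma.1.

Definition weight_space s0 s1 h (beta : weightV h) : set (toroidal L) :=
  [set X | twisted_toroidal s0 s1 X /\
    forall t a0 a1 c0 c1,
      lie (tor_cartan t a0 a1 c0 c1) X = weight_eval beta t a0 a1 *: X].

Definition nonisotropic_roots s0 s1 h : set (weightV h) :=
  [set beta | formV beta beta <> 0 /\
    exists X, weight_space s0 s1 beta X /\ X <> 0].

End Twisted.

Arguments nonisotropic_roots {R L} s0 s1 h _.
Arguments delta0 {R L} h.
Arguments delta1 {R L} h.

Section Ad.
Variables (K : fieldType) (N : nat).

(* Ad(A) X = A X A^-1 on so_N; A is meant to normalize so_N, otherwise the
   result is projected back *)
Definition Ad (A : 'M[K]_N) : 'End(so K N) :=
  linfun (fun X : so K N => vsproj (skew_space K N) (A *m vsval X *m invmx A) : so K N).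

Fact Ad_fun_linear (A : 'M[K]_N) :
  linear (fun X : so K N => vsproj (skew_space K N) (A *m vsval X *m invmx A) : so K N).
Proof.
move=> a X Y; rewrite -[RHS]linearP; congr vsproj.
by rewrite vsval_is_linear mulmxDr mulmxDl -scalemxAr -scalemxAl.
Qed.

Lemma AdE (A : 'M[K]_N) (X : so K N) :
  A^T *m A = 1%:M -> vsval (Ad A X) = A *m vsval X *m invmx A.
Proof.
move=> AA; pose lm := GRing.isLinear.Build K _ _ _ _ (Ad_fun_linear A).
pose f : {linear so K N -> so K N} := HB.pack
  (fun X : so K N => vsproj (skew_space K N) (A *m vsval X *m invmx A) : so K N) lm.
rewrite /Ad -[X in linfun X]/(f : _ -> _) lfunE /= vsprojK //.
have uA : A \in unitmx by case: (mulmx1_unit AA).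
have -> : invmx A = A^T by rewrite -[invmx A]mul1mx -AA mulmxK.
by apply/skew_spaceP; rewrite !trmx_mul trmxK so_trmx mulNmx mulmxN mulmxA.
Qed.

Lemma Ad_lie (A : 'M[K]_N) (X Y : so K N) :
  A^T *m A = 1%:M -> Ad A (lie X Y) = lie (Ad A X) (Ad A Y).
Proof.
move=> AA; have uA : A \in unitmx by case: (mulmx1_unit AA).
have E (x y : 'M[K]_N) :
    A *m x *m invmx A *m (A *m y *m invmx A) = A *m (x *m y) *m invmx A.
  by rewrite !mulmxA mulmxKV.
apply: val_inj; rewrite [LHS]AdE // [RHS]so_lieE !AdE // !E [vsval _]so_lieE.
by rewrite mulmxBr mulmxBl.
Qed.

(* the matrix unit E_ij, with indices starting at 1 *)
Definition Emx (i j : nat) : 'M[K]_N :=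
  \matrix_(a, b) ((a.+1 == i) && (b.+1 == j))%:R.

End Ad.

Arguments Emx {K N} i j.

Section Sigma.
Variables (R : realType) (l : nat).
Local Notation C := R[i].
Local Notation N := (2 * l + 4)%N.

Definition sigma0_mx : 'M[C]_N :=
  - Emx (2 * l + 3) (2 * l + 3) - Emx (2 * l + 4) (2 * l + 4)
  + \sum_(1 <= i < 2 * l + 3) Emx i i.

Definition sigma1_mx : 'M[C]_N :=
  - Emx (2 * l + 2) (2 * l + 2) + Emx (2 * l + 3) (2 * l + 3)
  - Emx (2 * l + 4) (2 * l + 4) + \sum_(1 <= i < 2 * l + 2) Emx i i.

Definition sigma0 : 'End(so C N) := Ad sigma0_mx.
Definition sigma1 : 'End(so C N) := Ad sigma1_mx.

Let sgn_mx (P : pred nat) : 'M[C]_N := diag_mx (\row_i (-1) ^+ P i).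

Let sgn_mxP (A : 'M[C]_N) (P : pred nat) :
  (forall i j : 'I_N, A i j = if i == j then (-1) ^+ P i else 0) -> A = sgn_mx P.
Proof.
move=> E; apply/matrixP => i j; rewrite E !mxE.
by case: eqVneq => [->|]; rewrite ?mulr1n ?mulr0n.
Qed.

Let sum_Emx m (i j : 'I_N) :
  (\sum_(1 <= k < m) Emx k k : 'M[C]_N) i j = ((i == j) && (i.+1 < m)%N)%:R.
Proof.
rewrite summxE; elim: m => [|m IH]; first by rewrite big_geq // andbF.
have [->|m0] := posnP m; first by rewrite big_geq // ltnS ltn0 andbF.
rewrite big_nat_recr //= IH mxE -natrD -val_eqE /=; congr (_%:R).
case: (ltngtP i j) => ij /=; [lia|lia|].
by case: (ltngtP i.+1 m); lia.
Qed.

Let sigma0_mxE : sigma0_mx = sgn_mx (fun i => 2 * l + 2 <= i)%N.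
Proof.
apply: sgn_mxP => i j; rewrite mxE sum_Emx !mxE -val_eqE /=.
have iN := ltn_ord i; have jN := ltn_ord j.
have [ij|ij] := eqVneq (i : nat) (j : nat); last first.
  have E k : (i.+1 == k) && (j.+1 == k) = false by lia.
  by rewrite !E ?subr0 ?oppr0 ?addr0 //.
set b1 := (i.+1 == 2 * l + 3)%N && _; set b2 := (i.+1 == 2 * l + 4)%N && _.
set b3 := true && _; set b4 := (_ <= _)%N.
have : [|| [&& b1, ~~ b2, ~~ b3 & b4], [&& ~~ b1, b2, ~~ b3 & b4]
  | [&& ~~ b1, ~~ b2, b3 & ~~ b4]].
  by rewrite /b1 /b2 /b3 /b4; lia.
by case: b1 b2 b3 b4 => [] [] [] [] //= _; rewrite ?oppr0 ?subr0 ?add0r ?addr0.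
Qed.

Let sigma1_mxE :
  sigma1_mx = sgn_mx (fun i => (i == 2 * l + 1) || (i == 2 * l + 3))%N.
Proof.
apply: sgn_mxP => i j; rewrite mxE sum_Emx !mxE -val_eqE /=.
have iN := ltn_ord i; have jN := ltn_ord j.
have [ij|ij] := eqVneq (i : nat) (j : nat); last first.
  have E k : (i.+1 == k) && (j.+1 == k) = false by lia.
  by rewrite !E ?subr0 ?oppr0 ?addr0 //.
set b1 := (i.+1 == 2 * l + 2)%N && _; set b2 := (i.+1 == 2 * l + 3)%N && _.
set b3 := (i.+1 == 2 * l + 4)%N && _; set b4 := true && _; set b5 := _ || _.
have : [|| [&& b1, ~~ b2, ~~ b3, ~~ b4 & b5], [&& ~~ b1, b2, ~~ b3, ~~ b4 & ~~ b5],
  [&& ~~ b1, ~~ b2, b3, ~~ b4 & b5] | [&& ~~ b1, ~~ b2, ~~ b3, b4 & ~~ b5]].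
  rewrite /b1 /b2 /b3 /b4 /b5 -ij !andbb; move: (i : nat) iN => k kN.
  have : [|| k < 2 * l + 1, k == 2 * l + 1, k == 2 * l + 2 | k == 2 * l + 3]%N.
    by lia.
  by case/or4P => [h|/eqP->|/eqP->|/eqP->]; apply/or4P;
    [constructor 4|constructor 1|constructor 2|constructor 3]; lia.
by case: b1 b2 b3 b4 b5 => [] [] [] [] [] //= _;
   rewrite ?oppr0 ?subr0 ?add0r ?addr0.
Qed.

Let sgn_mx_mul P Q : sgn_mx P *m sgn_mx Q = sgn_mx (fun i => P i (+) Q i).
Proof.
rewrite mulmx_diag; congr diag_mx; apply/rowP => i.
by rewrite !mxE signr_addb.
Qed.

Let sgn_mx_sqr P : sgn_mx P *m sgn_mx P = 1%:M.
Proof.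
rewrite sgn_mx_mul -diag_const_mx; congr diag_mx; apply/rowP => i.
by rewrite !mxE addbb.
Qed.

Let sgn_mx_orth P : (sgn_mx P)^T *m sgn_mx P = 1%:M.
Proof. by rewrite tr_diag_mx sgn_mx_sqr. Qed.

Let sgn_mx_inv P : invmx (sgn_mx P) = sgn_mx P.
Proof.
have [_ u] := mulmx1_unit (sgn_mx_sqr P).
by rewrite -[LHS]mulmx1 -(sgn_mx_sqr P) mulKmx.
Qed.

Let Ad_sgnE P (X : so C N) (i j : 'I_N) :
  vsval (Ad (sgn_mx P) X) i j = (-1) ^+ (P i (+) P j) * vsval X i j.
Proof.
rewrite AdE // sgn_mx_inv mul_mx_diag mxE mul_diag_mx !mxE.
by rewrite mulrAC signr_addb.
Qed.

Let Ad_sgn_order (P : pred nat) (a b : 'I_N) : P a != P b -> is_aut_order (Ad (sgn_mx P)) 2.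
Proof.
move=> Pab; split=> // [X|[|[|k]] //= _].
  by apply/val_inj/matrixP => i j; rewrite /= !Ad_sgnE mulrA -signr_addb addbb mul1r.
have nab : a != b by apply: contraNneq Pab => ->.
have sE : delta_mx a b - delta_mx b a \in skew_space C N.
  by apply/skew_spaceP; rewrite linearB /= !trmx_delta opprB.
exists (Subvs sE) => /(congr1 (fun X : so C N => vsval X a b)); rewrite Ad_sgnE /= !mxE.
rewrite !eqxx (negPf nab) /= subr0 mulr1 -negb_add negbK in Pab *.
by rewrite Pab expr1 => /eqP; rewrite eq_sym -addr_eq0 -mulr2n pnatr_eq0.
Qed.

Lemma sigma0_order : is_aut_order sigma0 2.
Proof.
have a : (0 < N)%N by lia. have b : (2 * l + 2 < N)%N by lia.
rewrite /sigma0 sigma0_mxE; apply: (@Ad_sgn_order _ (Ordinal a) (Ordinal b)) => /=.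
by lia.
Qed.

Lemma sigma1_order : is_aut_order sigma1 2.
Proof.
have a : (2 * l + 1 < N)%N by lia. have b : (2 * l + 2 < N)%N by lia.
rewrite /sigma1 sigma1_mxE; apply: (@Ad_sgn_order _ (Ordinal a) (Ordinal b)) => /=.
by lia.
Qed.

Lemma sigma0_lie X Y : sigma0 (lie X Y) = lie (sigma0 X) (sigma0 Y).
Proof. by apply: Ad_lie; rewrite sigma0_mxE. Qed.

Lemma sigma1_lie X Y : sigma1 (lie X Y) = lie (sigma1 X) (sigma1 Y).
Proof. by apply: Ad_lie; rewrite sigma1_mxE. Qed.

Lemma sigma_commute X : sigma0 (sigma1 X) = sigma1 (sigma0 X).
Proof.
apply/val_inj/matrixP => i j; rewrite /sigma0 /sigma1 sigma0_mxE sigma1_mxE /=.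
rewrite [LHS]Ad_sgnE [RHS]Ad_sgnE [in LHS]Ad_sgnE [in RHS]Ad_sgnE.
exact: mulrCA.
Qed.

End Sigma.

(* Main.v *)
Require Import Defs.
From HB Require Import structures.
From mathcomp Require Import all_boot all_order all_algebra.
From mathcomp Require Import complex ring zify.
From mathcomp Require Import all_classical all_reals all_analysis.

(**
  Everything is reduced to linear algebra in C^(2l+1).  A Cartan subalgebra h of
  g_(0,0) = so_(2l+1) equals its own generalized centralizer (Engel), so it
  contains the semisimple part of each of its elements.  Diagonalize all these
  semisimple parts at once: if v and w have opposite weights, then the skew
  matrix v w^T - w v^T lies in h.  Applying this to weight vectors shows that
  every weight has multiplicity one; the weights come in opposite pairs, plus
  the weight 0 since 2l+1 is odd.  Hence h is diagonal in a hyperbolic basis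
  (v_a) of weights +-eps_i and 0, and the v_a w^T - w v_a^T with w another v_b
  or one of the last three coordinate vectors e_k are weight vectors spanning
  so_(2l+4).  The roots and their lengths are read off from them, the Killing
  form being a multiple of the trace form; a loop weight eps_a + eps_b with a, b
  both nonzero only occurs in even degrees, while v_a w^T - w v_a^T realizes
  eps_a in degree of any parity for a suitable w among e_k and the vector of
  weight 0.
*)

Set Implicit Arguments.
Unset Strict Implicit.
Unset Printing Implicit Defensive.

Import Order.TTheory GRing.Theory Num.Theory.

Local Open Scope ring_scope.

(** * Skew matrices and their Jordan decomposition *)

(** The last claim concerns every Cartan subalgebra h, given only as nilpotent and self-normalizing,
    and it is not reduced to a standard one by conjugacy. The elements of h are not known to be
    diagonalizable at the start, so only their semisimple parts provide weights; once the weight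
    spaces are lines, h preserves each of them and turns out to be diagonal.

    The signs of the last three coordinates under ([sigma0], [sigma1]) are the three nonzero
    elements of (Z/2)^2. Any two of them add up to the third: this is the origin of the trivial
    summand, spanned by E_jk - E_kj, in each degree other than (0,0).

    The Killing form of so_N is N - 2 times the trace form, hence the constants 2l - 1 for g_(0,0)
    and 2l + 2 for the whole algebra. Both are positive, so the two notions of length in the
    statement agree up to scale. The hypothesis l >= 2 supplies roots of both lengths, as short and
    long are defined by comparison, and the five indices used for simplicity. *)

Section DotProduct.
Variables (F : fieldType) (n : nat).
Implicit Types (u v w : 'cV[F]_n) (x : 'M[F]_n).

Definition dotv v w : F := (v^T *m w) 0 0.

Lemma dotvC v w : dotv v w = dotv w v.
Proof. by rewrite /dotv -[v^T *m w]trmxK trmx_mul trmxK mxE. Qed.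

Fact dotv_is_linear v : linear (dotv v : _ -> F^o).
Proof. by move=> a u w; rewrite /dotv mulmxDr -scalemxAr !mxE. Qed.
HB.instance Definition _ v :=
  GRing.isLinear.Build F _ F^o _ (dotv v) (dotv_is_linear v).

Lemma dotvDr u v w : dotv u (v + w) = dotv u v + dotv u w.
Proof. exact: linearD. Qed.
Lemma dotvBr u v w : dotv u (v - w) = dotv u v - dotv u w.
Proof. exact: linearB. Qed.
Lemma dotvNr v w : dotv v (- w) = - dotv v w.
Proof. exact: linearN. Qed.
Lemma dotvZr a v w : dotv v (a *: w) = a * dotv v w.
Proof. exact: linearZ. Qed.
Lemma dotvZl a v w : dotv (a *: v) w = a * dotv v w.
Proof. by rewrite dotvC dotvZr dotvC. Qed.
Lemma dotvDl u v w : dotv (v + w) u = dotv v u + dotv w u.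
Proof. by rewrite dotvC dotvDr !(dotvC u). Qed.
Lemma dotvBl u v w : dotv (v - w) u = dotv v u - dotv w u.
Proof. by rewrite dotvC dotvBr !(dotvC u). Qed.
Lemma dotv0 v : dotv v 0 = 0.
Proof. exact: linear0. Qed.
Lemma dot0v v : dotv 0 v = 0.
Proof. by rewrite dotvC dotv0. Qed.

Lemma dotv_mulmx v w : v^T *m w = (dotv v w)%:M.
Proof. exact: mx11_scalar. Qed.

End DotProduct.

Lemma dotvM (F : fieldType) m n (x : 'M[F]_(m, n)) (v : 'cV_n) (w : 'cV_m) :
  dotv (x *m v) w = dotv v (x^T *m w).
Proof. by rewrite /dotv trmx_mul mulmxA. Qed.

Section Wedge.
Variables (F : fieldType) (n : nat).
Implicit Types (u v w : 'cV[F]_n) (x : 'M[F]_n).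

Lemma dotv_skew x v w : x^T = - x -> dotv (x *m v) w = - dotv v (x *m w).
Proof. by move=> xs; rewrite dotvM xs mulNmx dotvNr. Qed.

Lemma outer_mul u v w : u *m v^T *m w = dotv v w *: u.
Proof. by rewrite -mulmxA dotv_mulmx mul_mx_scalar. Qed.

(** The exterior product v ^ w, realized as a skew matrix. By [wedge_comm] this is compatible with
    the action of skew matrices, so wedges of weight vectors are weight vectors. *)
Definition wedge v w : 'M[F]_n := v *m w^T - w *m v^T.

Lemma wedge_skew v w : (wedge v w)^T = - wedge v w.
Proof. by rewrite /wedge linearB /= !trmx_mul !trmxK opprB. Qed.

Lemma wedge_mul v w u : wedge v w *m u = dotv w u *: v - dotv v u *: w.
Proof. by rewrite /wedge mulmxBl !outer_mul. Qed.

Lemma wedgeC v w : wedge v w = - wedge w v.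
Proof. by rewrite /wedge opprB. Qed.

Lemma wedgeDl u v w : wedge (u + v) w = wedge u w + wedge v w.
Proof. by rewrite /wedge linearD /= mulmxDl mulmxDr opprD addrACA. Qed.

Lemma wedgeZl a v w : wedge (a *: v) w = a *: wedge v w.
Proof. by rewrite /wedge linearZ /= -scalemxAl -scalemxAr scalerBr. Qed.

Lemma wedgeZr a v w : wedge v (a *: w) = a *: wedge v w.
Proof. by rewrite wedgeC wedgeZl -scalerN -wedgeC. Qed.

Lemma wedge_comm x v w : x^T = - x ->
  x *m wedge v w - wedge v w *m x = wedge (x *m v) w + wedge v (x *m w).
Proof.
move=> xs; rewrite /wedge mulmxBr mulmxBl !mulmxA -!(mulmxA _ _ x).
have E u : u^T *m x = - (x *m u)^T by rewrite trmx_mul xs mulmxN opprK.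
rewrite !E !mulmxN !opprD !opprK addrACA [RHS]addrACA.
by congr (_ + _); rewrite addrC.
Qed.

End Wedge.

Section JordanChevalley.

(** Chinese remainders. Evaluated at a matrix whose eigenvalues are the elements of s, such a p
    yields the semisimple part once n is large enough. *)
Lemma poly_chinese (K : fieldType) (s : seq K) (n : nat) : uniq s ->
  exists p : {poly K}, forall a, a \in s -> ('X - a%:P) ^+ n %| p - a%:P.
Proof.
elim: s => [|a s IH] /=; first by exists 0.
case/andP=> sa /IH[p ps].
pose q := \prod_(b <- s) ('X - b%:P) ^+ n.
have copq : coprimep (('X - a%:P) ^+ n) q.
  rewrite /q big_seq; elim/big_rec: _ => [|b x bs IHx]; first exact: coprimep1.
  rewrite coprimepMr IHx andbT coprimep_expl // coprimep_expr //.
  rewrite coprimep_XsubC root_XsubC; apply: contraNneq sa => <- //.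
have [[u v] /=] := Bezout_coprimepP _ _ copq.
rewrite -size_poly_eq1 => /size_poly1P[c c0 E].
have {}E : c^-1%:P * v * q = 1 - c^-1%:P * u * ('X - a%:P) ^+ n.
  apply/eqP; rewrite eq_sym subr_eq -!mulrA -mulrDr addrC E.
  by rewrite -polyCM mulVf.
(* The Bezout product c^-1 v q is 1 modulo (X - a)^n and 0 modulo the other powers, so the
   correction changes p to a at the new point only. *)
exists (p + q * (c^-1%:P * v * (a%:P - p))) => b; rewrite inE => /predU1P[->|bs].
  have -> : p + q * (c^-1%:P * v * (a%:P - p)) - a%:P =
      (p - a%:P) * (1 - c^-1%:P * v * q) by ring.
  by rewrite E subKr mulrA dvdp_mull.
rewrite addrAC dvdp_addr ?ps // dvdp_mulr // /q.
by rewrite (big_rem b) //= dvdp_mulr.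
Qed.

(** With p = a modulo (X - a)^k at each eigenvalue a, the characteristic polynomial divides both the
    product of the p - a and (X - p)^k; Cayley-Hamilton finishes. Having the semisimple part as a
    polynomial in A makes it commute with whatever commutes with A and gives control of its
    transpose. *)
Lemma jordan_chevalley (C : closedFieldType) n (A : 'M[C]_n.+1) :
  exists p : {poly C}, exists2 s : seq C, uniq s &
    horner_mx (horner_mx A p) (\prod_(a <- s) ('X - a%:P)) = 0
    /\ exists k, (A - horner_mx A p) ^+ k = 0.
Proof.
have [r Er] := closed_field_poly_normal (char_poly A).
have {}Er : char_poly A = \prod_(z <- r) ('X - z%:P).
  by rewrite Er (monicP (char_poly_monic A)) scale1r.
pose s := undup r; pose k := size r.
have us : uniq s by exact: undup_uniq.
have [p ps] := poly_chinese k us.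
have dvA (q : {poly C}) : (forall a, a \in s -> ('X - a%:P) ^+ k %| q) ->
    horner_mx A q = 0.
  move=> qs; suff /dvdpP[w ->] : char_poly A %| q.
    by rewrite rmorphM /= Cayley_Hamilton mulr0.
  apply: (@dvdp_trans _ (\prod_(a <- s) ('X - a%:P) ^+ k)).
    rewrite Er -prodr_undup_exp_count -/s.
    elim: s {us ps qs} => [|a s IH]; rewrite ?big_nil // !big_cons.
    by apply: dvdp_mul IH; apply: dvdp_exp2l; exact: count_size.
  move: us qs; elim: s {ps} => [|a s IH] /=; first by rewrite big_nil dvd1p.
  case/andP=> sa us qs; rewrite big_cons Gauss_dvdp ?qs ?mem_head ?IH //.
    by move=> b bs; apply: qs; rewrite inE bs orbT.
  rewrite big_seq; elim/big_rec: _ => [|b x bs IHx]; first exact: coprimep1.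
  rewrite coprimepMr IHx andbT coprimep_expl // coprimep_expr //.
  rewrite coprimep_XsubC root_XsubC; apply: contraNneq sa => <- //.
exists p, s => //; split.
  rewrite -[LHS]/(horner_mx (horner_mx A p) _).
  have -> : horner_mx (horner_mx A p) (\prod_(a <- s) ('X - a%:P))
      = horner_mx A (\prod_(a <- s) (p - a%:P)).
    rewrite !rmorph_prod; apply: eq_bigr => a _ /=.
    by rewrite !rmorphB /= !horner_mx_X !horner_mx_C.
  apply: dvA => a sa; rewrite (big_rem a) //=.
  by apply: dvdp_mulr; apply: ps.
exists k; have -> : (A - horner_mx A p) ^+ k = horner_mx A (('X - p) ^+ k).
  by rewrite rmorphXn rmorphB /= horner_mx_X.
apply: dvA => a sa; apply: dvdp_exp2r.
have [k0|k0] := posnP k.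
  by move: sa; rewrite mem_undup; move/eqP: k0; rewrite size_eq0 => /eqP->.
have -> : 'X - p = ('X - a%:P) - (p - a%:P) by ring.
rewrite dvdp_sub // (dvdp_trans _ (ps a sa)) //.
by rewrite -[X in X %| _]expr1 dvdp_exp2l.
Qed.

End JordanChevalley.

Section NilpotentOperators.

(** In the binomial expansion of (f - g)^(a+b) every term f^i g^j has i >= a or j >= b. Nilpotency
    is assumed at z alone because ad of an element of a Cartan subalgebra is nilpotent only on that
    subalgebra. *)
Lemma iter_sub_nilp (V : zmodType) (f g : {additive V -> V}) (z : V) a b :
    (forall v, f (g v) = g (f v)) -> iter a f z = 0 -> iter b g z = 0 ->
  iter (a + b) (fun v => f v - g v) z = 0.
Proof.
move=> fg fz gz; pose h v := f v - g v.
have i0 (p : {additive V -> V}) i : iter i p 0 = 0.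
  by elim: i => //= i ->; rewrite raddf0.
have h0 i : iter i h 0 = 0 by elim: i => //= i ->; rewrite /h !raddf0 addr0.
have hB i u v : iter i h (u - v) = iter i h u - iter i h v.
  elim: i => //= i ->; rewrite /h (raddfB f) (raddfB g) !opprB addrACA.
  by rewrite [RHS]addrACA [- _ - _]addrC.
have fgi i v : g (iter i f v) = iter i f (g v).
  by elim: i => //= i IH; rewrite -fg IH.
have fgij i j v : iter j g (iter i f v) = iter i f (iter j g v).
  by elim: j => //= j ->; rewrite fgi.
have H s : forall i j, (a + b <= i + j + s)%N ->
    iter s h (iter i f (iter j g z)) = 0.
  elim: s => [|s IH] i j.
    rewrite addn0 => le_ab; have [bj|jb] := leqP b j.
      by rewrite -(subnK bj) iterD gz !i0.
    have ai : (a <= i)%N by lia.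
    by rewrite -fgij -(subnK ai) [iter (_ + a) f z]iterD fz !i0.
  move=> le_ab; rewrite iterSr {2}/h hB fgi.
  rewrite -[f (iter i f _)]/(iter i.+1 f _) -[g (iter j g z)]/(iter j.+1 g z).
  by rewrite !IH ?subrr //; lia.
exact: (H (a + b)%N 0%N 0%N).
Qed.

End NilpotentOperators.

Section AdMatrix.
Variables (C : closedFieldType) (n : nat).
Implicit Types A B x y z s u : 'M[C]_n.+1.

Definition mx_ad x z := x * z - z * x.

Fact mx_ad_is_additive x : zmod_morphism (mx_ad x).
Proof.
by move=> u v; rewrite /mx_ad mulrBr mulrBl !opprB addrACA [RHS]addrACA [- _ - _]addrC.
Qed.
HB.instance Definition _ x := GRing.isZmodMorphism.Build _ _ (mx_ad x)
  (mx_ad_is_additive x).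

Lemma mx_ad_comm s u z : s * u = u * s -> mx_ad s (mx_ad u z) = mx_ad u (mx_ad s z).
Proof.
move=> su; rewrite /mx_ad !mulrBr !mulrBl !mulrA su -!mulrA su.
by rewrite !opprB addrACA [RHS]addrACA [- _ - _]addrC.
Qed.

(** ad u is the difference of the left and right multiplications by u, which commute. *)
Lemma mx_ad_nilp u z k : u ^+ k = 0 -> iter (k + k) (mx_ad u) z = 0.
Proof.
move=> uk; apply: (iter_sub_nilp (f := mulmx u) (g := mulmxr u)) => [v||] /=.
- exact: mulmxA.
- suff -> i : iter i (mulmx u) z = u ^+ i *m z by rewrite uk mul0mx.
  by elim: i => [|i IH] /=; rewrite ?expr0 ?mul1mx // IH exprS -mulmxA.
- suff -> i : iter i (mulmxr u) z = z *m u ^+ i by rewrite uk mulmx0.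
  by elim: i => [|i IH] /=; rewrite ?expr0 ?mulmx1 // IH exprSr -mulmxA.
Qed.

(** After diagonalizing s, ad s multiplies the (i, j) entry by d_i - d_j, and a scalar with a
    vanishing power vanishes. *)
Lemma mx_ad_diag s z k : diagonalizable s -> iter k (mx_ad s) z = 0 -> mx_ad s z = 0.
Proof.
case=> P uP /(similar_diagLR uP)[d Es].
have uP' : invmx P \in unitmx by rewrite unitmx_inv.
have {}Es : s = invmx P * diag_mx d * P by rewrite Es conjumx // invmxK.
have PK : P * invmx P = 1 by exact: mulmxV.
have KP : invmx P * P = 1 by exact: mulVmx.
have E w : mx_ad s (invmx P * w * P) = invmx P * mx_ad (diag_mx d) w * P.
  rewrite Es /mx_ad mulrBr mulrBl.
  by congr (_ - _); rewrite !mulrA -(mulrA _ P (invmx P)) PK mulr1.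
pose w := P * z * invmx P.
have Ez : z = invmx P * w * P by rewrite /w !mulrA KP mul1r -mulrA KP mulr1.
have Ek j : iter j (mx_ad s) z = invmx P * iter j (mx_ad (diag_mx d)) w * P.
  by elim: j => [|j IH] //=; rewrite IH E.
have I0 x : invmx P * x * P = 0 -> x = 0.
  move=> /(congr1 (fun y => P * y * invmx P)).
  by rewrite !mulrA PK mul1r -mulrA PK mulr1 mulr0 mul0r.
rewrite Ek => /I0 wk; rewrite [X in mx_ad s X]Ez E.
suff -> : mx_ad (diag_mx d) w = 0 by rewrite mulr0 mul0r.
have F x i j : mx_ad (diag_mx d) x i j = (d 0 i - d 0 j) * x i j.
  by rewrite /mx_ad -!mulmxE mul_diag_mx mul_mx_diag !mxE mulrBl; congr (_ - _);
    rewrite mulrC.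
have Fk m i j : iter m (mx_ad (diag_mx d)) w i j = (d 0 i - d 0 j) ^+ m * w i j.
  by elim: m => [|m IH] /=; rewrite ?expr0 ?mul1r // F IH mulrA -exprS.
apply/matrixP => i j; rewrite F [RHS]mxE; have := Fk k i j; rewrite wk [LHS]mxE => /eqP.
by rewrite eq_sym mulf_eq0 expf_eq0 => /orP[/andP[_ /eqP->]|/eqP->];
  rewrite ?mul0r ?mulr0.
Qed.

(** The semisimple part of a skew y is skew: s + s^T = -(u + u^T) is diagonalizable, since s and s^T
    are commuting polynomials in y, and nilpotent, since u and u^T commute; hence it is 0. *)
Lemma skew_jordan y : y^T = - y -> exists s u, [/\ y = s + u, s * u = u * s,
  s^T = - s, diagonalizable s & exists k, u ^+ k = 0].
Proof.
move=> ys; have [p [r ur [pr [k yk]]]] := jordan_chevalley y.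
pose s := horner_mx y p; pose u := y - s.
have ysC : y * s = s * y by apply: comm_mx_horner.
have trX (x : 'M[C]_n.+1) i : (x ^+ i)^T = x^T ^+ i.
  elim: i => [|i IH]; rewrite ?expr0 ?trmx1 // exprSr -mulmxE trmx_mul IH exprS.
  by rewrite mulmxE.
have trH (x : 'M[C]_n.+1) (q : {poly C}) : (horner_mx x q)^T = horner_mx x^T q.
  elim/poly_ind: q => [|q c IH]; first by rewrite !rmorph0 trmx0.
  rewrite !rmorphD !rmorphM /= !horner_mx_X !horner_mx_C linearD /= tr_scalar_mx.
  rewrite -mulmxE trmx_mul IH; congr (_ + _).
  exact: comm_mx_horner.
have dg x : horner_mx x (\prod_(a <- r) ('X - a%:P)) = 0 -> diagonalizable x.
  move=> H; apply/diagonalizableP; exists r => //.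
  exact: mxminpoly_min.
have ds : diagonalizable s by exact: dg.
have dt : diagonalizable s^T by apply: dg; rewrite -trH pr trmx0.
have stC : s * s^T = s^T * s.
  rewrite /s trH ys; apply/comm_mx_horner/comm_mxN/comm_mx_sym.
  exact: comm_mx_horner.
have /codiagonalizableP[P uP /=] : 
    {in [:: s; s^T] &, forall A B, comm_mx A B} /\ {in [:: s;
      s^T], forall A, diagonalizable A}.
  split=> A.
    by move=> B; rewrite !inE => /orP[]/eqP-> /orP[]/eqP->.
  by rewrite !inE => /orP[]/eqP->.
rewrite andbT => /andP[/(similar_diagLR uP)[d Es] /(similar_diagLR uP)[e Et]].
exists s, u; split=> //; try by rewrite /u addrC subrK.
- by rewrite /u mulrBl mulrBr ysC.
- have uP' : invmx P \in unitmx by rewrite unitmx_inv.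
  have {}Es : s = invmx P * diag_mx d * P by rewrite Es conjumx // invmxK.
  have {}Et : s^T = invmx P * diag_mx e * P by rewrite Et conjumx // invmxK.
  have PK : P * invmx P = 1 by exact: mulmxV.
  have KP : invmx P * P = 1 by exact: mulVmx.
  pose D := s + s^T.
  have ED : D = invmx P * diag_mx (d + e) * P.
    by rewrite /D Et {1}Es linearD /= mulrDr mulrDl.
  have DX i : D ^+ i = invmx P * diag_mx (d + e) ^+ i * P.
    elim: i => [|i IH]; first by rewrite !expr0 mulr1 KP.
    by rewrite exprS IH ED exprS -!mulrA (mulrA P) PK mul1r.
  have EDu : D = - (u + u^T) by rewrite /u linearB /= ys addrACA subrr add0r opprD
    !opprK.
  have utC : GRing.comm u u^T.
    have c1 : GRing.comm s^T y.
      by rewrite /s trH ys; apply/comm_mx_sym/comm_mx_horner/comm_mxN.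
    rewrite /u linearB /= ys -comm_mxE; apply: comm_mxB; [apply: comm_mxN|];
      apply: comm_mx_sym; apply: comm_mxB => //.
  have Dk : D ^+ (k + k) = 0.
    rewrite EDu exprNn exprDn_comm // big1 ?mulr0 // => [[i /= ilt]] _.
    have [ki|ik] := leqP k i.
      by rewrite -trX -(subnK ki) exprD yk mulr0 trmx0 mulr0 mul0rn.
    have ki : (k <= k + k - i)%N by lia.
    by rewrite -{1}(subnK ki) exprD yk mulr0 mul0r mul0rn.
  suff D0 : D = 0 by apply/eqP; rewrite -addr_eq0 addrC -/D D0.
  have d0 : diag_mx (d + e) ^+ (k + k) = 0.
    move: Dk; rewrite DX => /(congr1 (fun y => P * y * invmx P)).
    by rewrite !mulrA PK mul1r -mulrA PK mulr1 mulr0 mul0r.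
  suff de0 : d + e = 0 by rewrite ED de0 linear0 mulr0 mul0r.
  apply/rowP => i; have dX m : diag_mx (d + e) ^+ m = diag_mx (\row_j (d + e) 0 j ^+ m).
    elim: m => [|m IH].
      by rewrite expr0 -[LHS]/(1%:M) -diag_const_mx; congr diag_mx; apply/rowP => j;
        rewrite !mxE expr0.
    by rewrite exprS IH -mulmxE mulmx_diag; congr diag_mx; apply/rowP => j;
      rewrite !mxE exprS.
  move: d0; rewrite dX => /matrixP/(_ i i); rewrite !mxE eqxx mulr1n => /eqP.
  by rewrite expf_eq0 => /andP[_ /eqP->].
- by exists k.
Qed.

End AdMatrix.

(** * Cartan subalgebras of so_(2l+1) *)

Section CartanOfSkew.
Variables (C : numClosedFieldType) (n : nat) (H : 'M[C]_n.+1 -> Prop).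
Implicit Types (v w : 'cV[C]_n.+1).

Hypothesis Hskew : forall x, H x -> x^T = - x.
Hypothesis Hnilp : forall x z, H x -> H z -> exists k, iter k (mx_ad x) z = 0.
Hypothesis Hmax : forall z, z^T = - z ->
  (forall x, H x -> exists k, iter k (mx_ad x) z = 0) -> H z.

Definition toral t := H t /\ diagonalizable t.

Lemma toral_central t z : toral t -> H z -> mx_ad t z = 0.
Proof. by case=> Ht dt Hz; have [k] := Hnilp Ht Hz; apply: mx_ad_diag. Qed.

Lemma toral_commute t z : toral t -> H z -> t *m z = z *m t.
Proof. by move=> Tt Hz; apply/eqP; rewrite -subr_eq0; apply/eqP/toral_central. Qed.

(** On H, ad s = ad y - ad u is nilpotent at each vector, and s is diagonalizable, so s centralizes
    H; [Hmax] then puts s into H. *)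
Lemma cartan_jordan y : H y -> exists s u, [/\ y = s + u, s * u = u * s, toral s &
  exists k, u ^+ k = 0].
Proof.
move=> Hy; have [s [u [Ey su ss ds [k uk]]]] := skew_jordan (Hskew Hy).
exists s, u; split=> //; last by exists k.
split=> //; apply: Hmax => // x Hx; exists 1%N => /=.
have [m ym] := Hnilp Hy Hx.
suff sx0 : mx_ad s x = 0 by rewrite /mx_ad -opprB -/(mx_ad s x) sx0 oppr0.
apply: (@mx_ad_diag _ _ _ _ (m + (k + k))%N ds).
have yu : y * u = u * y by rewrite Ey mulrDl mulrDr su.
have := iter_sub_nilp (f := mx_ad y) (g := mx_ad u) (fun z => mx_ad_comm z yu) ym
  (mx_ad_nilp x uk).
move=> <-; apply: eq_iter => z /=; rewrite /mx_ad Ey mulrDl mulrDr.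
by rewrite opprD addrACA addrK.
Qed.

Definition toral_weight (c : 'M[C]_n.+1 -> C) v := forall t, toral t -> t *m v = c t
  *: v.

(** The semisimple part of x in H annihilates v ^ w because the weights cancel. It commutes with the
    nilpotent part, so ad x acts on the iterates of v ^ w as ad of the nilpotent part, and [Hmax]
    applies. *)
Lemma wedge_cartan c v w : toral_weight c v -> toral_weight (fun t => - c t) w ->
  H (wedge v w).
Proof.
move=> cv cw; apply: Hmax => [|x Hx]; first exact: wedge_skew.
have [s [u [-> su ts [k uk]]]] := cartan_jordan Hx; exists (k + k)%N.
have sw0 : mx_ad s (wedge v w) = 0.
  rewrite /mx_ad -!mulmxE wedge_comm ?(Hskew ts.1) // cv // cw //.
  by rewrite wedgeZl wedgeZr scaleNr subrr.
rewrite -[RHS](mx_ad_nilp (wedge v w) uk).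
have E m : mx_ad s (iter m (mx_ad u) (wedge v w)) = 0.
  by elim: m => //= m IH; rewrite mx_ad_comm // IH raddf0.
elim: (k + k)%N => //= m ->; rewrite {1}/mx_ad mulrDl mulrDr opprD addrACA.
by rewrite -/(mx_ad s _) E add0r.
Qed.

(** Simultaneous diagonalization is available for a finite list; the dimension bounds how often the
    span of a list of toral elements can grow. *)
Lemma toral_list : exists2 s : seq 'M[C]_n.+1, (forall t, t \in s -> toral t) &
  forall t, toral t -> t \in << s >>%VS.
Proof.
have [m] := ubnP (\dim {: 'M[C]_n.+1} - \dim <<[::] : seq 'M[C]_n.+1>>)%N.
have : forall t, t \in [::] -> toral t by [].
elim: m [::] => // m IH s sT lt_m.
have [?|/existsNP[t /not_implyP[Tt ts]]] := pselect (forall t, toral t -> t \in << s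
  >>%VS).
  by exists s.
apply: (IH (t :: s)) => [t'|].
  by rewrite inE => /predU1P[->//|/sT].
have le_s : (<< s >> <= <<t :: s>>)%VS by rewrite span_cons addvSr.
have lt_s : (\dim << s >> < \dim <<t :: s>>)%N.
  rewrite ltn_neqAle dimvS // andbT (dimv_leqif_eq le_s).
  by apply: contra_notN ts => /eqP ->; rewrite memv_span ?mem_head.
rewrite ltnS in lt_m; apply: leq_trans lt_m; apply: ltn_sub2l => //.
by apply: leq_trans lt_s _; apply/dimvS/subvf.
Qed.

Lemma toral_basis : exists2 Q : 'M[C]_n.+1, Q \in unitmx &
  forall t, toral t -> exists d, t *m Q = Q *m diag_mx d.
Proof.
have [s sT Ts] := toral_list.
have /codiagonalizableP[P uP /allP Pd] : {in s &, forall A B, comm_mx A B} /\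
    {in s, forall A, diagonalizable A}.
  by split=> [A B /sT TA /sT[HB _]|A /sT[]//]; apply: toral_commute.
exists (invmx P); first by rewrite unitmx_inv.
move=> t /Ts ts; rewrite (coord_span (X := in_tuple s) ts).
elim/big_ind: _ => [|x y [d Ed] [e Ee]|i _].
- by exists 0; rewrite linear0 mulmx0 mul0mx.
- by exists (d + e); rewrite mulmxDl linearD /= mulmxDr Ed Ee.
have /Pd/(similar_diagLR uP)[d Ed] : s`_i \in s by rewrite mem_nth.
exists (coord (in_tuple s) i t *: d); rewrite -scalemxAl linearZ -scalemxAr /=.
by congr (_ *: _); rewrite Ed conjumx ?unitmx_inv // invmxK mulmxK.
Qed.

Section Basis.
Variables (Q : 'M[C]_n.+1).
Hypothesis uQ : Q \in unitmx.
Hypothesis QT : forall t, toral t -> exists d, t *m Q = Q *m diag_mx d.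

Let chi k t : C := (invmx Q *m t *m Q) k k.

Let chiP k : toral_weight (chi k) (col k Q).
Proof.
move=> t Tt; have [d Ed] := QT Tt.
have -> : chi k t = d 0 k by rewrite /chi -mulmxA Ed mulKmx // mxE eqxx mulr1n.
rewrite !colE mulmxA Ed -mulmxA scalemxAr; congr (_ *m _).
apply/colP => i; rewrite mul_diag_mx !mxE.
by case: eqP => [->|]; rewrite ?mulr0.
Qed.

Lemma col_weight k : exists c, toral_weight c (col k Q).
Proof. by exists (chi k); apply: chiP. Qed.

Lemma weight_opp c v k : toral_weight c v -> dotv v (col k Q) != 0 ->
  toral_weight (fun t => - c t) (col k Q).
Proof.
move=> cv vk t Tt; rewrite chiP //; congr (_ *: _).
have := dotv_skew v (col k Q) (Hskew Tt.1); rewrite cv // chiP // dotvZl dotvZr.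
by rewrite -mulNr => /(mulIf vk)->; rewrite opprK.
Qed.

Lemma weight_pairing c v : toral_weight c v -> v != 0 ->
  exists k, dotv v (col k Q) != 0 /\ toral_weight (fun t => - c t) (col k Q).
Proof.
move=> cv v0; have : v^T *m Q != 0.
  apply: contraNneq v0 => vQ; rewrite -[v]trmxK -[v^T](mulmxK uQ) vQ mul0mx.
  by rewrite trmx0.
case/rV0Pn => k vk; exists k.
have {}vk : dotv v (col k Q) != 0 by rewrite /dotv colE mulmxA -colE mxE.
by split=> //; apply: weight_opp vk.
Qed.

(** Multiplicity one. On the zero weight space all 2 x 2 Gram determinants vanish although the form
    is nondegenerate there. For a nonzero weight, a second independent vector would be an
    eigenvector of a nilpotent matrix with a nonzero eigenvalue. *)
Lemma weight_line c v w : toral_weight c v -> v != 0 -> toral_weight c w ->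
  exists a, w = a *: v.
Proof.
move=> cv v0 cw.
have uXE (u : 'M[C]_n.+1) (a : C) (x : 'cV_n.+1) k : u *m x = a *: x -> u ^+ k *m x =
  a ^+ k *: x.
  move=> ux; elim: k => [|k IH]; first by rewrite mul1mx expr0 scale1r.
  by rewrite exprSr -mulmxE -mulmxA ux -scalemxAr IH scalerA exprS.
have uX0 (u : 'M[C]_n.+1) (a : C) (x : 'cV_n.+1) k : u ^+ k = 0 -> u *m x = a *: x ->
  x != 0 -> a = 0.
  move=> uk ux x0; have := uXE u a x k ux; rewrite uk mul0mx => /esym/eqP.
  by rewrite scaler_eq0 (negPf x0) orbF expf_eq0 => /andP[_ /eqP].
have wB a x y : toral_weight c x -> toral_weight c y -> toral_weight c (x - a *: y).
  move=> cx cy t Tt; rewrite mulmxBr -scalemxAr cx // cy // scalerBr !scalerA.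
  by rewrite mulrC.
have [zc|/existsNP[t /not_implyP[Tt /eqP t0]]] := pselect (forall t, toral t -> c t =
  0).
  have NW x : toral_weight c x -> toral_weight (fun t => - c t) x.
    by move=> cx t Tt; rewrite cx // zc // oppr0.
  (* wedge x y lies in H and its semisimple part kills x and y: it is nilpotent. *)
  have sq x y : toral_weight c x -> toral_weight c y -> x != 0 ->
      dotv x y ^+ 2 = dotv x x * dotv y y.
    move=> cx cy x0; pose a := wedge x y.
    have [s [u [Ea su Ts [k uk]]]] := cartan_jordan (wedge_cartan cx (NW _ cy)).
    have sa : s * a = 0.
      by rewrite /a /wedge -mulmxE mulmxBr !mulmxA cx // cy // zc // !scale0r !mul0mx
        subrr.
    have ak i : a ^+ i.+1 = u ^+ i * a.
      elim: i => [|i IH]; first by rewrite mul1r.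
      rewrite exprS IH {1}/a Ea mulrDl mulrA (commrX i su) -mulrA sa mulr0 add0r.
      by rewrite mulrA -exprS.
    (* The square of x ^ y has x as an eigenvector, with minus the Gram determinant as
       eigenvalue. *)
    have a2 : (a * a) *m x = (dotv x y ^+ 2 - dotv x x * dotv y y) *: x.
      rewrite -mulmxE -mulmxA /a !wedge_mul !(dotvBr, dotvZr) (dotvC y x).
      rewrite (mulrC (dotv x y) (dotv x x)) subrr scale0r subr0.
      by rewrite expr2.
    have a2k : (a * a) ^+ k.+1 = 0.
      by rewrite -expr2 -exprM mul2n -addnn exprD ak uk !mul0r.
    by apply/eqP; rewrite -subr_eq0; apply/eqP; apply: uX0 a2k a2 x0.
  (* Some column of weight 0 pairs nontrivially with x, and the vanishing Gram determinant would
     turn dotv x x = 0 into the vanishing of that pairing. *)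
  have an x : toral_weight c x -> x != 0 -> dotv x x != 0.
    move=> cx x0; have [k [xk ck]] := weight_pairing cx x0.
    have ck' : toral_weight c (col k Q) by move=> t Tt; rewrite ck // zc // oppr0.
    apply: contra_neq xk => xx; have := sq _ _ cx ck' x0.
    by rewrite xx mul0r => /eqP; rewrite expf_eq0 => /andP[_ /eqP].
  pose a := dotv v w / dotv v v; exists a.
  apply/eqP; rewrite -subr_eq0; apply: contraT => w0.
  have := an _ (wB a _ _ cw cv) w0.
  have := sq _ _ cv (wB a _ _ cw cv) v0.
  have -> : dotv v (w - a *: v) = 0 by rewrite dotvBr dotvZr divfK ?subrr // an.
  by rewrite expr0n => /esym/eqP; rewrite mulf_eq0 (negPf (an _ cv v0)) /= => ->.
have iso x y : toral_weight c x -> toral_weight c y -> dotv x y = 0.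
  move=> cx cy; have := dotv_skew x y (Hskew Tt.1).
  rewrite cx // cy // dotvZl dotvZr => /eqP; rewrite -addr_eq0 -mulr2n mulrn_eq0 /=.
  by rewrite mulf_eq0 (negPf t0) => /eqP.
have [k [vk ck]] := weight_pairing cv v0; pose x := col k Q.
have [s [u [Ea su Ts [m um]]]] := cartan_jordan (wedge_cartan cv ck).
have uE y : u *m y = dotv x y *: v - dotv v y *: x - s *m y.
  by rewrite -wedge_mul Ea mulmxDl addrC addKr.
(* The nilpotent u has v as an eigenvector with eigenvalue dotv v x - c s, which must be 0. *)
have cs : c s = dotv v x.
  apply/eqP; rewrite eq_sym -subr_eq0; apply/eqP; apply: (uX0 u _ v m) => //.
  by rewrite uE (iso v v) // scale0r subr0 cv // -scalerBl dotvC.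
(* This makes w - a v orthogonal to x; it is also orthogonal to v, so v ^ x kills it and the
   nilpotent u acts on it by the nonzero scalar - c s. *)
pose a := dotv x w / dotv x v; exists a.
apply/eqP; rewrite -subr_eq0; apply: contraT => w0.
have xw0 : dotv x (w - a *: v) = 0 by rewrite dotvBr dotvZr divfK ?subrr // dotvC.
have := uX0 u (- c s) _ m um _ w0.
rewrite cs => E; move/eqP: vk; case; apply/eqP; rewrite -oppr_eq0; apply/eqP/E.
rewrite uE (iso v) //; last exact: wB.
rewrite xw0 !scale0r subrr sub0r.
by rewrite (wB a _ _ cw cv) // cs scaleNr.
Qed.

Lemma col_unit_inj j k a : col k Q = a *: col j Q -> j = k.
Proof.
rewrite !colE scalemxAr => /(congr1 (mulmx (invmx Q))); rewrite !mulKmx //.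
move=> /matrixP/(_ k 0); rewrite !mxE !eqxx /=; case: eqP => // _.
by rewrite mulr0 => /eqP; rewrite oner_eq0.
Qed.

Lemma col_unit_neq0 k : col k Q != 0.
Proof.
apply/eqP; rewrite colE => /(congr1 (mulmx (invmx Q))); rewrite mulKmx // mulmx0.
by move=> /matrixP/(_ k 0); rewrite !mxE !eqxx => /eqP; rewrite oner_eq0.
Qed.

Definition partner k : 'I_n.+1 :=
  odflt k [pick j | dotv (col k Q) (col j Q) != 0].

Lemma partner_dot k : dotv (col k Q) (col (partner k) Q) != 0.
Proof.
rewrite /partner; case: pickP => // no.
by have [j [kj _]] := weight_pairing (chiP k) (col_unit_neq0 k); rewrite no in kj.
Qed.

Lemma dot_partner k j : (dotv (col k Q) (col j Q) != 0) = (j == partner k).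
Proof.
apply/idP/eqP => [kj|->]; last exact: partner_dot.
have [a] := weight_line (weight_opp (chiP k) kj) (col_unit_neq0 j)
  (weight_opp (chiP k) (partner_dot k)).
exact: col_unit_inj.
Qed.

Lemma partnerK : involutive partner.
Proof.
by move=> k; apply/esym/eqP; rewrite -dot_partner dotvC partner_dot.
Qed.

(** A column paired with itself has a weight equal to its opposite, that is 0, and the zero weight
    space is a line. *)
Lemma partner_fixed j k : partner j = j -> partner k = k -> j = k.
Proof.
have zw i : partner i = i -> toral_weight (fun=> 0) (col i Q).
  move=> ii t Tt; rewrite chiP // -[in RHS](addrN (chi i t)) scalerDl scaleNr.
  have := weight_opp (chiP i) (partner_dot i); rewrite ii => /(_ t Tt).
  rewrite chiP // => E; rewrite -scaleNr -E.
  apply/eqP; rewrite -subr_eq0 opprD addNKr -scaleNr -E scaler_eq0.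
  move/eqP: E; rewrite -subr_eq0 -scalerBl opprK scaler_eq0.
  by rewrite (negPf (col_unit_neq0 i)) !orbF -mulr2n mulrn_eq0.
move=> /zw wj /zw wk; have [a] := weight_line wj (col_unit_neq0 j) wk.
exact: col_unit_inj.
Qed.

(** Elements of H commute with the toral ones and so preserve their weight spaces, which are lines:
    H as a whole is diagonal. *)
Lemma cartan_eigen z k : H z -> exists c, z *m col k Q = c *: col k Q.
Proof.
move=> Hz; apply: weight_line (chiP k) (col_unit_neq0 k) _ => t Tt.
by rewrite mulmxA toral_commute // -mulmxA chiP // scalemxAr.
Qed.

End Basis.
End CartanOfSkew.

(* Some (i, false) and Some (i, true) index weight vectors of opposite nonzero
   weights, and None the vector of weight 0. *)
Notation hidx l := (option ('I_l * bool)).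

Definition hconj l (a : hidx l) : hidx l :=
  if a is Some (i, b) then Some (i, ~~ b) else None.

Lemma hconjK l : involutive (@hconj l).
Proof. by case=> [[i b]|] //=; rewrite negbK. Qed.

Definition hyperbolic (F : fieldType) n l (v : hidx l -> 'cV[F]_n) :=
  forall a b, dotv (v a) (v b) = (b == hconj a)%:R.

(** Two-point orbits are represented by their smaller element. Since 2l + 1 is odd there is a fixed
    point, which becomes the image of [None]. *)
Lemma involution_split l (s : 'I_(2 * l).+1 -> 'I_(2 * l).+1) : involutive s ->
    (forall j k, s j = j -> s k = k -> j = k) ->
  exists f : hidx l -> 'I_(2 * l).+1,
    injective f /\ forall a, f (hconj a) = s (f a).
Proof.
move=> sK s1; pose A := [set k : 'I_(2 * l).+1 | (k < s k)%N].
pose B := [set k : 'I_(2 * l).+1 | (s k < k)%N].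
pose F := [set k : 'I_(2 * l).+1 | s k == k].
have BA : B = s @: A.
  apply/setP => k; rewrite inE; apply/idP/imsetP => [sk|[j]].
    by exists (s k); rewrite ?inE ?sK.
  by rewrite inE => jA ->; rewrite sK.
have cB : #|B| = #|A| by rewrite BA card_imset //; apply: inv_inj.
have cF : (#|F| <= 1)%N.
  by apply/card_le1_eqP => j k; rewrite !inE => /eqP sj /eqP sk; apply: s1.
have cT : (#|A| + #|B| + #|F| = (2 * l).+1)%N.
  rewrite -[RHS]card_ord -!sum1_card [RHS](bigID (mem A)) /= -addnA.
  congr (_ + _)%N; rewrite [RHS](bigID (mem B)) /=; congr (_ + _)%N.
    by apply: eq_bigl => k; rewrite !inE -leqNgt; case: ltngtP.
  by apply: eq_bigl => k; rewrite !inE -val_eqE /=; case: ltngtP.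
have cA : #|A| = l by lia.
have /card_gt0P[f0] : (0 < #|F|)%N by lia.
rewrite inE => /eqP f0E.
pose e (i : 'I_l) := enum_val (cast_ord (esym cA) i).
have eA i : (e i < s (e i))%N by have := enum_valP (cast_ord (esym cA) i); rewrite inE.
have e_inj : injective e by move=> i j /enum_val_inj/cast_ord_inj.
exists (fun a => if a is Some (i, b) then if b then s (e i) else e i else f0).
split; last by case=> [[i []]|] //=.
move=> [[i []]|] [[j []]|] //=.
- by move=> /(inv_inj sK)/e_inj->.
- by move=> E; have := eA j; rewrite -E sK; have := eA i; case: ltngtP.
- by move=> E; have := eA i; rewrite -{1}(sK (e i)) E f0E ltnn.
- by move=> E; have := eA i; rewrite E sK; have := eA j; case: ltngtP.
- by move=> /e_inj->.
- by move=> E; have := eA i; rewrite E f0E ltnn.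
- by move=> E; have := eA j; rewrite -{1}(sK (e j)) -E f0E ltnn.
- by move=> E; have := eA j; rewrite -E f0E ltnn.
Qed.

(* The hypotheses on H say that it is nilpotent and equal to its own generalized
   centralizer in so_(2l+1), i.e. that it is a Cartan subalgebra. *)
Theorem cartan_hyperbolic (C : numClosedFieldType) l (H : 'M[C]_((2 * l).+1) -> Prop) :
    (forall x, H x -> x^T = - x) ->
    (forall x z, H x -> H z -> exists k, iter k (mx_ad x) z = 0) ->
    (forall z, z^T = - z -> (forall x, H x -> exists k, iter k (mx_ad x) z = 0) ->
      H z) ->
  exists v : hidx l -> 'cV[C]_((2 * l).+1), [/\ hyperbolic v,
    forall a, H (wedge (v a) (v (hconj a))) &
    forall z a, H z -> exists c, z *m v a = c *: v a].
Proof.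
move=> Hs Hn Hm; have [Q uQ QT] := toral_basis Hn.
pose g j k := dotv (col j Q) (col k Q).
have [f [f_inj fC]] := involution_split (partnerK Hs Hn Hm uQ QT)
  (partner_fixed Hs Hn Hm uQ QT).
have gE j k : (g j k != 0) = (k == partner Q j) := dot_partner Hs Hn Hm uQ QT j k.
(* One vector of each opposite pair absorbs the pairing; the vector of weight 0 is paired with
   itself and needs a square root. *)
pose sc a := match a with Some (i, false) => 1
  | Some (i, true) => (g (f (Some (i, false))) (f a))^-1
  | None => (sqrtC (g (f None) (f None)))^-1 end.
pose v a := sc a *: col (f a) Q; exists v; split.
- move=> a b; rewrite /v dotvZl dotvZr -/(g _ _).
  have [->|ba] := eqVneq b (hconj a); last first.
    have : g (f a) (f b) == 0.
      by rewrite -[_ == 0]negbK gE -fC (inj_eq f_inj).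
    by move/eqP->; rewrite !mulr0.
  have : g (f a) (f (hconj a)) != 0 by rewrite gE fC.
  case: a => [[i []]|] /= g0.
  + by rewrite mul1r {1}/g dotvC mulVf // /g dotvC.
  + by rewrite mul1r mulVf.
  + by rewrite mulrA -invfM -expr2 sqrtCK mulVf.
- move=> a; have [c ca] := col_weight uQ QT (f a).
  have wZ d w : toral_weight H d w -> forall e, toral_weight H d (e *: w).
    by move=> dw e t Tt; rewrite -scalemxAr dw // !scalerA mulrC.
  apply: (wedge_cartan Hs Hn Hm (c := c)); apply: wZ => //.
  by apply: (weight_opp Hs uQ QT ca); rewrite (dot_partner Hs Hn Hm) ?fC.
- move=> z a Hz; have [c zc] := cartan_eigen Hs Hn Hm uQ QT (f a) Hz.
  by exists c; rewrite /v -scalemxAr zc !scalerA mulrC.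
Qed.

(** * Engel's theorem and generalized centralizers *)

Section Engel.
Variables (K : fieldType) (L : vectLieAlgType K).
Implicit Types (g h U W X : {vspace L}) (x y z m : L).

Lemma lie_sumr I (r : seq I) (P : pred I) (F : I -> L) x :
  lie x (\sum_(i <- r | P i) F i) = \sum_(i <- r | P i) lie x (F i).
Proof. exact: (big_morph _ (fun u v => lieDr u v x) (liex0 x)). Qed.

Lemma lie_suml I (r : seq I) (P : pred I) (F : I -> L) x :
  lie (\sum_(i <- r | P i) F i) x = \sum_(i <- r | P i) lie (F i) x.
Proof. exact: (big_morph _ (fun u v => lieDl u v x) (lie0x x)). Qed.

Lemma lie_leibniz x y z : lie x (lie y z) = lie (lie x y) z + lie y (lie x z).
Proof.
apply/eqP; rewrite -subr_eq0 opprD addrA; apply/eqP.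
rewrite -[RHS](lie_jacobi x y z) (lieC z (lie x y)) (lieC z x) lieNr.
by rewrite addrAC.
Qed.

Lemma memv_lie_prodv U W u w : u \in U -> w \in W -> lie u w \in lie_prodv U W.
Proof.
move=> /coord_vbasis-> /coord_vbasis->; rewrite lie_suml memv_suml // => i _.
rewrite lieZl rpredZ // lie_sumr memv_suml // => j _.
rewrite lieZr rpredZ // memv_span //; apply/allpairsP.
by exists ((vbasis U)`_i, (vbasis W)`_j); rewrite !mem_nth ?size_tuple.
Qed.

Lemma lie_prodv_subv U W X :
  (forall u w, u \in U -> w \in W -> lie u w \in X) -> (lie_prodv U W <= X)%VS.
Proof.
move=> UW; apply/span_subvP => _ /allpairsP[[u w] /= [uU wW ->]].
by apply: UW; apply: vbasis_mem.
Qed.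

Lemma nilpotent_ad h x z : nilpotent_lie h -> x \in h -> z \in h ->
  exists k, iter k (lie x) z = 0.
Proof.
case=> k hk xh zh; exists k; apply/eqP; rewrite -memv0 -hk.
by elim: {hk}k => //= k IH; apply: memv_lie_prodv.
Qed.

(* Engel's theorem for the action of h on M / h, where M need not be linear:
   climbing the lower central series C^k h from its end, one finds m in M
   outside h with [C^k h, m] inside h. *)
Lemma engel_relative h (M : L -> Prop) : subalgebra h -> nilpotent_lie h ->
    (forall x m, x \in h -> M m -> M (lie x m)) ->
    (forall x m, x \in h -> M m -> exists k, iter k (lie x) m = 0) ->
    (exists2 m, M m & m \notin h) ->
  exists m, [/\ M m, m \notin h & forall x, x \in h -> lie x m \in h].
Proof.
move=> hh [n hn] Mh Mn [m0 Mm0 m0h].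
pose c k := iter k (lie_prodv h) h.
have hlie x y : x \in h -> y \in h -> lie x y \in h.
  by move=> xh yh; apply: (subvP hh); apply: memv_lie_prodv.
have ch k : (c k <= h)%VS.
  elim: k => [|k IH] //=; apply: lie_prodv_subv => u w uh /(subvP IH).
  exact: hlie.
have cS k : (c k.+1 <= c k)%VS.
  elim: k => [|k IH]; apply: lie_prodv_subv => u w uh wh; first exact: hlie.
  by apply: memv_lie_prodv => //; apply: subvP IH _ _.
pose Q k := exists m, [/\ M m, m \notin h & forall x, x \in c k -> lie x m \in h].
have step k : Q k.+1 -> Q k.
  case=> m1 [Mm1 m1h m1c].
  suff : forall s : seq L, {subset s <= c k} -> exists m, [/\ M m, m \notin h,
      forall x, x \in c k.+1 -> lie x m \in h & forall x, x \in s -> lie x m \in h].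
    move=> /(_ (vbasis (c k))) [x /vbasis_mem //|m [Mm mh _ mc]].
    exists m; split=> // x /coord_vbasis ->; rewrite lie_suml memv_suml // => i _.
    by rewrite lieZl rpredZ // mc // mem_nth ?size_tuple.
  elim=> [|y s IH] sc; first by exists m1.
  have [|m [Mm mh mc ms]] := IH; first by move=> x xs; apply: sc; rewrite inE xs orbT.
  have yck : y \in c k by apply: sc; rewrite mem_head.
  have yh : y \in h := subvP (ch k) _ yck.
  have stab i : [/\ M (iter i (lie y) m),
      forall x, x \in c k.+1 -> lie x (iter i (lie y) m) \in h &
      forall x, x \in s -> lie x (iter i (lie y) m) \in h].
    elim: i => [|i [Mi ci si]]; first by split.
    split=> /= [|x xc|x xs]; first exact: Mh.
      have xyc : lie x y \in c k.+1.
        by rewrite lieC memvN; apply: (subvP (cS k.+1)); apply: memv_lie_prodv.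
      by rewrite lie_leibniz memvD ?(ci _ xyc) // hlie // ci.
    have xc : x \in c k by apply: sc; rewrite inE xs orbT.
    have xyc : lie x y \in c k.+1 by rewrite lieC memvN; apply: memv_lie_prodv.
    by rewrite lie_leibniz memvD ?(ci _ xyc) // hlie // si.
  (* The last iterate of ad y outside h is the new vector: it keeps the earlier conditions by
     [stab], and y sends it into h. *)
  have ex : exists i, iter i (lie y) m \in h.
    by have [i iy] := Mn _ _ yh Mm; exists i; rewrite iy mem0v.
  case: (ex_minnP ex) => [[|i]] /= ih imin; first by rewrite ih in mh.
  have [Mi ci si] := stab i; exists (iter i (lie y) m); split=> //.
    by apply/negP => /imin; rewrite ltnn.
  by move=> x; rewrite inE => /predU1P[->|/si].
have base : Q n.
  by exists m0; split=> // x; rewrite /c hn memv0 => /eqP->; rewrite lie0x mem0v.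
suff [m [Mm mh mc]] : Q 0%N by exists m.
by elim: {hn}n base => // k IH /step.
Qed.

(** By the Leibniz rule the generalized null space of ad x is closed under the bracket. *)
Lemma ad_nilp_lie x y z : (exists k, iter k (lie x) y = 0) ->
  (exists k, iter k (lie x) z = 0) -> exists k, iter k (lie x) (lie y z) = 0.
Proof.
have i0 k : iter k (lie x) 0 = 0 by elim: k => //= k ->; rewrite liex0.
have iD k u v : iter k (lie x) (u + v) = iter k (lie x) u + iter k (lie x) v.
  by elim: k => //= k ->; rewrite lieDr.
case=> a ya [b zb]; exists (a + b)%N.
have [n] := ubnP (a + b); elim: n => // n IH in a b y z ya zb *.
case: a ya => [|a] ya lt_n; first by rewrite [y]ya lie0x i0.
case: b zb lt_n => [|b] zb lt_n; first by rewrite [z]zb liex0 i0.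
have E1 : iter (a + b.+1) (lie x) (lie (lie x y) z) = 0.
  by apply: IH => //; rewrite -iterSr.
have E2 : iter (a.+1 + b) (lie x) (lie y (lie x z)) = 0.
  by apply: IH => //; [rewrite -iterSr | rewrite addnS in lt_n].
by rewrite addSn iterSr lie_leibniz iD E1 add0r -addSnnS.
Qed.

(** Otherwise Engel's theorem, applied to the elements of g on which every ad x with x in h is
    nilpotent, yields an element outside h that normalizes h. *)
Lemma cartan_maximal g h z : subalgebra g -> cartan_subalgebra g h -> z \in g ->
  (forall x, x \in h -> exists k, iter k (lie x) z = 0) -> z \in h.
Proof.
move=> gg [hg hh hn hN] zg zn; apply: contraT => zh.
pose M m := m \in g /\ forall x, x \in h -> exists k, iter k (lie x) m = 0.
have [|||m [[mg _] mh mN]] := @engel_relative h M hh hn.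
- move=> x m xh [mg mn]; split.
    by apply: (subvP gg); apply: memv_lie_prodv => //; apply: (subvP hg).
  by move=> y yh; apply: ad_nilp_lie; [apply: (nilpotent_ad hn)|apply: mn].
- by move=> x m xh [_]; apply.
- by exists z.
have : m \in h by apply: hN; split=> // y yh; rewrite lieC memvN; apply: mN.
by rewrite (negPf mh).
Qed.

End Engel.

(** * The Killing form *)

Section TraceOnSubspace.
Variables (K : fieldType) (V : vectType K).

(** A trace can be computed from any family that reconstructs the vectors, even a linearly dependent
    one. This allows the redundant N^2 matrices E_ij - E_ji instead of a basis of so_N. *)
Lemma sum_coord_frame (g : {vspace V}) (I : finType) (phi : I -> V -> K)
    (w : I -> V) (f : V -> V) :
    (forall k, scalar (phi k)) -> linear f ->
    (forall v, v \in g -> f v \in g) -> (forall k, w k \in g) ->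
    (forall v, v \in g -> v = \sum_k phi k v *: w k) ->
  \sum_(i < \dim g) coord (vbasis g) i (f (vbasis g)`_i) = \sum_k phi k (f (w k)).
Proof.
move=> lphi lf fg wg E.
pose fm := GRing.isLinear.Build K V V _ f lf.
pose F : {linear V -> V} := HB.pack f fm.
have phiS k (r : 'I_(\dim g) -> V) (c : 'I_(\dim g) -> K) :
    phi k (\sum_i c i *: r i) = \sum_i c i * phi k (r i).
  pose pm := GRing.isLinear.Build K V K _ (phi k) (lphi k).
  pose P : {linear V -> K | *%R} := HB.pack (phi k) pm.
  rewrite -[phi k]/(P : V -> K) linear_sum; apply: eq_bigr => i _.
  by rewrite linearZ.
transitivity (\sum_(i < \dim g) \sum_k phi k (vbasis g)`_i * coord (vbasis g) i (f (w
  k))).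
  apply: eq_bigr => i _; have bi : (vbasis g)`_i \in g.
    by apply: vbasis_mem; rewrite mem_nth ?size_tuple.
  rewrite {1}(E _ bi) -[f]/(F : V -> V) !linear_sum; apply: eq_bigr => k _.
  by rewrite !linearZ.
rewrite exchange_big; apply: eq_bigr => k _ /=.
rewrite [in RHS](coord_vbasis (fg _ (wg k))) phiS; apply: eq_bigr => i _.
by rewrite mulrC.
Qed.

End TraceOnSubspace.

Section KillingForm.
Variables (K : fieldType) (N : nat).
Hypothesis two_neq0 : (2 : K) != 0.
Implicit Types (A E : 'M[K]_N).

Lemma skew_trace A : A^T = - A -> \tr A = 0.
Proof.
move=> At; have := mxtrace_tr A; rewrite At linearN /= => /eqP.
by rewrite eq_sym -addr_eq0 -mulr2n -mulr_natr mulf_eq0 (negPf two_neq0) orbF => /eqP.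
Qed.

Lemma mul_delta_mxE A E (a b i j : 'I_N) :
  (A *m delta_mx a b *m E) i j = A i a * E b j.
Proof.
rewrite mxE (bigD1 b) //= [(A *m _) i b]mxE (bigD1 a) //= !big1.
- by rewrite mxE !eqxx !mulr1n mulr1 !addr0.
- move=> k kb; rewrite mxE big1 ?mul0r // => m _.
  by rewrite mxE (negPf kb) andbF mulr0.
- by move=> k ka; rewrite mxE (negPf ka) mulr0.
Qed.

(** The trace of the operator Z -> A Z E on all matrices; [sum_delta_trace_tr] treats Z -> A Z^T
    E. *)
Lemma sum_delta_trace A E :
  \sum_(k : 'I_N * 'I_N) (A *m delta_mx k.1 k.2 *m E) k.1 k.2 = \tr A * \tr E.
Proof.
rewrite -(pair_bigA _ (fun i j => (A *m delta_mx i j *m E) i j)) /=.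
rewrite /mxtrace mulr_suml; apply: eq_bigr => i _; rewrite mulr_sumr.
by apply: eq_bigr => j _; rewrite mul_delta_mxE.
Qed.

Lemma sum_delta_trace_tr A E :
  \sum_(k : 'I_N * 'I_N) (A *m delta_mx k.2 k.1 *m E) k.1 k.2 = \tr (A *m E^T).
Proof.
rewrite -(pair_bigA _ (fun i j => (A *m delta_mx j i *m E) i j)) /=.
rewrite /mxtrace; apply: eq_bigr => i _; rewrite mxE.
by apply: eq_bigr => j _; rewrite mul_delta_mxE mxE.
Qed.

(** The cases of interest are e = 1, for so_N, and e = [blk], for so_(2l+1). In the trace over the
    frame (E_ij - E_ji) / 2, cut down by e, the terms E_ij contribute tr e tr(xy) and the terms -
    E_ji contribute - 2 tr(xy). *)
Lemma killing_block (g : {vspace so K N}) (e : 'M[K]_N) (x y : so K N) :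
    e^T = e -> e *m e = e ->
    (forall z : so K N, z \in g <-> e *m vsval z *m e = vsval z) ->
    x \in g -> y \in g ->
  killing g x y = (\tr e - 2) * \tr (vsval x *m vsval y).
Proof.
move=> et ee gE xg yg.
have gel (z : so K N) : z \in g -> e *m vsval z = vsval z.
  by move=> /gE <-; rewrite !mulmxA ee.
have ger (z : so K N) : z \in g -> vsval z *m e = vsval z.
  by move=> /gE <-; rewrite -!mulmxA ee.
have lieg u v : u \in g -> v \in g -> lie u v \in g.
  move=> ug vg; apply/gE; rewrite [vsval (lie u v)]so_lieE mulmxBr mulmxBl.
  by rewrite !mulmxA !gel // -!mulmxA !ger.
pose X := vsval x; pose Y := vsval y.
pose D (k : 'I_N * 'I_N) : 'M[K]_N := delta_mx k.1 k.2 - delta_mx k.2 k.1.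
pose W k : so K N := vsproj (skew_space K N) (2^-1 *: (e *m D k *m e)).
have DT k : (D k)^T = - D k by rewrite linearB /= !trmx_delta opprB.
have WE k : vsval (W k) = 2^-1 *: (e *m D k *m e).
  rewrite vsprojK //; apply/skew_spaceP.
  by rewrite linearZ /= !trmx_mul et DT mulNmx mulmxN scalerN mulmxA.
pose phi (k : 'I_N * 'I_N) (z : so K N) : K := vsval z k.1 k.2.
rewrite /killing (@sum_coord_frame _ _ g _ phi W (fun z => lie x (lie y z))).
- have XT : X^T = - X := so_trmx x; have YT : Y^T = - Y := so_trmx y.
  have tXY : \tr (Y *m X) = \tr (X *m Y) by rewrite mxtrace_mulC.
  have xe : X *m e = X := ger _ xg. have ex : e *m X = X := gel _ xg.
  have ye : Y *m e = Y := ger _ yg. have ey : e *m Y = Y := gel _ yg.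
  have aD (A B : 'M[K]_N) i j : (A + B) i j = A i j + B i j by rewrite mxE.
  have aN (A : 'M[K]_N) i j : (- A) i j = - A i j by rewrite mxE.
  (* The expansion of [X, [Y, e Z e]], with e absorbed wherever it meets X or Y. *)
  pose T (Z : 'M[K]_N) := (X *m Y) *m Z *m e - X *m Z *m Y
    - Y *m Z *m X + e *m Z *m (Y *m X).
  have WT k : vsval (lie x (lie y (W k))) =
      2^-1 *: (T (delta_mx k.1 k.2) - T (delta_mx k.2 k.1)).
    have TB Z Z' : T (Z - Z') = T Z - T Z'.
      rewrite /T !(mulmxBr, mulmxBl) !opprD !opprK !addrA.
      by rewrite [LHS](AC 8 (1*3*5*7*2*4*6*8)) //=.
    rewrite -TB -/(D k) [LHS]so_lieE [vsval (lie y _)]so_lieE -/X -/Y WE.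
    rewrite -!(scalemxAl, scalemxAr) -!scalerBr -!(scalemxAl, scalemxAr) -scalerBr.
    congr (_ *: _); have -> : Y *m (e *m D k *m e) = Y *m D k *m e by rewrite !mulmxA
      ye.
    have -> : e *m D k *m e *m Y = e *m D k *m Y by rewrite -!mulmxA ey.
    rewrite mulmxBr mulmxBl /T !mulmxA xe -(mulmxA _ e X) ex.
    by rewrite opprB addrA addrAC.
  under eq_bigr => k _ do rewrite /phi WT mxE aD aN.
  rewrite -mulr_sumr sumrB.
  have E1 : \sum_(k : 'I_N * 'I_N) T (delta_mx k.1 k.2) k.1 k.2 = 2 * (\tr e * \tr (X
    *m Y)).
    under eq_bigr => k _ do rewrite /T !(aD, aN).
    rewrite big_split !sumrB /= !sum_delta_trace !(skew_trace XT, skew_trace YT).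
    by rewrite tXY; ring.
  have E2 : \sum_(k : 'I_N * 'I_N) T (delta_mx k.2 k.1) k.1 k.2 = 4 * \tr (X *m Y).
    under eq_bigr => k _ do rewrite /T !(aD, aN).
    rewrite big_split !sumrB /= !sum_delta_trace_tr et XT YT trmx_mul XT YT.
    have t1 : X *m Y *m e = X *m Y by rewrite -mulmxA ye.
    have t2 : e *m (X *m Y) = X *m Y by rewrite mulmxA ex.
    by rewrite !(mulmxN, mulNmx) opprK t1 t2 !linearN /= tXY; ring.
  by rewrite E1 E2 -/X -/Y; field.
- by move=> k a u v; rewrite /phi mxE mxE.
- by move=> a u v; rewrite lieDr lieZr lieDr lieZr.
- by move=> v vg; apply: (lieg) => //; apply: (lieg).
- by move=> k; apply/gE; rewrite WE -scalemxAr -scalemxAl !mulmxA ee -!mulmxA ee.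
move=> v vg; apply: val_inj.
rewrite raddf_sum /=.
have vT := so_trmx v; set V := vsval v in vT *.
have -> : \sum_k vsval (phi k v *: W k) = 2^-1 *: (e *m (\sum_k V k.1 k.2 *: D k) *m e).
  rewrite mulmx_sumr mulmx_suml scaler_sumr; apply: eq_bigr => k _.
  rewrite -[LHS]/(phi k v *: vsval (W k)) WE scalerA -scalemxAr -scalemxAl scalerA.
  by rewrite mulrC.
have -> : \sum_k V k.1 k.2 *: D k = V - V^T.
  under eq_bigr => k _ do rewrite /D scalerBr.
  rewrite sumrB; congr (_ - _).
    by rewrite [RHS]matrix_sum_delta pair_bigA.
  have -> : V^T = \sum_i \sum_j V i j *: delta_mx j i.
    rewrite [in LHS](matrix_sum_delta V) linear_sum; apply: eq_bigr => i _.
    by rewrite linear_sum; apply: eq_bigr => j _; rewrite linearZ /= trmx_delta.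
  by rewrite pair_bigA.
have eV : e *m V *m e = V by apply/gE.
by rewrite vT opprK mulmxDr mulmxDl eV -mulr2n -scaler_nat scalerA mulVf // scale1r.
Qed.

End KillingForm.

(** * The block so_(2l+1) and frames adapted to its Cartan subalgebras *)

Section Block.
Variables (C : numClosedFieldType) (l : nat).
Local Notation N := (2 * l + 4)%N.
Local Notation n := ((2 * l).+1).

Definition incl : 'M[C]_(N, n) := \matrix_(i, j) (i == j :> nat)%:R.
Definition blk : 'M[C]_N := diag_mx (\row_i (i < n)%N%:R).

Lemma incl_orth : incl^T *m incl = 1%:M.
Proof.
apply/matrixP => i j; rewrite !mxE.
have iN : (i < N)%N by have := ltn_ord i; lia.
rewrite (bigD1 (Ordinal iN)) //= !mxE eqxx mul1r big1 ?addr0 // => k ki.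
rewrite !mxE; have [E|] := eqVneq (k : nat) i; last by rewrite mul0r.
by case/eqP: ki; apply: val_inj.
Qed.

Lemma incl_blk : incl *m incl^T = blk.
Proof.
apply/matrixP => i j; rewrite !mxE; have [lt_in|le_ni] := ltnP i n.
  rewrite (bigD1 (Ordinal lt_in)) //= !mxE eqxx mul1r big1 ?addr0 => [|k ki].
    by rewrite eq_sym.
  rewrite !mxE; have [E|] := eqVneq (i : nat) k; last by rewrite mul0r.
  by case/eqP: ki; apply: val_inj.
rewrite big1 ?mul0rn // => k _; rewrite !mxE; have [E|] := eqVneq (i : nat) k.
  by have := ltn_ord k; rewrite -E ltnNge le_ni.
by rewrite mul0r.
Qed.

Lemma blk_tr : blk^T = blk.
Proof. exact: tr_diag_mx. Qed.

Lemma blk_idem : blk *m blk = blk.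
Proof. by rewrite -incl_blk mulmxA -(mulmxA incl) incl_orth mulmx1. Qed.

Lemma blk_trace : \tr blk = n%:R.
Proof. by rewrite -incl_blk mxtrace_mulC incl_orth mxtrace1. Qed.

Lemma blk_entry (A : 'M[C]_N) i j :
  (blk *m A *m blk) i j = if (i < n)%N && (j < n)%N then A i j else 0.
Proof.
rewrite mul_mx_diag mxE mul_diag_mx !mxE.
by case: (_ < _)%N; case: (_ < _)%N; rewrite ?mul0r ?mul1r ?mulr1 ?mulr0.
Qed.

Variable g : {vspace so C N}.
Hypothesis gP : forall X : so C N, X \in g <-> blk *m vsval X *m blk = vsval X.

Definition pblk (X : so C N) : 'M[C]_n := incl^T *m vsval X *m incl.

Lemma pblkK X : X \in g -> vsval X = incl *m pblk X *m incl^T.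
Proof. by move=> /gP <-; rewrite /pblk -incl_blk !mulmxA. Qed.

Lemma pblk_skew X : (pblk X)^T = - pblk X.
Proof. by rewrite /pblk !trmx_mul trmxK so_trmx mulNmx mulmxN mulmxA. Qed.

Definition eblk (Y : 'M[C]_n) : so C N := vsproj (skew_space C N) (incl *m Y *m incl^T).

Lemma eblkE Y : Y^T = - Y -> vsval (eblk Y) = incl *m Y *m incl^T.
Proof.
move=> YT; rewrite vsprojK //; apply/skew_spaceP.
by rewrite !trmx_mul trmxK YT mulNmx mulmxN mulmxA.
Qed.

Lemma eblkK Y : Y^T = - Y -> pblk (eblk Y) = Y.
Proof.
move=> YT; rewrite /pblk eblkE // !mulmxA incl_orth mul1mx -mulmxA incl_orth.
by rewrite mulmx1.
Qed.

Lemma eblk_in Y : Y^T = - Y -> eblk Y \in g.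
Proof.
move=> YT; apply/gP; rewrite eblkE // -incl_blk !mulmxA.
by rewrite -(mulmxA incl _ incl) incl_orth mulmx1 -(mulmxA _ incl^T incl) incl_orth
  mulmx1.
Qed.

Lemma pblk_lie X Z : X \in g -> Z \in g -> pblk (lie X Z) = mx_ad (pblk X) (pblk Z).
Proof.
move=> Xg Zg; rewrite /pblk [vsval (lie X Z)]so_lieE /mx_ad -!mulmxE.
have inclK A : A \in g -> vsval A *m incl *m incl^T = vsval A.
  by move=> /gP <-; rewrite -!mulmxA incl_blk blk_idem.
by rewrite mulmxBr mulmxBl !mulmxA -!(mulmxA incl^T) !inclK.
Qed.

Lemma block_lie X Z : X \in g -> Z \in g -> lie X Z \in g.
Proof.
move=> Xg Zg; have bl A : A \in g -> blk *m vsval A = vsval A.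
  by move=> /gP <-; rewrite !mulmxA blk_idem.
have br A : A \in g -> vsval A *m blk = vsval A.
  by move=> /gP <-; rewrite -!mulmxA blk_idem.
apply/gP; rewrite [vsval (lie X Z)]so_lieE mulmxBr mulmxBl !mulmxA.
by rewrite !bl // -!mulmxA !br.
Qed.

Lemma block_subalgebra : subalgebra g.
Proof. exact/lie_prodv_subv/block_lie. Qed.

(** [pblk] turns brackets in g into commutators of matrices of size 2l + 1, so nilpotency and
    maximality of h carry over to its image. *)
Theorem cartan_frame h : cartan_subalgebra g h ->
  exists u : hidx l -> 'cV[C]_n, [/\ hyperbolic u,
    forall a, eblk (wedge (u a) (u (hconj a))) \in h &
    forall z a, z \in h -> exists c, pblk z *m u a = c *: u a].
Proof.
move=> ch; have [hg hh hn hN] := ch.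
have hgP z : z \in h -> z \in g by apply: (subvP hg).
pose H Y := exists2 z, z \in h & pblk z = Y.
have iterE x z k : x \in g -> z \in g ->
    iter k (lie x) z \in g /\ pblk (iter k (lie x) z) = iter k (mx_ad (pblk x)) (pblk
      z).
  move=> xg zg; elim: k => //= k [IH1 IH2].
  by rewrite pblk_lie // IH2; split=> //; apply: block_lie.
have [||| u [u1 u2 u3]] := @cartan_hyperbolic _ l H.
- by move=> _ [z _ <-]; apply: pblk_skew.
- move=> _ _ [x xh <-] [z zh <-]; have [k xk] := nilpotent_ad hn xh zh; exists k.
  have [_ <-] := iterE x z k (hgP _ xh) (hgP _ zh).
  by rewrite xk /pblk -[vsval 0]/(0 : 'M[C]_N) mulmx0 mul0mx.
- move=> Y YT Yn; exists (eblk Y); last exact: eblkK.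
  apply: (cartan_maximal block_subalgebra ch); first exact: eblk_in.
  move=> x xh; have [|k xk] := Yn (pblk x); first by exists x.
  exists k; have [ig iE] := iterE x (eblk Y) k (hgP _ xh) (eblk_in YT).
  by apply: val_inj; rewrite /= (pblkK ig) iE eblkK // xk mulmx0 mul0mx.
exists u; split=> // [a|z a zh]; last by apply: u3; exists z.
have [z zh zE] := u2 a; suff -> : eblk (wedge (u a) (u (hconj a))) = z by [].
apply: val_inj; rewrite /= eblkE; last exact: wedge_skew.
by rewrite -zE -pblkK // hgP.
Qed.

End Block.

Lemma hom_exists (K : fieldType) (U W : vectType K) (f : U -> W) :
  linear f -> exists F : 'Hom(U, W), forall t, F t = f t.
Proof.
move=> lf; pose fm := GRing.isLinear.Build K U W _ f lf.
pose F : {linear U -> W} := HB.pack f fm.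
by exists (linfun F) => t; rewrite lfunE.
Qed.

(** There are as many vectors as dimensions, so the one-sided inverse read off from the Gram matrix
    is two-sided. This resolution of the identity serves to expand matrices in the frame. *)
Lemma hyperbolic_complete (F : fieldType) l (u : hidx l -> 'cV[F]_((2 * l).+1)) :
  hyperbolic u -> \sum_a u a *m (u (hconj a))^T = 1%:M.
Proof.
move=> hu; have cI : #|{: hidx l}| = (2 * l).+1.
  by rewrite card_option card_prod card_bool card_ord mulnC.
pose f (k : 'I_((2 * l).+1)) : hidx l := enum_val (cast_ord (esym cI) k).
have fb : bijective f.
  exists (fun a => cast_ord cI (enum_rank a)) => k; rewrite /f.
    by rewrite enum_valK cast_ordKV.
  by rewrite cast_ordK enum_rankK.
pose U := \matrix_(i, k) u (f k) i 0.
pose W := \matrix_(k, i) u (hconj (f k)) i 0.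
have WU : W *m U = 1%:M.
  apply/matrixP => k m; transitivity (dotv (u (hconj (f k))) (u (f m))).
    by rewrite /dotv !mxE; apply: eq_bigr => i _; rewrite !mxE.
  by rewrite hu hconjK mxE (inj_eq (bij_inj fb)) eq_sym.
rewrite -(mulmx1C WU); apply/matrixP => i j; rewrite summxE mxE.
rewrite (reindex f) /=; last exact: onW_bij.
by apply: eq_bigr => k _; rewrite !mxE big_ord1 !mxE.
Qed.

Definition swedge (K : fieldType) N (v w : 'cV[K]_N) : so K N :=
  vsproj (skew_space K N) (wedge v w).

Section SWedge.
Variables (K : fieldType) (N : nat).
Implicit Types (v w : 'cV[K]_N) (x : so K N).

Lemma so_valD x y : vsval (x + y) = vsval x + vsval y.
Proof. by []. Qed.

Lemma so_valZ a x : vsval (a *: x) = a *: vsval x.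
Proof. by []. Qed.

Lemma swedgeE v w : vsval (swedge v w) = wedge v w.
Proof. by rewrite vsprojK //; apply/skew_spaceP/wedge_skew. Qed.

Lemma swedgeC v w : swedge v w = - swedge w v.
Proof. by apply: val_inj; rewrite [LHS]swedgeE wedgeC -swedgeE. Qed.

Lemma lie_swedge x v w :
  lie x (swedge v w) = swedge (vsval x *m v) w + swedge v (vsval x *m w).
Proof.
apply: val_inj; rewrite [LHS]so_lieE [RHS]so_valD !swedgeE.
by rewrite wedge_comm // so_trmx.
Qed.

Lemma lie_swedge_eigen x v w a b : vsval x *m v = a *: v -> vsval x *m w = b *: w ->
  lie x (swedge v w) = (a + b) *: swedge v w.
Proof.
move=> xv xw; rewrite lie_swedge xv xw; apply: val_inj.
by rewrite [LHS]so_valD [RHS]so_valZ !swedgeE wedgeZl wedgeZr scalerDl.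
Qed.

Lemma swedge_neq0 v w z : dotv v z = 0 -> dotv w z != 0 -> v != 0 -> swedge v w != 0.
Proof.
move=> vz wz v0; apply: contraNneq v0 => E.
have : wedge v w *m z == 0 by rewrite -swedgeE E mul0mx.
by rewrite wedge_mul vz scale0r subr0 scaler_eq0 (negPf wz).
Qed.

(** The dual of [lie_swedge_eigen]: if x is a weight vector, its matrix coefficient between v and w
    can be nonzero only if its weight is - (a + b). *)
Lemma lie_pairing (t x : so K N) v w a b : vsval t *m v = a *: v -> vsval t *m w = b
  *: w ->
  dotv v (vsval (lie t x) *m w) = - (a + b) * dotv v (vsval x *m w).
Proof.
move=> tv tw; rewrite [vsval (lie t x)]so_lieE mulmxBl -!mulmxA tw dotvBr.
rewrite -scalemxAr dotvZr -[dotv v (vsval t *m _)]opprK -dotv_skew ?so_trmx //.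
by rewrite tv dotvZl; ring.
Qed.

End SWedge.

Lemma swedge_block (C : numClosedFieldType) l (g : {vspace so C (2 * l + 4)}) v w :
    (forall X : so C (2 * l + 4), X \in g <-> blk C l *m vsval X *m blk C l = vsval
      X) ->
  blk C l *m v = v -> blk C l *m w = w -> swedge v w \in g.
Proof.
move=> gP bv bw; apply/gP; rewrite swedgeE /wedge mulmxBr mulmxBl !mulmxA bv bw.
by rewrite -!mulmxA -[blk C l]blk_tr -!trmx_mul bv bw.
Qed.

(* v_a is a weight vector of h of weight eps_a, and is paired with v_(hconj a). *)
Record split_frame (C : numClosedFieldType) l (g h : {vspace so C (2 * l + 4)})
    (v : hidx l -> 'cV[C]_(2 * l + 4)) (eps : hidx l -> 'Hom(subvs_of h, C^o)) : Prop :=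
  SplitFrame {
    frame_blockP : forall X : so C (2 * l + 4),
      X \in g <-> blk C l *m vsval X *m blk C l = vsval X;
    frame_sub : (h <= g)%VS;
    frame_dot : forall a b, dotv (v a) (v b) = (b == hconj a)%:R;
    frame_blk : forall a, blk C l *m v a = v a;
    frame_complete : \sum_a v a *m (v (hconj a))^T = blk C l;
    frame_in : forall a, swedge (v a) (v (hconj a)) \in h;
    frame_eps : forall a (t : subvs_of h),
      vsval (vsval t) *m v a = (eps a t : C) *: v a }.

Section HyperbolicCartan.
Variables (C : numClosedFieldType) (l : nat).
Local Notation N := (2 * l + 4)%N.
Local Notation n := ((2 * l).+1).
Variables (g h : {vspace so C N}) (u : hidx l -> 'cV[C]_n).
Hypothesis gP : forall X : so C N, X \in g <-> blk C l *m vsval X *m blk C l = vsval X.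
Hypothesis hyp_u : hyperbolic u.
Hypothesis hg : (h <= g)%VS.
Hypothesis hu : forall a, eblk (wedge (u a) (u (hconj a))) \in h.
Hypothesis hz : forall z a, z \in h -> exists c, pblk z *m u a = c *: u a.

Local Notation dualh := 'Hom(subvs_of h, C^o).

Definition hvec a : 'cV[C]_N := incl C l *m u a.

Lemma hvec_dot a b : dotv (hvec a) (hvec b) = (b == hconj a)%:R.
Proof. by rewrite /hvec dotvM mulmxA incl_orth mul1mx hyp_u. Qed.

Lemma blk_hvec a : blk C l *m hvec a = hvec a.
Proof.
by rewrite /hvec -incl_blk mulmxA -(mulmxA (incl C l)) incl_orth mulmx1.
Qed.

Lemma hvec_complete : \sum_a hvec a *m (hvec (hconj a))^T = blk C l.
Proof.
rewrite -incl_blk -[X in X *m _^T]mulmx1 -(hyperbolic_complete hyp_u).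
rewrite mulmx_sumr mulmx_suml; apply: eq_bigr => a _.
by rewrite trmx_mul !mulmxA.
Qed.

Lemma eblk_swedge a b : eblk (wedge (u a) (u b)) = swedge (hvec a) (hvec b).
Proof.
congr vsproj; rewrite /wedge mulmxBr mulmxBl /hvec !trmx_mul !mulmxA.
by [].
Qed.

Lemma hz_eigen (t : subvs_of h) a : exists c, vsval (vsval t) *m hvec a = c *: hvec a.
Proof.
have th := subvsP t; have [c tc] := hz a th; exists c.
rewrite (pblkK gP (subvP hg _ th)); move: (pblk _) tc => P Pc.
by rewrite /hvec -!mulmxA (mulmxA (incl C l)^T) incl_orth mul1mx Pc -scalemxAr.
Qed.

Lemma split_frame_exists : exists eps : hidx l -> dualh, split_frame g hvec eps.
Proof.
suff [eps epsP] : exists eps : hidx l -> dualh, forall a (t : subvs_of h),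
    vsval (vsval t) *m hvec a = (eps a t : C) *: hvec a.
  exists eps; split=> //; [exact: hvec_dot | exact: blk_hvec | exact: hvec_complete |].
  by move=> a; rewrite -eblk_swedge.
suff /choice[e eP] : forall a, exists e : dualh, forall t : subvs_of h,
    vsval (vsval t) *m hvec a = (e t : C) *: hvec a by exists e.
move=> a.
(* Pairing with the opposite vector extracts the eigenvalue in a way that is visibly linear in t. *)
pose f (t : subvs_of h) : C^o := dotv (hvec (hconj a)) (vsval (vsval t) *m hvec a).
have [|F FE] := @hom_exists _ _ _ f.
  move=> c x y; rewrite /f.
  rewrite -[LHS]/(dotv _ ((c *: vsval (vsval x) + vsval (vsval y)) *m hvec a)).
  by rewrite mulmxDl -scalemxAl dotvDr dotvZr.
exists F => t; rewrite FE /f; have [c ->] := hz_eigen t a.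
by rewrite dotvZr hvec_dot hconjK eqxx mulr1.
Qed.

End HyperbolicCartan.

Theorem cartan_split_frame (C : numClosedFieldType) l (g h : {vspace so C (2 * l +
  4)}) :
    (forall X : so C (2 * l + 4), X \in g <-> blk C l *m vsval X *m blk C l = vsval
      X) ->
    cartan_subalgebra g h ->
  exists v eps, @split_frame C l g h v eps.
Proof.
move=> gP ch; have [u [u1 u2 u3]] := cartan_frame gP ch.
have [hg _ _ _] := ch; exists (hvec u).
exact: split_frame_exists u1 hg u2 u3.
Qed.

Section SplitFrame.
Variables (C : numClosedFieldType) (l : nat).
Local Notation N := (2 * l + 4)%N.
Variables (g h : {vspace so C N}) (hvec : hidx l -> 'cV[C]_N).
Local Notation dualh := 'Hom(subvs_of h, C^o).
Variables (eps : hidx l -> dualh) (F : split_frame g hvec eps).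

Let hvec_dot := frame_dot F.
Let epsP := frame_eps F.
Let hg := frame_sub F.
Let gP := frame_blockP F.

Lemma hvec_neq0 a : hvec a != 0.
Proof.
apply: contra_eq_neq (hvec_dot a (hconj a)) => ->.
by rewrite dot0v eqxx eq_sym oner_eq0.
Qed.

Lemma hvec_outer (t : subvs_of h) a (w : 'rV_N) :
  vsval (vsval t) *m (hvec a *m w) = (eps a t : C) *: (hvec a *m w).
Proof. by rewrite mulmxA epsP -scalemxAl. Qed.

Lemma eps_conj a : eps (hconj a) = - eps a.
Proof.
apply/lfunP => t; have := dotv_skew (hvec (hconj a)) (hvec a) (so_trmx (vsval t)).
by rewrite !epsP dotvZl dotvZr hvec_dot hconjK eqxx !mulr1 opp_lfunE.
Qed.

Lemma eps_None : eps None = 0.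
Proof.
have := eps_conj None; move/eqP; rewrite -addr_eq0 -mulr2n -scaler_nat scaler_eq0.
by rewrite pnatr_eq0 => /eqP.
Qed.

(** The basis of h dual to the weights [eps (Some (i, false))]. *)
Definition hco (i : 'I_l) : subvs_of h := vsproj h (swedge (hvec (Some (i, false)))
  (hvec (Some (i, true)))).

Lemma hcoE i : vsval (hco i) = swedge (hvec (Some (i, false))) (hvec (Some (i, true))).
Proof. by rewrite vsprojK //; apply: (frame_in F (Some (i, false))). Qed.

Lemma eps_hco a i : eps a (hco i) =
  (a == Some (i, false))%:R - (a == Some (i, true))%:R :> C.
Proof.
have := epsP a (hco i);
  rewrite hcoE swedgeE wedge_mul !hvec_dot /= => /(congr1 (dotv (hvec (hconj a)))).
rewrite dotvBr !dotvZr !hvec_dot !hconjK eqxx mulr1 => <-.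
by rewrite ![Some _ == _]eq_sym -!natrM !mulnb !andbb.
Qed.

Lemma eps_false_hco i j : eps (Some (i, false)) (hco j) = (i == j)%:R :> C.
Proof.
rewrite eps_hco (_ : (_ == Some (j, true)) = false) ?subr0; last by apply/eqP => -[].
by congr (nat_of_bool _)%:R; apply/eqP/eqP => [[]|->].
Qed.

Lemma sum_hidx (V : nmodType) (f : hidx l -> V) :
  \sum_a f a = f None + \sum_i (f (Some (i, false)) + f (Some (i, true))).
Proof.
rewrite (bigD1 None) //=; congr (_ + _).
rewrite (reindex_omap Some id) => [|[]] //=.
rewrite (eq_bigl xpredT) => [|j]; last by rewrite eqxx.
rewrite (eq_bigr (fun p => f (Some (p.1, p.2)))) => [|[]] //.
rewrite -(pair_bigA _ (fun i b => f (Some (i, b)))) /=.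
by apply: eq_bigr => i _; rewrite big_bool addrC.
Qed.

Lemma eps_true i : eps (Some (i, true)) = - eps (Some (i, false)).
Proof. exact: (eps_conj (Some (i, false))). Qed.

(** The resolution of the block identity writes x as the sum of the c_a v_a v_(hconj a)^T. Skewness
    makes c odd under [hconj], so the terms pair up into wedges. With [frame_in], h is thus the full
    diagonal subalgebra of g. *)
Lemma diag_swedge (x : so C N) (c : hidx l -> C) : x \in g ->
    (forall a, vsval x *m hvec a = c a *: hvec a) ->
  x = \sum_i c (Some (i, false)) *:
        swedge (hvec (Some (i, false))) (hvec (Some (i, true))).
Proof.
move=> xg xc; have cC a : c (hconj a) = - c a.
  have := dotv_skew (hvec (hconj a)) (hvec a) (so_trmx x).
  by rewrite !xc dotvZl dotvZr hvec_dot hconjK eqxx !mulr1.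
have c0 : c None = 0.
  by have /eqP := cC None; rewrite -addr_eq0 -mulr2n mulrn_eq0 => /eqP.
apply: val_inj; rewrite raddf_sum /=.
have -> : vsval x = vsval x *m blk C l.
  by move/gP: xg => <-; rewrite -!mulmxA blk_idem.
rewrite -(frame_complete F) mulmx_sumr.
rewrite (eq_bigr (fun a => c a *: (hvec a *m (hvec (hconj a))^T))); last first.
  by move=> a _; rewrite mulmxA xc scalemxAl.
rewrite sum_hidx c0 scale0r add0r; apply: eq_bigr => i _.
rewrite -[RHS]/(_ *: vsval _) swedgeE /= (cC (Some (i, false))).
by rewrite scaleNr -scalerBr.
Qed.

Lemma eps_hcoK (t : subvs_of h) : t = \sum_i (eps (Some (i, false)) t : C) *: hco i.
Proof.
have tg : vsval t \in g by apply: (subvP hg); apply: subvsP.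
apply: val_inj; rewrite raddf_sum /= (diag_swedge tg (c := fun a => eps a t)) //.
by apply: eq_bigr => i _; rewrite hcoE.
Qed.

Lemma dual_hco (al be : dualh) : (forall i, al (hco i) = be (hco i)) -> al = be.
Proof.
move=> E; apply/lfunP => t; rewrite (eps_hcoK t) !linear_sum.
by apply: eq_bigr => i _; rewrite !linearZ /= E.
Qed.

Lemma trace_hco (t s : subvs_of h) : \tr (vsval (vsval t) *m vsval (vsval s)) =
  2 * \sum_i (eps (Some (i, false)) t : C) * (eps (Some (i, false)) s : C).
Proof.
have sg : vsval s \in g by apply: (subvP hg); apply: subvsP.
have -> : vsval (vsval s) = vsval (vsval s) *m blk C l.
  by move/gP: sg => <-; rewrite -!mulmxA blk_idem.
rewrite -(frame_complete F) mulmx_sumr mulmx_sumr linear_sum /=.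
have E a : \tr (vsval (vsval t) *m (vsval (vsval s) *m (hvec a *m (hvec (hconj a))^T)))
    = (eps a t : C) * (eps a s : C).
  rewrite !hvec_outer -scalemxAr hvec_outer !linearZ /= mxtrace_mulC dotv_mulmx.
  by rewrite hvec_dot hconjK eqxx mxtrace1 mulr1 mulrC.
rewrite (eq_bigr _ (fun a _ => E a)).
rewrite sum_hidx eps_None lfunE mul0r add0r mulr_sumr; apply: eq_bigr => i _.
by rewrite eps_true !opp_lfunE mulrNN mulr_natl mulr2n.
Qed.

Lemma dual_sum (I : finType) (c : I -> C) (t : I -> subvs_of h) (al : dualh) :
  (al (\sum_j c j *: t j) : C) = \sum_j c j * al (t j).
Proof. by rewrite linear_sum; apply: eq_bigr => j _; rewrite linearZ. Qed.

Lemma eps_sum (c : 'I_l -> C) i :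
  (eps (Some (i, false)) (\sum_j c j *: hco j) : C) = c i.
Proof.
rewrite dual_sum (bigD1 i) //= eps_false_hco eqxx mulr1 big1 ?addr0 // => j ji.
by rewrite eps_false_hco eq_sym (negPf ji) mulr0.
Qed.

(** In the basis [hco] the trace form is twice the standard one, since opposite weights contribute
    equally; hence the factor 2 c, inverted on the dual. *)
Lemma hco_dual_form (kappa : so C N -> so C N -> C) (c : C) (al be : dualh) :
    c != 0 -> (forall x y, x \in h -> y \in h -> kappa x y = c * \tr (vsval x *m
      vsval y)) ->
  dual_form kappa al be = (2 * c)^-1 * \sum_i (al (hco i) : C) * (be (hco i) : C).
Proof.
move=> c0 kE; have c20 : 2 * c != 0 by rewrite mulf_neq0 ?pnatr_eq0.
have kh (t s : subvs_of h) : kappa (vsval t) (vsval s) =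
    2 * c * \sum_i (eps (Some (i, false)) t : C) * (eps (Some (i, false)) s : C).
  by rewrite kE ?subvsP // trace_hco mulrA (mulrC 2).
have dv (ga : dualh) i : (eps (Some (i, false)) (dual_vec kappa ga) : C) = (2 * c)^-1
  * ga (hco i).
  have dvP : forall s, kappa (vsval (dual_vec kappa ga)) (vsval s) = ga s.
    rewrite /dual_vec; case: xgetP => [t _ //|no].
    case: (no (\sum_j ((2 * c)^-1 * ga (hco j)) *: hco j)) => s /=.
    rewrite kh {2}(eps_hcoK s) dual_sum mulr_sumr; apply: eq_bigr => j _.
    by rewrite eps_sum mulrA mulrA divff // mul1r mulrC.
  have := dvP (hco i); rewrite kh (bigD1 i) //= [eps _ (hco i)]eps_false_hco eqxx
    mulr1 big1.
    by rewrite addr0 => <-; rewrite mulKf.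
  move=> j ji; by rewrite [X in _ * X]eps_false_hco (negPf ji) mulr0.
rewrite /dual_form kh mulr_sumr mulr_sumr; apply: eq_bigr => i _.
by rewrite !dv; field; rewrite c0.
Qed.

End SplitFrame.

(** * Roots of g_(0,0) *)

Section Roots.
Variables (C : numClosedFieldType) (l : nat).
Local Notation N := (2 * l + 4)%N.
Local Notation n := ((2 * l).+1).
Variables (g h : {vspace so C N}) (v : hidx l -> 'cV[C]_N).
Local Notation dualh := 'Hom(subvs_of h, C^o).
Variables (eps : hidx l -> dualh) (F : split_frame g v eps).

Let v_dot := frame_dot F.
Let epsP := frame_eps F.
Let hg := frame_sub F.
Let gP := frame_blockP F.

(* The frame completed by the coordinate vectors outside the block; the indices
   inside it are redundant and give 0. *)
Definition xvec (f : hidx l + 'I_N) : 'cV[C]_N :=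
  match f with inl a => v a | inr k => if (k < n)%N then 0 else delta_mx k 0 end.
Definition xeps (f : hidx l + 'I_N) : dualh := if f is inl a then eps a else 0.
Definition xconj (f : hidx l + 'I_N) : hidx l + 'I_N :=
  if f is inl a then inl (hconj a) else f.

Lemma xvec_complete : \sum_f xvec f *m (xvec (xconj f))^T = 1%:M.
Proof.
rewrite big_sumType /= (frame_complete F).
rewrite -[RHS](subrK (blk C l)) addrC; congr (_ + _).
apply/matrixP => i j; rewrite summxE !mxE.
have E (k : 'I_N) : (xvec (inr k) *m (xvec (inr k))^T) i j
    = ((k == i) && (k == j) && ~~ (k < n)%N)%:R.
  rewrite /=; case: ifP => kn; first by rewrite mul0mx mxE andbF.
  rewrite trmx_delta mul_delta_mx mxE andbT [i == k]eq_sym [j == k]eq_sym.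
  by [].
under eq_bigr => k _ do rewrite E.
rewrite (bigD1 i) //= eqxx /= big1 ?addr0 => [|k /negPf->] //.
by case: (i == j); case: (i < n)%N; rewrite /= ?mulr1n ?mulr0n ?subr0 ?subrr.
Qed.

Lemma xvec_pairing (x : 'M[C]_N) : x != 0 ->
  exists f f', dotv (xvec f) (x *m xvec f') != 0.
Proof.
apply: contra_neqP => /forallNP no;
  rewrite -[x]mul1mx -[1%:M *m x]mulmx1 -xvec_complete.
rewrite mulmx_suml mulmx_suml big1 // => f _; rewrite mulmx_sumr big1 // => f' _.
have /forallNP/(_ f')/negP := no (xconj f); rewrite negbK => /eqP xff.
by rewrite -!mulmxA (mulmxA x) (mulmxA _^T) dotv_mulmx xff -scalemx1 scale0r mul0mx
  mulmx0.
Qed.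

Lemma block_outside (x : so C N) (k : 'I_N) : x \in g -> ~~ (k < n)%N ->
  vsval x *m delta_mx k (0 : 'I_1) = 0.
Proof.
move=> /gP xg kn; rewrite -colE; apply/colP => i.
by rewrite mxE -xg blk_entry (negPf kn) andbF mxE.
Qed.

Lemma xepsP f (t : subvs_of h) : vsval (vsval t) *m xvec f = (xeps f t : C) *: xvec f.
Proof.
case: f => [a|k] /=; first exact: epsP.
rewrite lfunE scale0r; case: ifPn => kn; first by rewrite mulmx0.
by rewrite block_outside // (subvP hg) ?subvsP.
Qed.

(** By [lie_pairing] a single nonzero matrix coefficient determines the weight. This holds in all of
    so_(2l+4), not just in g. *)
Lemma eigen_pairing (al : dualh) (x : so C N) f f' :
    (forall t : subvs_of h, lie (vsval t) x = (al t : C) *: x) ->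
    dotv (xvec f) (vsval x *m xvec f') != 0 ->
  al = xeps (xconj f) + xeps (xconj f').
Proof.
move=> ax ff'; apply/lfunP => t.
have := lie_pairing x (xepsP f t) (xepsP f' t).
rewrite ax so_valZ -scalemxAl dotvZr => /(mulIf ff') ->.
have E a : (xeps (xconj a) t : C) = - (xeps a t : C).
  by case: a => [a|k] /=; rewrite ?(eps_conj F) ?opp_lfunE // lfunE oppr0.
by rewrite add_lfunE !E opprD.
Qed.

Lemma pairing_skew (x : so C N) w : dotv w (vsval x *m w) = 0.
Proof.
have := dotv_skew w w (so_trmx x); rewrite dotvC => /eqP.
by rewrite -addr_eq0 -mulr2n mulrn_eq0 => /eqP.
Qed.

(** A nonzero coefficient of the root vector lies between two block vectors; skewness excludes equal
    vectors, and a nonzero weight excludes opposite ones. *)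
Lemma root_eps (al : dualh) : lie_root g al ->
  exists a b, [/\ a != b, b != hconj a & al = eps a + eps b].
Proof.
case=> al0 [x [xg x0 ax]].
have /xvec_pairing[f [f' ff']] : vsval x != 0 by apply: contra_notN x0 => /eqP E;
  apply: val_inj.
have alE := eigen_pairing ax ff'.
have inr0 k : vsval x *m xvec (inr k) = 0.
  by rewrite /=; case: ifPn => kn; rewrite ?mulmx0 ?block_outside.
case: f' => [b|k] in ff' alE *; last by rewrite inr0 dotv0 eqxx in ff'.
case: f => [a|k] in ff' alE *; last first.
  by rewrite -[dotv _ _]opprK -dotv_skew ?so_trmx // inr0 dot0v oppr0 eqxx in ff'.
exists (hconj a), (hconj b); split=> //.
- rewrite (inj_eq (inv_inj (@hconjK l))); apply: contraNneq ff' => -> /=.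
  by rewrite pairing_skew.
- apply: contra_notN al0 => /eqP E; rewrite alE /= E hconjK -[in LHS](hconjK a).
  by rewrite (eps_conj F) hconjK addNr.
Qed.

Lemma eps_eq0 a : eps a = 0 -> a = None.
Proof.
case: a => [[i b]|] // /(congr1 (fun e : dualh => e (hco h v i) : C)).
rewrite (eps_hco F) lfunE => /eqP; case: b.
  rewrite (_ : (_ == Some (i, false)) = false); last by apply/eqP => -[].
  by rewrite eqxx sub0r oppr_eq0 oner_eq0.
rewrite (_ : (_ == Some (i, true)) = false); last by apply/eqP => -[].
by rewrite eqxx subr0 oner_eq0.
Qed.

Lemma hidx_Some_eq i j b : (Some (i, b) == Some (j, b) :> hidx l) = (i == j).
Proof. by apply/eqP/eqP => [[]|->]. Qed.

Lemma hidx_Some_neq i j b : (Some (i, b) == Some (j, ~~ b) :> hidx l) = false.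
Proof. by apply/eqP => -[_]; case: b. Qed.

Lemma eps_val (i : 'I_l) s j : (eps (Some (i, s)) (hco h v j) : C) = (-1) ^+ s * (i
  == j)%:R.
Proof.
case: s; last by rewrite (eps_false_hco F) mul1r.
by rewrite (eps_true F) opp_lfunE (eps_false_hco F) expr1 mulN1r.
Qed.

Lemma eps_root a b : a != b -> b != hconj a -> lie_root g (eps a + eps b).
Proof.
move=> ab ba; split.
  move=> /eqP; rewrite addr_eq0 => /eqP E.
  case: a b ab ba E => [[i s]|] [[j s']|] //=.
  - move=> ab ba /(congr1 (fun e : dualh => e (hco h v i) : C)).
    rewrite opp_lfunE !eps_val eqxx mulr1; have [ji|ij] := eqVneq j i.
      rewrite {}ji in ab ba *; case: s s' ab ba => [] [] //; rewrite ?eqxx //.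
    by rewrite mulr0 oppr0 => /eqP; rewrite signr_eq0.
  - by move=> _ _; rewrite (eps_None F) oppr0 => /eps_eq0.
  - by move=> _ _; rewrite (eps_None F) => /esym/eqP; rewrite oppr_eq0 => /eqP/eps_eq0.
exists (swedge (v a) (v b)); split.
- by apply: (swedge_block gP); apply: (frame_blk F).
- apply/eqP; apply: (swedge_neq0 (z := v (hconj b))); last exact: (hvec_neq0 F).
    rewrite v_dot (inj_eq (inv_inj (@hconjK l))) eq_sym.
    by rewrite (negPf ab).
  by rewrite v_dot eqxx oner_eq0.
- by move=> t; rewrite (lie_swedge_eigen (epsP a t) (epsP b t)) add_lfunE.
Qed.

End Roots.

(** * Simple roots and the Cartan matrix of type B_l *)

Section CartanMatrix.
Variables (C : numClosedFieldType) (l : nat).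
Local Notation N := (2 * l + 4)%N.
Local Notation n := ((2 * l).+1).
Variables (g h : {vspace so C N}) (v : hidx l -> 'cV[C]_N).
Local Notation dualh := 'Hom(subvs_of h, C^o).
Variables (eps : hidx l -> dualh) (F : split_frame g v eps).
Hypothesis hl : (2 <= l)%N.

Let gP := frame_blockP F.
Let hg := frame_sub F.
Local Notation hc := (hco h v).

(** The value 0 out of range lets the short simple root eps_(l-1) fit the formula eps_k -
    eps_(k+1). *)
Definition epsn (k : nat) : dualh :=
  oapp (fun i : 'I_l => eps (Some (i, false))) 0 (insub k).

Definition simple_root (i : 'I_l) : dualh := epsn i - epsn i.+1.

Lemma epsn_ord (i : 'I_l) : epsn i = eps (Some (i, false)).
Proof. by rewrite /epsn valK. Qed.

Lemma epsn_last : epsn l = 0.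
Proof. by rewrite /epsn insubN // ltnn. Qed.

Lemma epsn_val k (j : 'I_l) : (epsn k (hc j) : C) = (k == j)%:R.
Proof.
rewrite /epsn; case: insubP => [i _ <-|] /=; first by rewrite (eps_false_hco F).
rewrite lfunE; have [->|//] := eqVneq k (j : nat).
by rewrite ltn_ord.
Qed.

Lemma epsn_sum k : (k <= l)%N -> epsn k = \sum_(i < l) simple_root i *+ (k <= i)%N.
Proof.
move=> kl; under eq_bigr => i _ do rewrite mulrb.
rewrite -big_mkcond -(big_geq_mkord _ _ xpredT (fun i => epsn i - epsn i.+1)) /=.
under eq_bigr => i _ do rewrite -opprB.
by rewrite sumrN telescope_sumr // epsn_last sub0r opprK.
Qed.

Lemma simple_root_basis : basis_of fullv [seq simple_root i | i <- enum 'I_l].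
Proof.
pose X := [tuple simple_root i | i < l].
have XE i : X`_(nat_of_ord i) = simple_root i.
  by rewrite -tnth_nth tnth_mktuple.
rewrite -[[seq _ | _ <- _]]/(X : seq _) /basis_of; apply/andP; split.
  rewrite eqEsubv subvf; apply/subvP => al _.
  have -> : al = \sum_i (al (hc i) : C) *: eps (Some (i, false)).
    apply: (dual_hco F) => i; rewrite sum_lfunE (bigD1 i) //= big1 => [|j ji].
      by rewrite addr0 scale_lfunE (eps_false_hco F) eqxx /= [RHS]mulr1.
    by rewrite scale_lfunE (eps_false_hco F) (negPf ji) scaler0.
  rewrite memv_suml // => i _; rewrite rpredZ // -epsn_ord epsn_sum; last exact: ltnW.
  rewrite memv_suml // => j _; rewrite rpredMn // memv_span //.
  by apply/mapP; exists j; rewrite ?mem_enum.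
apply/freeP => k k0.
(* Evaluating at the dual basis gives k_0 = 0 and k_j = k_(j-1), so all coefficients vanish by
   induction. *)
have kE (j : 'I_l) : \sum_(i < l) k i * ((i == j)%:R - (i.+1 == j :> nat)%:R) = 0.
  have /lfunP/(_ (hc j)) := k0; rewrite sum_lfunE lfunE => E; rewrite -[RHS]E.
  apply: eq_bigr => i _; rewrite scale_lfunE XE /simple_root add_lfunE opp_lfunE.
  by rewrite !epsn_val.
have kS (i j : 'I_l) : i.+1 = j -> k i = 0 -> k j = 0.
  move=> ij ki; have := kE j; rewrite (bigD1 j) //= eqxx (bigD1 i) /=; last first.
    by rewrite -val_eqE /= -ij; lia.
  rewrite ki mul0r add0r big1 ?addr0 => [|m /andP[mj mi]].
    by rewrite gtn_eqF // subr0 mulr1.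
  rewrite (negPf mj); case: eqP => [E|]; last by rewrite subrr mulr0.
  by case/eqP: mi; apply: val_inj => /=; lia.
case=> m; elim: m => [|m IH] il; last first.
  by apply: (kS (Ordinal (ltnW il))).
have := kE (Ordinal il);
  rewrite (bigD1 (Ordinal il)) //= ?eqxx subr0 mulr1 big1 ?addr0 // => j ji.
by rewrite (negPf ji) subrr mulr0.
Qed.

Lemma simple_root_root i : lie_root g (simple_root i).
Proof.
rewrite /simple_root epsn_ord; have [il|] := ltnP i.+1 l.
  rewrite (epsn_ord (Ordinal il)) -(eps_true F); apply: (eps_root F).
    by apply/eqP => -[].
  by rewrite /=; apply/eqP => -[] /(congr1 val) /=; lia.
move=> li; have -> : i.+1 = l by have := ltn_ord i; lia.
by rewrite epsn_last oppr0 -(eps_None F); apply: (eps_root F).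
Qed.

Definition hidx_nat (a : hidx l) : nat := if a is Some (i, _) then i : nat else l.
Definition hidx_sgn (a : hidx l) : bool := if a is Some (_, s) then s else false.

Lemma eps_epsn a : eps a = if hidx_sgn a then - epsn (hidx_nat a) else epsn (hidx_nat
  a).
Proof.
by case: a => [[i []]|] /=; rewrite ?epsn_ord ?(eps_true F) // epsn_last (eps_None F).
Qed.

Lemma hidx_nat_le a : (hidx_nat a <= l)%N.
Proof. by case: a => [[i s]|] //=; apply: ltnW. Qed.

Lemma hidx_nat_inj a b : a != b -> b != hconj a -> hidx_nat a != hidx_nat b.
Proof.
case: a b => [[i s]|] [[j s']|] //= ab ba.
- apply: contra_neq ab => /val_inj E; rewrite E in ba *; move: ba.
  by case: s s' => [] [] //; rewrite eqxx.
- by rewrite neq_ltn ltn_ord.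
- by rewrite neq_ltn ltn_ord orbT.
Qed.

(** With [None] placed at position l, where [epsn] is 0, every root is a signed sum of [epsn p] and
    [epsn q] with p < q <= l. Both telescope into simple roots, and p < q keeps the coefficients of
    the difference nonnegative. *)
Lemma root_combination (al : dualh) : lie_root g al -> exists c : 'I_l -> nat,
  let be := \sum_i simple_root i *+ c i in al = be \/ al = - be.
Proof.
move=> /(root_eps F)[a [b [ab ba ->]]].
wlog lt_ab : a b ab ba / (hidx_nat a < hidx_nat b)%N.
  move=> W; have := hidx_nat_inj ab ba; rewrite neq_ltn => /orP[lab|lba];
    first exact: W.
  rewrite addrC; apply: W => //; first by rewrite eq_sym.
  by apply: contraNneq ba => ->; rewrite hconjK.
have sumD : epsn (hidx_nat a) + epsn (hidx_nat b) =
    \sum_i simple_root i *+ ((hidx_nat a <= i) + (hidx_nat b <= i))%N.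
  under eq_bigr => i _ do rewrite mulrnDr.
  by rewrite big_split -!epsn_sum ?hidx_nat_le.
have sumB : epsn (hidx_nat a) - epsn (hidx_nat b) =
    \sum_i simple_root i *+ ((hidx_nat a <= i) - (hidx_nat b <= i))%N.
  rewrite !epsn_sum ?hidx_nat_le // -sumrB; apply: eq_bigr => i _.
  by rewrite mulrnBr //; case: (leqP (hidx_nat b)); case: (leqP (hidx_nat a)) => //=;
    lia.
rewrite !eps_epsn; case: (hidx_sgn a) (hidx_sgn b) => [] [].
- exists (fun i => ((hidx_nat a <= i) + (hidx_nat b <= i))%N); right.
  by rewrite -sumD opprD.
- exists (fun i => ((hidx_nat a <= i) - (hidx_nat b <= i))%N); right.
  by rewrite -sumB opprB addrC.
- by exists (fun i => ((hidx_nat a <= i) - (hidx_nat b <= i))%N); left.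
- by exists (fun i => ((hidx_nat a <= i) + (hidx_nat b <= i))%N); left.
Qed.

Lemma block_dual_form (al be : dualh) : dual_form (killing g) al be =
  (2 * (2 * l - 1)%N%:R)^-1 * \sum_i (al (hc i) : C) * (be (hc i) : C).
Proof.
apply: (hco_dual_form F); first by rewrite pnatr_eq0; lia.
move=> x y xh yh; rewrite (@killing_block _ _ _ g (blk C l)) ?pnatr_eq0 //.
- rewrite blk_trace natrB ?mulnS; last by lia.
  by congr (_ * _); rewrite -natr1; ring.
- exact: blk_tr.
- exact: blk_idem.
- exact: (subvP hg).
- exact: (subvP hg).
Qed.

Lemma full_dual_form (al be : dualh) : dual_form (killing {:so C N}) al be =
  (2 * (2 * l + 2)%N%:R)^-1 * \sum_i (al (hc i) : C) * (be (hc i) : C).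
Proof.
apply: (hco_dual_form F); first by rewrite pnatr_eq0; lia.
move=> x y xh yh; rewrite (@killing_block _ _ _ fullv 1%:M) ?pnatr_eq0 ?memvf ?trmx1
  ?mulmx1 //.
  by rewrite mxtrace1 !natrD; congr (_ * _); ring.
by move=> z; rewrite mul1mx mulmx1 memvf.
Qed.

Lemma sum_indicator (f : nat -> C) m :
  \sum_(k < l) f k * (m == k :> nat)%:R = if (m < l)%N then f m else 0.
Proof.
case: ltnP => [ml|lm].
  rewrite (bigD1 (Ordinal ml)) //= eqxx mulr1 big1 ?addr0 // => k km.
  by rewrite eq_sym; move: km; rewrite -val_eqE /= => /negPf->; rewrite mulr0.
by rewrite big1 // => k _; rewrite gtn_eqF ?mulr0 // (leq_trans (ltn_ord k)).
Qed.

Lemma simple_root_dot i j : \sum_k (simple_root i (hc k) : C) * (simple_root j (hc k)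
  : C) =
  ((i == j :> nat)%:R - (i.+1 == j :> nat)%:R)
  - (if (j.+1 < l)%N then (i == j.+1 :> nat)%:R - (i.+1 == j.+1 :> nat)%:R else 0).
Proof.
have sv k m : (simple_root k (hc m) : C) = (k == m :> nat)%:R - (k.+1 == m :> nat)%:R.
  by rewrite /simple_root add_lfunE opp_lfunE !epsn_val.
rewrite (eq_bigr (fun k : 'I_l => ((i == k :> nat)%:R - (i.+1 == k :> nat)%:R)
    * (j == k :> nat)%:R - ((i == k :> nat)%:R - (i.+1 == k :> nat)%:R)
    * (j.+1 == k :> nat)%:R)); last by move=> k _; rewrite !sv mulrBr.
rewrite sumrB (sum_indicator (fun k => (i == k :> nat)%:R - (i.+1 == k :> nat)%:R))
  ltn_ord.
by rewrite (sum_indicator (fun k => (i == k :> nat)%:R - (i.+1 == k :> nat)%:R)).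
Qed.

Theorem block_cartan_matrix : has_cartan_matrix g h (cartanB l).
Proof.
exists simple_root; split.
- exact: simple_root_basis.
- exact: simple_root_root.
- exact: root_combination.
move=> i j; rewrite !block_dual_form !simple_root_dot.
set c : C := (2 * _)^-1; have c0 : c != 0.
  by rewrite invr_eq0 mulf_neq0 ?pnatr_eq0 //; lia.
(* The normalization of the Killing form cancels; what remains is a case check on the relative
   position of i, j and the last node. *)
have -> (x y : C) : 2 * (c * x) / (c * y) = 2 * x / y.
  by rewrite mulrCA -mulf_div divff // mul1r.
have j1 : (j.+1 == j :> nat) = false by rewrite gtn_eqF.
have j2 : (j == j.+1 :> nat) = false by rewrite ltn_eqF.
rewrite mxE -val_eqE !eqxx j1 j2 /=.
have il := ltn_ord i; have jl := ltn_ord j.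
case: (eqVneq (i : nat) j) => e1; case: (eqVneq i.+1 (j : nat)) => e2;
  case: (eqVneq (i : nat) j.+1) => e3; case: (ltnP j.+1 l) => e4;
  case: (eqVneq i.+2 l) => e5; case: (eqVneq j.+1 l) => e6;
  try (exfalso; lia); rewrite ?eqSS ?(negPf e1) ?e1 ?eqxx /=.
all: by field.
Qed.

End CartanMatrix.

(** * Short and long roots *)

Section RootLengths.
Variables (C : numClosedFieldType) (l : nat).
Local Notation N := (2 * l + 4)%N.
Local Notation n := ((2 * l).+1).
Variables (g h : {vspace so C N}) (v : hidx l -> 'cV[C]_N).
Local Notation dualh := 'Hom(subvs_of h, C^o).
Variables (eps : hidx l -> dualh) (F : split_frame g v eps).
Hypothesis hl : (2 <= l)%N.
Local Notation hc := (hco h v).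

Definition hdot (al be : dualh) : C := \sum_k (al (hc k) : C) * (be (hc k) : C).

Lemma hdotDl al be ga : hdot (al + be) ga = hdot al ga + hdot be ga.
Proof. by rewrite -big_split; apply: eq_bigr => k _; rewrite add_lfunE mulrDl. Qed.

Lemma hdotC al be : hdot al be = hdot be al.
Proof. by apply: eq_bigr => k _; rewrite mulrC. Qed.

Lemma hdot_eps i s j s' : hdot (eps (Some (i, s))) (eps (Some (j, s'))) =
  (-1) ^+ (s (+) s') * (i == j)%:R.
Proof.
rewrite /hdot (bigD1 i) //= big1 => [|k ki]; rewrite !(eps_val F); last first.
  by rewrite eq_sym (negPf ki) mulr0 mul0r.
by rewrite eqxx mulr1 addr0 mulrA -signr_addb eq_sym.
Qed.

Definition short_eps (al : dualh) := exists2 a, a != None & al = eps a.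
Definition long_eps (al : dualh) := exists a b,
  [/\ a != None, b != None, a != b, b != hconj a & al = eps a + eps b].

Lemma hdot_short al : short_eps al -> hdot al al = 1.
Proof. by case=> -[[i s]|] // _ ->; rewrite hdot_eps addbb eqxx mul1r. Qed.

Lemma hdot_long al : long_eps al -> hdot al al = 2.
Proof.
case=> -[[i s]|] [[[j s']|]] [] // _ _ ab ba ->.
have ij : i == j = false.
  apply: contraTF ab => /eqP E; rewrite E negbK in ba *.
  by move: ba; rewrite /=; case: s s' => [] [] //; rewrite eqxx.
rewrite !hdotDl !(hdotC _ (_ + _)) !hdotDl !hdot_eps !addbb !eqxx.
by rewrite ij [j == i]eq_sym ij !mulr0 addr0 add0r mul1r.
Qed.

Lemma root_cases al : lie_root g al <-> short_eps al \/ long_eps al.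
Proof.
split=> [/(root_eps F)[a [b [ab ba ->]]]|].
  have [a0|a0] := eqVneq a None; [left|have [b0|b0] := eqVneq b None; [left|right]].
  - by exists b; rewrite ?a0 ?(eps_None F) ?add0r // -a0 eq_sym.
  - by exists a => //; rewrite b0 (eps_None F) addr0.
  - by exists a, b.
case=> [[a a0 ->]|[a [b [_ _ ab ba ->]]]]; last exact: (eps_root F).
by rewrite -[eps a]addr0 -(eps_None F); apply: (eps_root F) => //;
  case: a a0 => [[i s]|].
Qed.

Lemma short_eps_exists : exists al, short_eps al.
Proof.
have l0 : (0 < l)%N by apply: leq_trans hl.
by exists (eps (Some (Ordinal l0, false))), (Some (Ordinal l0, false)).
Qed.

Lemma long_eps_exists : exists al, long_eps al.
Proof.
have l0 : (0 < l)%N by apply: leq_trans hl.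
pose a : hidx l := Some (Ordinal l0, false);
  pose b : hidx l := Some (Ordinal hl, false).
by exists (eps a + eps b), a, b.
Qed.


Lemma dual_form_lt (al be : dualh) :
  (dual_form (killing g) al al < dual_form (killing g) be be) = (hdot al al < hdot be
    be).
Proof.
have c0 : 0 < (2 * (2 * l - 1)%N%:R : C)^-1.
  by rewrite invr_gt0 mulr_gt0 ?ltr0n //; lia.
by rewrite !(block_dual_form F) // ltr_pM2l.
Qed.

Let lt12 : 1 < 2 :> C. Proof. by rewrite ltr1n. Qed.

(** Short means shorter than some root, so the converse needs a long root to compare with, hence two
    different indices below l. *)
Lemma short_rootP (al : dualh) : short_root g al <-> short_eps al.
Proof.
split=> [[/root_cases[//|al_long] [be /root_cases be_root]]|al_short].
  rewrite dual_form_lt (hdot_long al_long).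
  by case: be_root => [/hdot_short|/hdot_long] ->; rewrite ?ltxx // (lt_gtF lt12).
split; first by apply/root_cases; left.
have [be be_long] := long_eps_exists; exists be; first by apply/root_cases; right.
by rewrite dual_form_lt (hdot_short al_short) (hdot_long be_long) ltr1n.
Qed.

Lemma long_rootP (al : dualh) : long_root g al <-> long_eps al.
Proof.
split=> [[/root_cases[al_short|//] [be /root_cases be_root]]|al_long].
  rewrite dual_form_lt (hdot_short al_short).
  by case: be_root => [/hdot_short|/hdot_long] ->; rewrite ?ltxx // (lt_gtF lt12).
split; first by apply/root_cases; right.
have [be be_short] := short_eps_exists; exists be; first by apply/root_cases; left.
by rewrite dual_form_lt (hdot_long al_long) (hdot_short be_short) ltr1n.
Qed.

Lemma root_nonisotropic (al : dualh) : lie_root g al -> dual_form (killing {:so C N})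
  al al != 0.
Proof.
move=> /root_cases al_root; rewrite (full_dual_form F) //; apply: mulf_neq0.
  by rewrite invr_eq0 mulf_neq0 ?pnatr_eq0 //; lia.
by rewrite -/(hdot al al); case: al_root => [/hdot_short|/hdot_long] ->;
  rewrite ?oner_eq0 ?pnatr_eq0.
Qed.

(** Prepares the parity argument. A nonzero coefficient of x that involves an outside coordinate
    vector makes the weight short; one between two block vectors gives a nonzero entry inside the
    block, where all signs are trivial. *)
Lemma eigen_root (al : dualh) (x : so C N) : al <> 0 -> x <> 0 ->
    (forall t : subvs_of h, lie (vsval t) x = (al t : C) *: x) ->
  short_eps al \/ (lie_root g al /\
    exists i j : 'I_N, [/\ (i < n)%N, (j < n)%N & vsval x i j != 0]).
Proof.
move=> al0 x0 ax.
have [f [f' ff']] : exists f f', dotv (xvec v f) (vsval x *m xvec v f') != 0.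
  by apply: (xvec_pairing F); apply: contra_notN x0 => /eqP E; apply: val_inj.
have := eigen_pairing F ax ff'; case: f f' ff' => [a|k] [b|k'] ff' /= alE.
- right; split.
    rewrite alE; apply: (eps_root F).
      rewrite (inj_eq (inv_inj (@hconjK l))); apply: contraNneq ff' => -> /=.
      by rewrite pairing_skew.
    rewrite (inj_eq (inv_inj (@hconjK l))).
    apply: contra_notN al0 => /eqP E; rewrite alE E hconjK.
    by rewrite (eps_conj F) addNr.
  have bxb : blk C l *m vsval x *m blk C l != 0.
    apply: contraNneq ff' => E /=; rewrite -(frame_blk F b) -[v a](frame_blk F).
    by rewrite dotvM blk_tr !mulmxA E mul0mx dotv0.
  have [i [j]] : exists i j, (blk C l *m vsval x *m blk C l) i j != 0.
    apply: contra_neqP bxb => /forallNP no; apply/matrixP => i j; rewrite [RHS]mxE.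
    by have /forallNP/(_ j)/negP := no i; rewrite negbK => /eqP.
  by rewrite blk_entry; case: ifP => [/andP[iN jN]|]; rewrite ?eqxx //; exists i, j.
- left; exists (hconj a); last by rewrite alE addr0.
  by apply: contra_notN al0 => /eqP E; rewrite alE E (eps_None F) addr0.
- left; exists (hconj b); last by rewrite alE add0r.
  by apply: contra_notN al0 => /eqP E; rewrite alE E (eps_None F) addr0.
- by case: al0; rewrite alE addr0.
Qed.

Lemma outside_eigen a (k : 'I_N) : a != None -> ~~ (k < n)%N ->
  swedge (v a) (delta_mx k 0) != 0 /\
  forall t : subvs_of h, lie (vsval t) (swedge (v a) (delta_mx k 0)) =
    (eps a t : C) *: swedge (v a) (delta_mx k 0).
Proof.
move=> a0 kn; have kk : dotv (delta_mx k 0) (delta_mx k 0) = 1 :> C.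
  by rewrite /dotv trmx_delta mul_delta_mx mxE !eqxx.
have xk : xvec v (inr k) = delta_mx k 0 by rewrite /= (negPf kn).
have dk : blk C l *m delta_mx k (0 : 'I_1) = 0.
  apply/colP => i; rewrite -colE !mxE; case: eqP => [->|]; last by rewrite mulr0n.
  by rewrite (negPf kn).
split.
  rewrite -oppr_eq0 -swedgeC.
  apply: (swedge_neq0 (z := v (hconj a))).
  - by rewrite -(frame_blk F) dotvC dotvM blk_tr dk dotv0.
  - by rewrite (frame_dot F) eqxx oner_eq0.
  - by apply: contra_eq_neq kk => ->; rewrite dotv0 eq_sym oner_eq0.
move=> t; have := xepsP F (inr k) t; rewrite xk lfunE => tk.
by rewrite (lie_swedge_eigen (frame_eps F a t) tk) addr0.
Qed.

Lemma frame_eigen a b : a != b ->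
  swedge (v a) (v b) != 0 /\
  forall t : subvs_of h, lie (vsval t) (swedge (v a) (v b)) =
    (eps a t + eps b t : C) *: swedge (v a) (v b).
Proof.
move=> ab; split; last by move=> t; apply: lie_swedge_eigen; apply: (frame_eps F).
apply: (swedge_neq0 (z := v (hconj b))); last exact: (hvec_neq0 F).
  by rewrite (frame_dot F) (inj_eq (inv_inj (@hconjK l))) eq_sym (negPf ab).
by rewrite (frame_dot F) eqxx oner_eq0.
Qed.

End RootLengths.

(** * Existence of a Cartan subalgebra *)

Section StandardCartan.
Variables (C : numClosedFieldType) (l : nat).
Local Notation N := (2 * l + 4)%N.
Local Notation n := ((2 * l).+1).

Lemma hyperbolic_exists : exists u : hidx l -> 'cV[C]_n, hyperbolic u.
Proof.
pose e k : 'cV[C]_n := delta_mx (inord k) 0.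
have ee j k : (j <= 2 * l)%N -> (k <= 2 * l)%N -> dotv (e j) (e k) = (j == k)%:R.
  move=> jl kl; rewrite /dotv trmx_delta mul_delta_mx_cond mulmxnE mxE !eqxx /=.
  rewrite -[_ == _ :> 'I__]val_eqE /= !inordK //.
(* The vectors e_i + 'i e_(l+i) and e_i - 'i e_(l+i) are isotropic with product 2, whence the factor
   1/2. *)
pose u (a : hidx l) := match a with
  | Some (i, false) => e i + 'i *: e (l + i)%N
  | Some (i, true) => 2^-1 *: (e i + (- 'i) *: e (l + i)%N)
  | None => e (2 * l)%N end.
have il (i : 'I_l) : (i <= 2 * l)%N by have := ltn_ord i; lia.
have li (i : 'I_l) : (l + i <= 2 * l)%N by have := ltn_ord i; lia.
have ij (i j : 'I_l) : ((i == l + j :> nat)%N = false) * ((l + i == j :> nat)%N =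
  false).
  by split; apply/negbTE; have := ltn_ord i; have := ltn_ord j; lia.
have i2 (i : 'I_l) : ((i == 2 * l :> nat)%N = false) * ((l + i == 2 * l :> nat)%N =
  false)
    * ((2 * l == i :> nat)%N = false) * ((2 * l == l + i :> nat)%N = false).
  by do !split; apply/negbTE; have := ltn_ord i; lia.
have ii : 'i * 'i = -1 :> C by rewrite -expr2 sqrCi.
exists u => -[[i [] ]|] [[j [] ]|] /=; rewrite ?hidx_Some_eq ?hidx_Some_neq
  ?(hidx_Some_neq j i true) ?(hidx_Some_neq j i false) //=;
  rewrite ?(dotvDl, dotvDr, dotvBl, dotvBr, dotvZl, dotvZr) !ee // ?ij ?i2 ?eqn_add2l;
  rewrite ?eqxx -?val_eqE /= ?(eq_sym (j : nat)) ?mulr0 ?subr0 ?addr0 ?add0r ?sub0r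
    ?mulrN
    ?mulrA ?ii ?mulN1r ?opprK ?subrr ?mulr0 ?oppr0 //.
- by rewrite [- 'i / 2 * _]mulrAC mulrNN ii mulN1r; case: (_ == _); field.
- by rewrite -[2^-1 * _ * 'i]mulrA mulNr ii opprK; case: (_ == _); field.
- by rewrite ['i / 2 * _]mulrAC mulrN ii opprK; case: (_ == _); field.
Qed.

Variables (g : {vspace so C N}).
Hypothesis gP : forall X : so C N, X \in g <-> blk C l *m vsval X *m blk C l = vsval X.

(** The wedges of opposite vectors span an abelian diagonal algebra. If x normalizes it, the
    coefficient of x between v_a and v_b is killed by eps_a + eps_b, which is nonzero unless the
    vectors are equal or opposite; skewness settles the equal ones. So x is diagonal and lies in h
    by [diag_swedge]. *)
Theorem standard_cartan : exists h v eps, @split_frame C l g h v eps /\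
  cartan_subalgebra g h.
Proof.
have [u hu] := hyperbolic_exists; pose v := hvec u.
pose w a := swedge (v a) (v (hconj a)).
pose h : {vspace so C N} := <<codom w>>%VS.
have wE a : eblk (wedge (u a) (u (hconj a))) = w a by rewrite eblk_swedge.
have wh a : w a \in h by rewrite memv_span ?codom_f.
have wg a : w a \in g by rewrite -wE; apply: eblk_in => //; apply: wedge_skew.
have hg : (h <= g)%VS by apply/span_subvP => _ /codomP[a ->].
have hz z a : z \in h -> exists c, pblk z *m u a = c *: u a.
  move=> zh; rewrite (@coord_span _ _ _ (in_tuple _) _ zh).
  elim/big_ind: _ => [|x y [c xc] [d yd]|i _].
  - by exists 0; rewrite scale0r /pblk -[vsval 0]/(0 : 'M[C]_N) mulmx0 !mul0mx.
  - exists (c + d); rewrite /pblk so_valD mulmxDr !mulmxDl scalerDl -xc -yd.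
    by [].
  set k := coord _ _ _; have /codomP[b ->] : (codom w)`_i \in codom w by apply: mem_nth.
  exists (k * ((a == b)%:R - (a == hconj b)%:R)).
  rewrite /pblk so_valZ -scalemxAr -!scalemxAl -scalerA; congr (_ *: _).
  rewrite -/(pblk (w b)) -wE eblkK; last exact: wedge_skew.
  rewrite wedge_mul !hu hconjK scalerBl.
  by congr (_ - _); case: eqP => [->|]; rewrite ?scale1r ?scale0r.
have [eps F] := split_frame_exists gP hu hg (fun a => etrans (erefl _) (etrans
  (congr1 (fun x => x \in h) (wE a)) (wh a))) hz.
exists h, v, eps; split=> //.
have hh x y : x \in h -> y \in h -> lie x y = 0.
  move=> xh yh; have xE : vsval (vsproj h x) = x by rewrite vsprojK.
  have yE : vsval (vsproj h y) = y by rewrite vsprojK.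
  have ew a : vsval (lie x y) *m v a = 0 *: v a.
    rewrite [vsval (lie x y)]so_lieE mulmxBl -!mulmxA -xE -yE !(frame_eps F).
    by rewrite -!scalemxAr !(frame_eps F) !scalerA mulrC subrr scale0r.
  have xyg : lie x y \in g by apply: (block_lie gP); apply: (subvP hg).
  rewrite (diag_swedge F xyg (c := fun=> 0)) // big1 // => i _.
  by rewrite scale0r.
have prod0 : lie_prodv h h = 0%VS.
  by apply/eqP; rewrite -subv0; apply/lie_prodv_subv => x y xh yh; rewrite hh ?mem0v.
split=> //.
- by rewrite /subalgebra prod0 sub0v.
- by exists 1%N.
move=> x [xg xN].
have p0 a b : b != hconj a -> dotv (v a) (vsval x *m v b) = 0.
  move=> ba; have [<-|ab] := eqVneq a b; first exact: pairing_skew.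
  apply: contraTeq isT => pab; have [e0 _] := eps_root F ab ba; case: e0.
  apply/lfunP => t; rewrite add_lfunE lfunE.
  have txh : lie (vsval t) x \in h by rewrite lieC memvN xN // subvsP.
  have := lie_pairing x (frame_eps F a t) (frame_eps F b t).
  have := frame_eps F b (vsproj h (lie (vsval t) x)); rewrite vsprojK // => ->.
  rewrite dotvZr (frame_dot F) (negPf ba) mulr0 => /esym/eqP.
  by rewrite mulf_eq0 (negPf pab) orbF oppr_eq0 => /eqP.
have xv b : vsval x *m v b = dotv (v (hconj b)) (vsval x *m v b) *: v b.
  have {1}-> : vsval x = blk C l *m vsval x by move/gP: xg => <-;
    rewrite !mulmxA blk_idem.
  rewrite -mulmxA -(frame_complete F) mulmx_suml (bigD1 b) //= big1 => [|a ab].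
    by rewrite addr0 outer_mul.
  rewrite outer_mul p0 ?scale0r // hconjK eq_sym.
  by [].
rewrite (diag_swedge F xg xv) memv_suml // => i _; rewrite memvZ //.
exact: (frame_in F (Some (i, false))).
Qed.

End StandardCartan.

(** * Simplicity *)

Section Simple.
Variables (C : numClosedFieldType) (l : nat).
Hypothesis hl : (2 <= l)%N.
Local Notation N := (2 * l + 4)%N.
Local Notation n := ((2 * l).+1).
Variables (g : {vspace so C N}).
Hypothesis gP : forall X : so C N, X \in g <-> blk C l *m vsval X *m blk C l = vsval X.

Definition unitv (i : 'I_N) : 'cV[C]_N := delta_mx i 0.

Definition rot (i j : 'I_N) : so C N := swedge (unitv i) (unitv j).

Lemma unitv_dot i j : dotv (unitv i) (unitv j) = (i == j)%:R.
Proof. by rewrite /dotv trmx_delta mul_delta_mx_cond mulmxnE mxE !eqxx. Qed.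

Lemma dotv_unitv i (w : 'cV[C]_N) : dotv (unitv i) w = w i 0.
Proof. by rewrite /dotv trmx_delta -rowE mxE. Qed.

Lemma rot_entry i j a b : vsval (rot i j) a b =
  ((a == i) && (b == j))%:R - ((a == j) && (b == i))%:R.
Proof.
rewrite swedgeE !mxE !big_ord1 !mxE !andbT -!natrM !mulnb.
by [].
Qed.

Lemma rotC i j : rot i j = - rot j i.
Proof. exact: swedgeC. Qed.

Lemma lie_rot_entry a b (x : so C N) i j : vsval (lie (rot a b) x) i j =
  (i == a)%:R * vsval x b j - (i == b)%:R * vsval x a j
  - (vsval x i a * (j == b)%:R - vsval x i b * (j == a)%:R).
Proof.
have E m (A : 'M[C]_(N, m)) : vsval (rot a b) *m A = unitv a *m row b A - unitv b *m
  row a A.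
  by rewrite swedgeE mulmxBl -!mulmxA !trmx_delta -!rowE.
have E' m (A : 'M[C]_(m, N)) :
    A *m vsval (rot a b) = col a A *m (unitv b)^T - col b A *m (unitv a)^T.
  by rewrite swedgeE mulmxBr !mulmxA -!colE.
rewrite [vsval (lie _ x)]so_lieE E E' !mxE !big_ord1 !mxE !andbT.
by [].
Qed.

Lemma so_entryC (x : so C N) i j : vsval x j i = - vsval x i j.
Proof. by have /matrixP/(_ i j) := so_trmx x; rewrite !mxE. Qed.

Lemma so_diag0 (x : so C N) i : vsval x i i = 0.
Proof.
by have /eqP := so_entryC x i i; rewrite -addr_eq0 -mulr2n mulrn_eq0 => /eqP.
Qed.

(** The generator of rotations in the plane (a, b) squares to -1 on that plane and to 0 off it;
    minus the square of its ad is the projection onto the entries joining the plane to its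
    complement. *)
Lemma rot_sqr_entry a b (x : so C N) i j : a != b ->
  vsval (- lie (rot a b) (lie (rot a b) x)) i j =
  (((i == a) || (i == b)) (+) ((j == a) || (j == b)))%:R * vsval x i j.
Proof.
move=> ab; have ba : b == a = false by rewrite eq_sym (negPf ab).
have xaa := so_diag0 x a; have xbb := so_diag0 x b; have xC := so_entryC x.
rewrite -[vsval (- _)]/(- vsval _) mxE !lie_rot_entry.
rewrite !eqxx !ba (negPf ab) ?mul1r ?mul0r ?mulr0 ?mulr1.
have [->|ia] := eqVneq i a; last have [->|ib] := eqVneq i b;
 (have [->|ja] := eqVneq j a; last have [->|jb] := eqVneq j b);
 rewrite ?eqxx ?ba ?(negPf ab) ?(negPf ia) ?(negPf ib) ?(negPf ja) ?(negPf jb) /=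
   ?xaa ?xbb ?(xC a b); by ring.
Qed.

Lemma blk_unitv (i : 'I_N) : (i < n)%N -> blk C l *m unitv i = unitv i.
Proof.
move=> iN; apply/colP => j; rewrite -colE !mxE.
by case: eqP => [->|]; rewrite ?iN ?eqxx ?mulr1n ?mulr0n ?andbT //; case: eqP.
Qed.

Lemma rot_in (i j : 'I_N) : (i < n)%N -> (j < n)%N -> rot i j \in g.
Proof. by move=> iN jN; apply: swedge_block => //; apply: blk_unitv. Qed.

Lemma rotE i j : vsval (rot i j) = delta_mx i j - delta_mx j i.
Proof. by rewrite swedgeE /wedge !trmx_delta !mul_delta_mx. Qed.

Lemma rot_sum (x : so C N) : x = \sum_i \sum_j (2^-1 * vsval x i j) *: rot i j.
Proof.
apply: val_inj; set X := \val x.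
have XT : X^T = - X := so_trmx x.
have E : X - X^T = \sum_i \sum_j X i j *: (delta_mx i j - delta_mx j i).
  rewrite [in LHS](matrix_sum_delta X) linear_sum -sumrB; apply: eq_bigr => i _.
  rewrite linear_sum -sumrB; apply: eq_bigr => j _.
  by rewrite linearZ /= trmx_delta -scalerBr.
have -> : X = 2^-1 *: (X - X^T).
  by rewrite XT opprK -mulr2n -scaler_nat scalerA mulVf ?scale1r // pnatr_eq0.
rewrite E scaler_sumr raddf_sum; apply: eq_bigr => i _.
rewrite scaler_sumr raddf_sum; apply: eq_bigr => j _.
rewrite -[RHS]/((2^-1 * X i j) *: vsval (rot i j)) rotE scalerA.
by [].
Qed.

Lemma block_entry0 (x : so C N) (i j : 'I_N) : x \in g -> vsval x i j != 0 ->
  (i < n)%N && (j < n)%N.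
Proof. by move=> /gP <-; rewrite blk_entry; case: ifP; rewrite ?eqxx. Qed.

Lemma lie_rot i j k : i != j -> j != k -> k != i -> lie (rot i j) (rot j k) = rot i k.
Proof.
move=> ij jk ki; rewrite lie_swedge !swedgeE !wedge_mul !unitv_dot eqxx.
rewrite (negPf ij) (negPf jk) [i == k]eq_sym (negPf ki) scale1r !scale0r !subr0.
by rewrite [X in _ + X](_ : _ = 0) ?addr0 //; apply: val_inj;
  rewrite /= swedgeE /wedge trmx0 mulmx0 mul0mx subrr.
Qed.

Lemma rot_neq0 (i j : 'I_N) : i != j -> rot i j != 0.
Proof.
move=> ij; apply: contraNneq ij => E; have := rot_entry i j i j.
rewrite E -[vsval 0]/(0 : 'M[C]_N) mxE !eqxx; case: eqP => //= _ /eqP.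
by rewrite subr0 eq_sym oner_eq0.
Qed.

(* Applying -(ad E_pr)^2 for every r in the block other than p and q isolates the
   (p, q) entry of x; two values of r would not suffice, whence n >= 5. *)
Lemma ideal_rot (I : {vspace so C N}) : ideal_of g I -> I <> 0%VS ->
  exists p q : 'I_N, [/\ (p < n)%N, (q < n)%N, p != q & rot p q \in I].
Proof.
case=> Ig gI I0; have lieI x y : x \in g -> y \in I -> lie x y \in I.
  by move=> xg yI; apply: (subvP gI); apply: memv_lie_prodv.
have [x xI x0] : exists2 x, x \in I & x != 0.
  exists (vpick I); first exact: memv_pick.
  by rewrite vpick0; apply/eqP.
have [p [q xpq]] : exists p q, vsval x p q != 0.
  apply: contra_neqP x0 => /forallNP no; apply: val_inj; apply/matrixP => i j.
  by rewrite [RHS]mxE; have /forallNP/(_ j)/negP := no i; rewrite negbK => /eqP.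
have xg := subvP Ig _ xI; have /andP[pN qN] := block_entry0 xg xpq.
have pq : p != q by apply: contraNneq xpq => ->; rewrite so_diag0.
exists p, q; split=> //.
pose rs := [seq r : 'I_N <- enum 'I_N | [&& (r < n)%N, r != p & r != q]].
pose sel (r i j : 'I_N) := ((i == p) || (i == r)) (+) ((j == p) || (j == r)).
have [y yI yE] : exists2 y, y \in I &
    forall i j, vsval y i j = (all (fun r => sel r i j) rs)%:R * vsval x i j.
  have : all (fun r : 'I_N => (r < n)%N && (r != p)) rs.
    by apply/allP => r; rewrite mem_filter => /andP[/and3P[-> ->]].
  elim: rs => [|r rs IH] /=; first by exists x => // i j; rewrite mul1r.
  case/andP=> /andP[rN rp] /IH[y yI yE].
  exists (- lie (rot p r) (lie (rot p r) y)).
    by rewrite memvN; apply: (lieI); [exact: rot_in | apply: lieI; first exact: rot_in].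
  by move=> i j; rewrite rot_sqr_entry ?yE ?mulrA -?natrM ?mulnb // eq_sym.
have selE i j : vsval x i j != 0 -> all (fun r => sel r i j) rs ->
    (i == p) && (j == q) || (i == q) && (j == p).
  move=> xij /allP rsP; have /andP[iN jN] := block_entry0 xg xij.
  have ij : i != j by apply: contraNneq xij => ->; rewrite so_diag0.
  have rsE (r : 'I_N) : (r < n)%N -> r != p -> r != q -> sel r i j.
    by move=> rN rp rq; apply: rsP; rewrite mem_filter rN rp rq mem_enum.
  have [ip|ip] := eqVneq i p.
    have [//|jq] := eqVneq j q; have jp : j != p by rewrite -ip eq_sym.
    by have := rsE j jN jp jq; rewrite /sel ip !eqxx orbT.
  have [jp|jp] := eqVneq j p.
    have [//|iq] := eqVneq i q.
    by have := rsE i iN ip iq; rewrite /sel jp !eqxx orbT.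
  (* Neither index is p. By pigeonhole one of five values avoids p, q, i and j, and the projection
     for this r kills the (i, j) entry. *)
  have [r r5 rP] : exists2 r : nat, r \in iota 0 5 & r \notin [:: (p : nat);
    (q : nat); (i : nat); (j : nat)].
    apply/hasP; rewrite -[has _ _]negbK -all_predC; apply/negP => /allP all5.
    have := @uniq_leq_size _ (iota 0 5) [:: (p : nat); (q : nat); (i : nat); (j : nat)].
    case/(_ isT _)/idPn => // k k5; have := all5 k k5.
    by rewrite /= negbK.
  have rn : (r < n)%N.
    move: r5; rewrite mem_iota add0n => /andP[_ r5]; apply: leq_trans r5 _.
    by rewrite ltnS -[4%N]/(2 * 2)%N leq_mul2l hl orbT.
  have rN : (r < N)%N by apply: leq_trans rn _; rewrite -addn1 leq_add2l.
  have {}rsE := rsE (Ordinal rN) rn.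
  have val_eq (k : 'I_N) : (Ordinal rN == k) = (r == k :> nat) by [].
  move: rP; rewrite !inE !negb_or => /and4P[rp rq ri rj].
  have := rsE _ _; rewrite !val_eq => /(_ rp rq).
  by rewrite /sel (negPf ip) (negPf jp) ![_ == Ordinal rN]eq_sym !val_eq (negPf ri)
    (negPf rj).
have selpq : all (fun r => sel r p q) rs /\ all (fun r => sel r q p) rs.
  have qp : q == p = false by rewrite eq_sym (negPf pq).
  by split; apply/allP => r; rewrite mem_filter => /andP[/and3P[_ rp rq] _];
    rewrite /sel eqxx qp [q == r]eq_sym (negPf rq).
have -> : rot p q = (vsval x p q)^-1 *: y.
  apply: val_inj; apply/matrixP => i j.
  rewrite -[\val (_ *: _)]/(_ *: vsval y) [RHS]mxE yE rot_entry.
  have [/andP[/eqP-> /eqP->]|ijpq] := boolP ((i == p) && (j == q)).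
    by rewrite (negPf pq) selpq.1 mul1r mulVf // subr0.
  have [/andP[/eqP-> /eqP->]|ijqp] := boolP ((i == q) && (j == p)).
    by rewrite selpq.2 mul1r (so_entryC x p q) mulrN mulVf // sub0r.
  rewrite subrr; have [->|xij] := eqVneq (vsval x i j) 0; first by rewrite !mulr0.
  case: (boolP (all _ _)) => [/(selE _ _ xij)|_]; last by rewrite mul0r mulr0.
  by rewrite (negPf ijpq) (negPf ijqp).
by rewrite memvZ.
Qed.

(** Once a nonzero ideal contains one E_pq - E_qp, brackets with the other generators replace its
    indices one at a time. *)
Theorem block_simple : simple_lie g.
Proof.
split.
- exact: block_subalgebra.
- have k0 : (0 < N)%N by lia. have k1 : (1 < N)%N by lia. have k2 : (2 < N)%N by lia.
  pose i : 'I_N := Ordinal k0; pose j : 'I_N := Ordinal k1; pose k : 'I_N := Ordinal k2.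
  move=> ab; have : lie (rot i j) (rot j k) \in 0%VS.
    by rewrite -ab memv_lie_prodv // rot_in //=; lia.
  rewrite lie_rot // memv0; apply/negP; exact: rot_neq0.
move=> I iI; have [->|/eqP I0] := eqVneq I 0%VS; [by left | right].
have [Ig gI] := iI; have lieI x y : x \in g -> y \in I -> lie x y \in I.
  by move=> xg yI; apply: (subvP gI); apply: memv_lie_prodv.
have [p [q [pN qN pq pqI]]] := ideal_rot iI I0.
have NI i j : rot i j \in I -> rot j i \in I by rewrite rotC memvN.
have pI (r : 'I_N) : (r < n)%N -> r != p -> rot p r \in I.
  move=> rN rp; have [->//|rq] := eqVneq r q.
  rewrite NI // -(lie_rot (j := q)) 1?eq_sym //; first by rewrite lieI ?rot_in // NI.
  by rewrite eq_sym.
have allI (i j : 'I_N) : (i < n)%N -> (j < n)%N -> i != j -> rot i j \in I.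
  move=> iN jN ij; have [ip|ip] := eqVneq i p; first by rewrite ip pI // eq_sym -ip.
  have [jp|jp] := eqVneq j p; first by rewrite jp NI // pI.
  have <- : lie (rot i p) (rot p j) = rot i j by apply: lie_rot => //; rewrite eq_sym.
  by apply: lieI; [exact: rot_in | exact: pI].
apply/eqP; rewrite eqEsubv Ig; apply/subvP => x xg.
rewrite (rot_sum x) memv_suml // => i _; rewrite memv_suml // => j _.
have [->|xij] := eqVneq (vsval x i j) 0; first by rewrite mulr0 scale0r mem0v.
have /andP[iN jN] := block_entry0 xg xij.
by rewrite memvZ // allI //; apply: contraNneq xij => ->; rewrite so_diag0.
Qed.

End Simple.

(** * The graded pieces *)

Section OutsideModule.
Variables (C : numClosedFieldType) (l : nat).
Hypothesis hl : (2 <= l)%N.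
Local Notation N := (2 * l + 4)%N.
Local Notation n := ((2 * l).+1).
Variables (g : {vspace so C N}).
Hypothesis gP : forall X : so C N, X \in g <-> blk C l *m vsval X *m blk C l = vsval X.
Variables (m : 'I_N).
Hypothesis mN : ~~ (m < n)%N.

Lemma blk_unitv_out : blk C l *m unitv C m = 0.
Proof.
apply/colP => i; rewrite -colE !mxE; case: eqP => [->|]; last by rewrite mulr0n.
by rewrite (negPf mN).
Qed.

Lemma block_unitv_out (x : so C N) : x \in g -> vsval x *m unitv C m = 0.
Proof.
by move=> /gP <-; rewrite -(mulmxA _ (blk C l)) blk_unitv_out mulmx0.
Qed.

(** A copy of the defining representation of so_(2l+1): g acts on u and kills the outside vector
    e_m. *)
Definition outw (u : 'cV[C]_n) : so C N := swedge (incl C l *m u) (unitv C m).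

Lemma lie_outw (x : so C N) u : x \in g -> lie x (outw u) = outw (pblk x *m u).
Proof.
move=> xg; rewrite /outw lie_swedge (block_unitv_out xg).
rewrite [X in _ + X](_ : _ = 0).
  rewrite addr0 (pblkK gP xg); move: (pblk x) => P.
  by rewrite -!mulmxA (mulmxA (incl C l)^T) incl_orth mul1mx.
by apply: val_inj; rewrite [LHS]swedgeE /wedge trmx0 mulmx0 mul0mx subrr.
Qed.

Lemma outw_linear : linear outw.
Proof.
move=> a u w; apply: val_inj; rewrite [LHS]swedgeE [RHS]so_valD so_valZ !swedgeE.
by rewrite mulmxDr -scalemxAr wedgeDl wedgeZl.
Qed.

Lemma incl_out (i : 'I_N) (u : 'cV[C]_n) : ~~ (i < n)%N -> (incl C l *m u) i 0 = 0.
Proof.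
move=> iN; rewrite mxE big1 // => k _; rewrite mxE.
case: eqP => [E|_]; last by rewrite mul0r.
by case/negP: iN; rewrite E.
Qed.

Lemma outw_eq0 u : outw u = 0 -> u = 0.
Proof.
move=> E; have : wedge (incl C l *m u) (unitv C m) *m unitv C m = 0.
  by rewrite -swedgeE -/(outw u) E mul0mx.
rewrite wedge_mul unitv_dot eqxx scale1r dotvC dotv_unitv incl_out // scale0r subr0.
move=> /(congr1 (mulmx (incl C l)^T)).
by rewrite mulmxA incl_orth mul1mx mulmx0.
Qed.

(** Irreducibility of the defining representation, phrased for a predicate so as to apply to the
    preimage of a submodule. If u_i is nonzero and i, j, k are distinct, then (d_k ^ d_j)(d_j ^ d_i)
    u = u_i d_k. *)
Lemma outw_skew_gen (P : 'cV[C]_n -> Prop) :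
    P 0 -> (forall a u w, P u -> P w -> P (a *: u + w)) ->
    (forall Y u, Y^T = - Y -> P u -> P (Y *m u)) ->
    (exists2 u, P u & u != 0) ->
  forall u, P u.
Proof.
move=> P0 PD PY [u Pu u0]; pose d i : 'cV[C]_n := delta_mx i 0.
have PZ a w : P w -> P (a *: w) by move=> Pw; rewrite -[_ *: _]addr0; apply: PD.
have dd i j : dotv (d i) (d j) = (i == j)%:R.
  by rewrite /dotv trmx_delta mul_delta_mx_cond mulmxnE mxE !eqxx.
have [i ui] : exists i, u i 0 != 0.
  apply: contra_neqP u0 => /forallNP no; apply/colP => i; rewrite [RHS]mxE.
  by have /negP := no i; rewrite negbK => /eqP.
have du k : dotv (d k) u = u k 0 by rewrite /dotv trmx_delta -rowE mxE.
have step j k : j != i -> k != i -> k != j -> P (d k).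
  move=> ji ki kj; have := PY _ _ (wedge_skew (d k) (d j)) (PY _ _ (wedge_skew (d j)
    (d i)) Pu).
  rewrite [X in _ *m X]wedge_mul wedge_mul !dotvBr !dotvZr !dd !du !eqxx.
  rewrite (negPf ki) (negPf kj) (negPf ji) !mulr0 mulr1 !subr0 scale0r subr0.
  by move=> /(PZ (u i 0)^-1); rewrite scalerA mulVf // scale1r.
have third k : exists2 j : 'I_n, j != i & j != k.
  pose s := [:: (i : nat); (k : nat)].
  have [j j3 js] : exists2 j : nat, j \in iota 0 3 & j \notin s.
    apply/hasP; rewrite -[has _ _]negbK -all_predC; apply/negP => /allP all3.
    have := @uniq_leq_size _ (iota 0 3) s.
    by case/(_ isT _)/idPn => // a a3; have := all3 a a3; rewrite /= negbK.
  have jn : (j < n)%N.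
    move: j3; rewrite mem_iota add0n => /andP[_ j3]; apply: leq_trans j3 _.
    by rewrite ltnS -[2%N]/(2 * 1)%N leq_mul2l (leq_trans _ hl) ?orbT.
  exists (Ordinal jn); move: js; rewrite !inE negb_or => /andP[ji jk].
    by rewrite -val_eqE.
  by rewrite -val_eqE.
have Pk k : k != i -> P (d k).
  by move=> ki; have [j ji jk] := third k; apply: (step j); rewrite // eq_sym.
have Pi : P (d i).
  have [k ki _] := third i; have := PY _ _ (wedge_skew (d i) (d k)) (Pk _ ki).
  by rewrite wedge_mul !dd eqxx [i == k]eq_sym (negPf ki) scale1r scale0r subr0.
have Pd k : P (d k) by have [->|] := eqVneq k i; [|apply: Pk].
move=> w; rewrite [w]matrix_sum_delta; elim/big_ind: _ => // [x y Px Py|k _].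
  by rewrite -[x]scale1r; apply: PD.
by rewrite big_ord1; apply/PZ/Pd.
Qed.

Theorem outside_irreducible : exists U : {vspace so C N},
  [/\ forall y, y \in U <-> exists u, y = outw u, \dim U = n & adj_irreducible g U].
Proof.
have [F FE] := hom_exists outw_linear; exists (limg F).
have UP y : y \in limg F <-> exists u, y = outw u.
  split=> [/memv_imgP[u _ ->]|[u ->]]; first by exists u; rewrite FE.
  by rewrite -FE memv_img ?memvf.
split=> //.
  rewrite limg_dim_eq; first by rewrite dimvf /dim /= muln1.
  apply/eqP; rewrite -subv0; apply/subvP => u; rewrite memv_cap memv_ker FE.
  by case/andP=> _ /eqP/outw_eq0 ->; rewrite mem0v.
have lieU x y : x \in g -> y \in limg F -> lie x y \in limg F.
  by move=> xg /UP[u ->]; apply/UP; rewrite lie_outw //; exists (pblk x *m u).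
split.
- exact: lie_prodv_subv.
- move=> U0; have : outw (delta_mx ord0 0) \in limg F by apply/UP;
  exists (delta_mx ord0 0).
  rewrite U0 memv0 => /eqP/outw_eq0/colP/(_ ord0); rewrite !mxE !eqxx => /eqP.
  by rewrite oner_eq0.
move=> W WU gW; have [->|/eqP W0] := eqVneq W 0%VS; [by left | right].
apply/eqP; rewrite eqEsubv WU; apply/subvP => y /UP[u ->] {y}.
move: u; apply: outw_skew_gen.
- by rewrite (lin_eq0 outw_linear) mem0v.
- by move=> a u w uW wW; rewrite outw_linear memvD // memvZ.
- move=> Y u YT uW; have Yg := eblk_in gP YT.
  have := lie_outw u Yg; rewrite eblkK // => <-.
  by apply: (subvP gW); apply: memv_lie_prodv.
have /UP[u uE] := subvP WU _ (memv_pick W); exists u; first by rewrite -uE memv_pick.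
apply: contra_not_neq W0 => u0; apply/eqP; rewrite -vpick0 uE u0.
by rewrite (lin_eq0 outw_linear).
Qed.

End OutsideModule.

Section ModuleSplit.
Variables (C : numClosedFieldType) (l : nat).
Hypothesis hl : (2 <= l)%N.
Local Notation N := (2 * l + 4)%N.
Local Notation n := ((2 * l).+1).
Variables (g : {vspace so C N}).
Hypothesis gP : forall X : so C N, X \in g <-> blk C l *m vsval X *m blk C l = vsval X.
Variables (m j k : 'I_N).
Hypotheses (mN : ~~ (m < n)%N) (jN : ~~ (j < n)%N) (kN : ~~ (k < n)%N).
Hypotheses (mj : m != j) (mk : m != k) (jk : j != k).

Lemma outw_entry u (i c : 'I_N) : vsval (outw m u) i c =
  (incl C l *m u) i 0 * (c == m)%:R - (i == m)%:R * (incl C l *m u) c 0.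
Proof.
rewrite swedgeE /wedge [LHS]mxE; move: (incl C l *m u) => w.
by rewrite !mxE !big_ord1 !mxE !andbT.
Qed.

(** Both j and k lie outside the block, so g kills E_jk - E_kj, which spans the trivial summand; the
    wedges u ^ e_m form the other one. The condition on V is the shape of the entries in the degree
    of e_m. *)
Theorem module_split (V : {vspace so C N}) :
    (forall x : so C N, x \in V <-> forall i c : 'I_N, i != c -> vsval x i c != 0 ->
      [|| (i < n)%N && (c == m), (c < n)%N && (i == m),
          (i == j) && (c == k) | (i == k) && (c == j)]) ->
  exists T U : {vspace so C N}, [/\ (T + U)%VS = V, (T :&: U)%VS = 0%VS,
    \dim T = 1%N /\ adj_trivial g T & \dim U = (2 * l + 1)%N /\ adj_irreducible g U].
Proof.
move=> VP; have [U [UP dimU irrU]] := outside_irreducible hl gP mN.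
have out (i : 'I_N) : ~~ (i < n)%N -> forall i' : 'I_N, (i' < n)%N -> i' == i = false.
  by move=> iN i' iN'; apply: contraNF iN => /eqP <-.
have km : k == m = false by rewrite eq_sym (negPf mk).
have jm : j == m = false by rewrite eq_sym (negPf mj).
have kj : k == j = false by rewrite eq_sym (negPf jk).
exists <[rot C j k]>%VS, U; split.
- apply/eqP; rewrite eqEsubv subv_add -memvE; apply/andP; split; [apply/andP; split|].
  + apply/VP => i c _; rewrite rot_entry; case: ((i == j) && _); first by rewrite !orbT.
    by case: ((i == k) && _); rewrite ?orbT // subrr eqxx.
  + apply/subvP => y /UP[u ->]; apply/VP => i c _; rewrite outw_entry.
    case: (boolP (i < n)%N) => iN; case: (boolP (c < n)%N) => cN;
      rewrite ?(incl_out _ iN) ?(incl_out _ cN) ?mul0r ?mulr0 ?subr0 ?sub0r.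
    * by rewrite (out _ mN _ iN) (out _ mN _ cN) mulr0n mulr0 mul0r subrr eqxx.
    * by case: (c == m) => //; rewrite mulr0n mulr0 eqxx.
    * by case: (i == m) => //; rewrite mulr0n mul0r oppr0 eqxx.
    * by rewrite eqxx.
  + apply/subvP => x xV; have xcls := (VP x).1 xV.
    (* The block part of column m of x; together with the (j, k) entry it determines x. *)
    pose w : 'cV[C]_n := (incl C l)^T *m (vsval x *m unitv C m).
    have wE (i : 'I_N) : (incl C l *m w) i 0 = if (i < n)%N then vsval x i m else 0.
      rewrite /w mulmxA incl_blk mul_diag_mx mxE mxE -colE mxE.
      by case: ifP => _; rewrite ?mul1r ?mul0r.
    have -> : x = vsval x j k *: rot C j k + outw m w.
      apply: val_inj; apply/matrixP => i c.
      rewrite -[LHS]/(vsval x i c) -[RHS]/((vsval x j k *: vsval (rot C j k) + vsval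
        (outw m w)) i c).
      rewrite [RHS]mxE [X in _ = X + _]mxE outw_entry !wE rot_entry.
      have [<-|ic] := eqVneq i c.
        rewrite (so_diag0 x i) [(i == k) && _]andbC subrr mulr0 add0r.
        by rewrite [X in _ = _ - X]mulrC subrr.
      have [/andP[iN /eqP->]|nA] := boolP ((i < n)%N && (c == m)).
        rewrite iN (negPf mN) !(out _ jN _ iN) !(out _ kN _ iN) (out _ mN _ iN) eqxx.
        by rewrite !andFb subrr !mulr0 add0r subr0 mulr1.
      have [/andP[cN /eqP->]|nB] := boolP ((c < n)%N && (i == m)).
        rewrite cN (negPf mN) !(out _ jN _ cN) !(out _ kN _ cN) (out _ mN _ cN) eqxx.
        rewrite !andbF subrr !mulr0 add0r sub0r mul1r.
        by rewrite (so_entryC x c m).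
      have [/andP[/eqP-> /eqP->]|nC] := boolP ((i == j) && (c == k)).
        by rewrite (negPf jk) (negPf jN) jm subr0 mulr1 !mul0r subr0 addr0.
      have [/andP[/eqP-> /eqP->]|nD] := boolP ((i == k) && (c == j)).
        rewrite (negPf kN) km sub0r mulrN1 !mul0r subr0 addr0.
        by rewrite (so_entryC x j k).
      rewrite subrr mulr0 add0r.
      have -> : (if (i < n)%N then vsval x i m else 0) * (c == m)%:R = 0.
        by move: nA; case: (i < n)%N => /= [/negPf->|_]; rewrite ?mulr0 ?mul0r.
      have -> : (i == m)%:R * (if (c < n)%N then vsval x c m else 0) = 0.
        by move: nB; case: (c < n)%N => /= [/negPf->|_]; rewrite ?mulr0 ?mul0r.
      rewrite subrr; apply/eqP; apply: contraT => /(xcls _ _ ic).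
      by rewrite (negPf nA) (negPf nB) (negPf nC) (negPf nD).
    by rewrite memv_add ?memvZ ?memv_line //; apply/UP; exists w.
- apply/eqP; rewrite -subv0; apply/subvP => y;
  rewrite memv_cap => /andP[/vlineP[a ->] /UP[u E]].
  have : vsval (a *: rot C j k) j k = 0.
    by rewrite E outw_entry km jm mulr0 mul0r subr0.
  rewrite so_valZ mxE rot_entry !eqxx (negPf jk) subr0 mulr1 => ->.
  by rewrite scale0r mem0v.
- split; first by rewrite dim_vline rot_neq0.
  move=> x u xg /vlineP[a ->]; rewrite lieZr /rot lie_swedge.
  rewrite (block_unitv_out gP jN xg) (block_unitv_out gP kN xg).
  have -> : swedge 0 (unitv C k) + swedge (unitv C j) 0 = 0 :> so C N.
    apply: val_inj; rewrite [LHS]so_valD !swedgeE /wedge.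
    by rewrite trmx0 !mul0mx !mulmx0 subrr addr0.
  by rewrite scaler0.
- by rewrite dimU addn1.
Qed.

End ModuleSplit.

(** * Weights of the toroidal algebra *)

Section ToroidalWeights.
Variables (K : numFieldType) (L : vectLieAlgType K).
Implicit Types (x : laurent L) (r : Z2) (u : L) (X : toroidal L).

Lemma laurentD x y r : (x + y) r = x r + y r. Proof. by []. Qed.
Lemma laurentZ a x r : (a *: x) r = a *: x r. Proof. by []. Qed.

Lemma loop_lie0_coeff u x r : loop_lie (mono 0 u) x r = lie u (x r).
Proof.
have lin := loop_lie_linearr (mono (0 : Z2) u).
elim/laurent_ind: x => [|x y IHx IHy|s w].
- by rewrite (lin_eq0 lin) liex0.
- by rewrite (lin_eqD lin) !laurentD IHx IHy lieDr.
- by rewrite loop_lie_mono add0r !monoE; case: eqP => // _; rewrite liex0.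
Qed.

Lemma degree_coeff a x r : degree a x r = (a.1 * r.1%:~R + a.2 * r.2%:~R : K) *: x r.
Proof.
elim/laurent_ind: x => [|x y IHx IHy|s w].
- by rewrite (lin_eq0 (degree_is_linear a)) scaler0.
- by rewrite (lin_eqD (degree_is_linear a)) !laurentD IHx IHy scalerDr.
- by rewrite degree_mono laurentZ !monoE; case: eqP => [->//|_]; rewrite !scaler0.
Qed.

Lemma degree0 (V : lmodType K) (x : laurent V) : degree 0 x = 0.
Proof. exact: lin_eq0 (degree_linearl x). Qed.

Lemma dkahler_degree0 (z : dkahler K) : dkahler_degree 0 z = 0.
Proof. exact: lin_eq0 (dkahler_degree_linearl z). Qed.

Lemma cocycle_mono0 u r w : cocycle (mono 0 u) (mono r w) = 0.
Proof.
rewrite cocycle_mono /mono_dmono [kclass _](_ : _ = 0) ?scaler0 //.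
have -> : mono (0 + r) (0%:~R : K^o, 0%:~R : K^o) = 0 :> Omega K by exact: linear0.
by rewrite raddf0.
Qed.

Variables (h : {vspace L}) (al : 'Hom(subvs_of h, K^o)).

(** Brackets have no d-part, so a nonzero weight on h makes that of X vanish; then the loop part
    cannot vanish, because h commutes with the central part. At a nonzero coefficient, the action of
    d_0 and d_1 identifies b with the degree. *)
Lemma toroidal_weight_vector (b : K * K) X :
    (forall (t : subvs_of h) (a : K * K), tor_lie (mono 0 (vsval t), tk 0 0 0, (a.1 :
      K^o, a.2 : K^o)) X
       = ((al t : K) + b.1 * a.1 + b.2 * a.2) *: X) ->
    al <> 0 -> X <> 0 ->
  exists r, [/\ b = (r.1%:~R, r.2%:~R), X.1.1 r <> 0 &
    forall t : subvs_of h, lie (vsval t) (X.1.1 r) = (al t : K) *: X.1.1 r].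
Proof.
move=> XE al0 X0; have [t0 t0E] : exists t, (al t : K) <> 0.
  apply: contrapT => /forallNP no; apply: al0; apply/lfunP => t.
  by rewrite lfunE; apply: contrapT (no t).
have X2 : X.2 = 0.
  have := congr1 snd (XE t0 0); rewrite /= !mulr0 !addr0 => /esym/eqP.
  by rewrite scaler_eq0 => /orP[/eqP//|/eqP].
have coefE t a r : lie (vsval t) (X.1.1 r) + (a.1 * r.1%:~R + a.2 * r.2%:~R) *: X.1.1 r
    = ((al t : K) + b.1 * a.1 + b.2 * a.2) *: X.1.1 r.
  have : (loop_lie (mono 0 (vsval t)) X.1.1 + degree (a.1 : K^o, a.2 : K^o) X.1.1
      - degree X.2 (mono 0 (vsval t))) r = (((al t : K) + b.1 * a.1 + b.2 * a.2) *:
        X.1.1) r.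
    by have /= := congr1 (fun Y : toroidal L => (Y.1.1 : laurent L) r) (XE t a).
  by rewrite X2 degree0 subr0 laurentD loop_lie0_coeff degree_coeff.
have [r Xr] : exists r, X.1.1 r <> 0.
  apply: contrapT => /forallNP no; have X11 : X.1.1 = 0.
    by apply: laurentP => r; apply: contrapT (no r).
  apply: X0; have := congr1 (fun Y : toroidal L => Y.1.2) (XE t0 0).
  rewrite /= X11 X2 !dkahler_degree0 !mulr0 !addr0 subr0.
  rewrite (lin_eq0 (cocycle_linearr _)) => /esym/eqP.
  rewrite scaler_eq0 => /orP[/eqP//|/eqP X12].
  by case: X X11 X2 X12 {XE coefE no} => [[x z] a] /= -> -> ->.
have lieE t : lie (vsval t) (X.1.1 r) = (al t : K) *: X.1.1 r.
  by have := coefE t 0 r; rewrite /= !mul0r !mulr0 !addr0 scale0r addr0.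
exists r; split=> //.
have bE a : a.1 * r.1%:~R + a.2 * r.2%:~R = b.1 * a.1 + b.2 * a.2.
  have /eqP := coefE 0 a r; rewrite lieE linear0 scale0r !add0r -subr_eq0 -scalerBl.
  by rewrite scaler_eq0 => /orP[|/eqP//]; rewrite subr_eq0 => /eqP.
have := bE (1, 0); have := bE (0, 1);
  rewrite /= !mul0r !mulr0 !mul1r !mulr1 !addr0 !add0r.
by case: b {XE coefE bE} => b0 b1 /= <- <-.
Qed.

Lemma mono_weight_vector r (u : L) :
    (forall t : subvs_of h, lie (vsval t) u = (al t : K) *: u) ->
  forall (t : subvs_of h) (a c : K * K),
  tor_lie (mono 0 (vsval t), tk 0 c.1 c.2, (a.1 : K^o, a.2 : K^o)) (mono r u, 0, 0)
    = ((al t : K) + r.1%:~R * a.1 + r.2%:~R * a.2) *: ((mono r u, 0, 0) : toroidal L).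
Proof.
move=> uE t a c; rewrite /tor_lie /= loop_lie_mono add0r cocycle_mono0 uE linearZ /=.
rewrite degree_mono !degree0 !dkahler_degree0 subr0.
rewrite (lin_eq0 (dkahler_degree_is_linear _)) !addr0 subr0 -scalerDl.
rewrite -[RHS]/(_ *: mono r u, _ *: (0 : dkahler K), _ *: (0 : K^o * K^o)) !scaler0.
by congr (_ *: _, _, _); rewrite /= addrA; congr (_ + _ + _); rewrite mulrC.
Qed.

End ToroidalWeights.

(** * The gradings by sigma_0 and sigma_1 *)

Section Gradings.
Variables (R : realType) (l : nat).
Local Notation C := R[i].
Local Notation N := (2 * l + 4)%N.

(* sigma_j conjugates by the diagonal matrix with entries (-1)^(e_j i). *)
Definition e0 (i : nat) : bool := (2 * l + 2 <= i)%N.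
Definition e1 (i : nat) : bool := (i == 2 * l + 1)%N || (i == 2 * l + 3)%N.

Lemma sum_EmxE m (i j : 'I_N) :
  (\sum_(1 <= k < m) Emx k k : 'M[C]_N) i j = ((i == j) && (i.+1 < m)%N)%:R.
Proof.
rewrite summxE; under eq_bigr do rewrite mxE.
have [<-|ij] := eqVneq i j.
  under eq_bigr do rewrite andbb mulrb eq_sym.
  by rewrite -big_mkcond big_nat1_eq /=; case: ifP.
rewrite big1 // => k _; case: eqP => // <-; case: eqP => //= E.
by case/eqP: ij; apply: val_inj; case: E.
Qed.

Lemma sigma0_mxE : sigma0_mx R l = diag_mx (\row_i (-1) ^+ e0 i).
Proof.
apply/matrixP => i j; rewrite mxE sum_EmxE !mxE /e0.
have [<-|ij] := eqVneq i j.
  rewrite !andbb mulr1n; have iN := ltn_ord i; case: eqP => a1; case: eqP => a2;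
    case: ltnP => a3; case: leqP => a4; try (exfalso; lia);
    by rewrite ?expr0 ?expr1 ?oppr0 ?subr0 ?addr0 ?add0r.
rewrite mulr0n; have {}ij : (i : nat) <> j by move/eqP: ij => + /val_inj.
by case: eqP => a1; case: eqP => a2; case: eqP => a3; case: eqP => a4;
  try (exfalso; lia); rewrite ?subr0 ?oppr0 ?addr0.
Qed.

Lemma sigma1_mxE : sigma1_mx R l = diag_mx (\row_i (-1) ^+ e1 i).
Proof.
apply/matrixP => i j; rewrite mxE sum_EmxE !mxE /e1.
have [<-|ij] := eqVneq i j.
  rewrite !andbb mulr1n; have iN := ltn_ord i; case: eqP => a1; case: eqP => a2;
    case: eqP => a3; case: ltnP => a4; case: eqP => a5; case: eqP => a6;
    try (exfalso; lia); by rewrite ?expr0 ?expr1 ?oppr0 ?subr0 ?addr0 ?add0r.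
rewrite mulr0n; have {}ij : (i : nat) <> j by move/eqP: ij => + /val_inj.
by case: eqP => a1; case: eqP => a2; case: eqP => a3; case: eqP => a4;
  case: eqP => a5; case: eqP => a6;
  try (exfalso; lia); rewrite ?subr0 ?oppr0 ?addr0.
Qed.

Lemma Ad_signE (P : pred nat) (A : 'M[C]_N) (X : so C N) i j :
    A = diag_mx (\row_i (-1) ^+ P i) ->
  vsval (Ad A X) i j = (-1) ^+ (P i (+) P j) * vsval X i j.
Proof.
move=> EA; have AA : A *m A = 1%:M.
  rewrite EA mulmx_diag -diag_const_mx; congr diag_mx; apply/rowP => k.
  by rewrite !mxE -signr_addb addbb.
have iA : invmx A = A.
  by rewrite -[LHS]mulmx1 -AA mulKmx //; case: (mulmx1_unit AA).
have At : A^T = A by rewrite EA tr_diag_mx.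
rewrite AdE ?At // iA EA mul_mx_diag mxE mul_diag_mx !mxE.
by rewrite mulrAC signr_addb.
Qed.

Lemma root_of_unity2 (p : int) : Defs.root_of_unity R 2 ^ p = (-1) ^+ odd `|p|%N.
Proof.
have -> : Defs.root_of_unity R 2 = -1.
  rewrite /Defs.root_of_unity mulrAC divff ?pnatr_eq0 // mul1r cospi sinpi.
  by apply/eqP; rewrite eq_complex /= oppr0 !eqxx.
by rewrite signr_odd; case: p => n //=; rewrite -[LHS]/((-1) ^- n.+1) -exprVn invrN1.
Qed.

(** Both automorphisms have order 2, so the eigenvalues are signs depending on parities, and
    conjugation by diagonal signs multiplies the (i, j) entry by the product of the two signs. *)
Lemma gradingP (p q : int) (X : so C N) :
  (X \in grading (sigma0 R l) (sigma1 R l) p q) <->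
  forall i j, vsval X i j != 0 ->
    e0 i (+) e0 j = odd `|p|%N /\ e1 i (+) e1 j = odd `|q|%N.
Proof.
have eig (P : pred nat) A (k : int) : A = diag_mx (\row_i (-1) ^+ P i) ->
    is_aut_order (Ad A) 2 ->
  (X \in passmx.leigenspace (Ad A) (Defs.root_of_unity R (aut_order (Ad A)) ^ k)) <->
  forall i j, vsval X i j != 0 -> P i (+) P j = odd `|k|%N.
  move=> EA /aut_orderE->; rewrite root_of_unity2 /passmx.leigenspace memv_ker.
  rewrite !lfunE /= opp_lfunE scale_lfunE id_lfunE subr_eq0; split=> [/eqP E i j Xij|E].
    have : vsval (Ad A X) i j = (-1) ^+ odd `|k|%N * vsval X i j by rewrite E mxE.
    rewrite (Ad_signE _ _ _ EA) => /(mulIf Xij)/eqP.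
    by rewrite (inj_eq (@signr_inj _)) => /eqP.
  apply/eqP/val_inj/matrixP => i j; rewrite [LHS](Ad_signE _ _ _ EA) [RHS]mxE.
  by have [->|/E->//] := eqVneq (vsval X i j) 0; rewrite !mulr0.
rewrite memv_cap; split.
  case/andP=> /(eig _ _ _ sigma0_mxE (sigma0_order R l)) X0.
  move=> /(eig _ _ _ sigma1_mxE (sigma1_order R l)) X1 i j Xij.
  by split; [apply: X0|apply: X1].
move=> E; apply/andP; split.
  by apply/(eig _ _ _ sigma0_mxE (sigma0_order R l)) => i j /E[].
by apply/(eig _ _ _ sigma1_mxE (sigma1_order R l)) => i j /E[].
Qed.

End Gradings.

Section GradingBlock.
Variables (R : realType) (l : nat).
Local Notation C := R[i].
Local Notation N := (2 * l + 4)%N.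
Local Notation n := ((2 * l).+1).
Local Notation g00 := (grading (sigma0 R l) (sigma1 R l) 0 0).

Lemma e_small i : (i < n)%N -> (e0 l i = false) * (e1 l i = false).
Proof. by move=> i_n; split; rewrite /e0 /e1; apply/negbTE; lia. Qed.

(** The sign pairs of the outside coordinates are distinct and nontrivial, so equal signs outside
    the block occur only on the diagonal, where skew matrices vanish. *)
Lemma g00P (X : so C N) : X \in g00 <-> blk C l *m vsval X *m blk C l = vsval X.
Proof.
split=> [/gradingP Xg|E].
  apply/matrixP => i j; rewrite blk_entry; case: ifPn => // ij.
  apply/esym/eqP; apply: contraR ij => /[dup] Xij /Xg[].
  have iN := ltn_ord i; have jN := ltn_ord j.
  have : i != j.
    apply: contraNneq Xij => <-; have /matrixP/(_ i i) := so_trmx X.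
    rewrite !mxE => /eqP; rewrite -addr_eq0 -mulr2n mulrn_eq0 /=.
    by move/eqP->.
  have addb0 (a b : bool) : a (+) b = odd `|0|%N -> a = b by case: a; case: b.
  by move=> + /addb0 + /addb0; rewrite -val_eqE /e0 /e1 /=; lia.
apply/gradingP => i j; rewrite -E blk_entry; case: ifP => [/andP[iN jN] _|_].
  by rewrite !e_small.
by rewrite eqxx.
Qed.


End GradingBlock.

(* The position of an index relative to the block: 0 inside it, and 1, 2, 3 for
   the last three coordinates, of signs (+,-), (-,+), (-,-). *)
Definition out_code (l i : nat) : nat := (i - 2 * l)%N.

Definition code0 (a : nat) : bool := (2 <= a)%N.
Definition code1 (a : nat) : bool := (a == 1)%N || (a == 3)%N.

(** If x, y, z are the nonzero elements of (Z/2)^2, then a + b = x means that {a, b} is {0, x} or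
    {y, z}. The hypothesis on a and b reflects that distinct coordinates share a code only inside
    the block. *)
Lemma out_code_table a b x y z : (a < 4)%N -> (b < 4)%N -> (x < 4)%N -> (y < 4)%N ->
    (z < 4)%N -> (a != b) || (a == 0)%N && (b == 0)%N ->
    [&& x != 0, y != 0, z != 0, x != y, x != z & y != z]%N ->
  (code0 a (+) code0 b == code0 x) && (code1 a (+) code1 b == code1 x) =
  [|| (a == 0)%N && (b == x), (b == 0)%N && (a == x),
      (a == y) && (b == z) | (a == z) && (b == y)].
Proof.
by case: a => [|[|[|[|]]]] //; case: b => [|[|[|[|]]]] //;
   case: x => [|[|[|[|]]]] //; case: y => [|[|[|[|]]]] //; case: z => [|[|[|[|]]]].
Qed.

Lemma e0_code l i : e0 l i = code0 (out_code l i).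
Proof. by rewrite /e0 /code0 /out_code; lia. Qed.

Lemma e1_code l i : e1 l i = code1 (out_code l i).
Proof. by rewrite /e1 /code1 /out_code; lia. Qed.

Lemma out_code_in l i : (i < (2 * l).+1)%N = (out_code l i == 0)%N.
Proof. by rewrite /out_code; lia. Qed.

Lemma out_code_eq l i m : ~~ (m < (2 * l).+1)%N -> (i == m) = (out_code l i ==
  out_code l m).
Proof. by rewrite /out_code; lia. Qed.

Lemma out_code_lt l i : (i < 2 * l + 4)%N -> (out_code l i < 4)%N.
Proof. by rewrite /out_code; lia. Qed.

Lemma out_code_class l (i c m j k : 'I_(2 * l + 4)) : i != c ->
    [&& ~~ (m < (2 * l).+1)%N, ~~ (j < (2 * l).+1)%N & ~~ (k < (2 * l).+1)%N] ->
    m != j -> m != k -> j != k ->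
  (e0 l i (+) e0 l c == e0 l m) && (e1 l i (+) e1 l c == e1 l m) =
  [|| (i < (2 * l).+1)%N && (c == m), (c < (2 * l).+1)%N && (i == m),
      (i == j) && (c == k) | (i == k) && (c == j)].
Proof.
move=> ic /and3P[mN jN kN] mj mk jk.
rewrite -!val_eqE /= in ic mj mk jk *.
rewrite !(out_code_eq _ mN) !(out_code_eq _ jN) !(out_code_eq _ kN) !out_code_in
  !e0_code !e1_code.
apply: out_code_table; rewrite ?out_code_lt ?ltn_ord //.
  rewrite -!out_code_in; have [iN|iN] := boolP (i < _)%N; last first.
    by rewrite eq_sym -out_code_eq // eq_sym ic.
  have [cN|cN] := boolP (c < _)%N; first by rewrite orbT.
  by rewrite -out_code_eq // ic.
by rewrite -!out_code_in mN jN kN -!out_code_eq // mj mk jk.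
Qed.

Section GradedPieces.
Variables (R : realType) (l : nat).
Hypothesis hl : (2 <= l)%N.
Local Notation C := R[i].
Local Notation N := (2 * l + 4)%N.
Local Notation n := ((2 * l).+1).
Local Notation s0 := (sigma0 R l).
Local Notation s1 := (sigma1 R l).
Local Notation g00 := (grading s0 s1 0 0).

Lemma grading_split (p q : int) (m j k : 'I_N) :
    [&& ~~ (m < n)%N, ~~ (j < n)%N & ~~ (k < n)%N] -> m != j -> m != k -> j != k ->
    e0 l m = odd `|p|%N -> e1 l m = odd `|q|%N ->
  exists T U : {vspace so C N}, [/\ (T + U)%VS = grading s0 s1 p q, (T :&: U)%VS = 0%VS,
    \dim T = 1%N /\ adj_trivial g00 T & \dim U = (2 * l + 1)%N /\ adj_irreducible g00
      U].
Proof.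
move=> out mj mk jk m0 m1; have /and3P[mN jN kN] := out.
apply: (module_split hl (@g00P R l) mN jN kN mj mk jk) => x.
have E (i c : 'I_N) : i != c ->
    (e0 l i (+) e0 l c = odd `|p|%N /\ e1 l i (+) e1 l c = odd `|q|%N) <->
    [|| (i < n)%N && (c == m), (c < n)%N && (i == m),
        (i == j) && (c == k) | (i == k) && (c == j)].
  move=> ic; rewrite -(out_code_class ic out mj mk jk) m0 m1.
  by split=> [[-> ->]|/andP[/eqP-> /eqP->]]; rewrite ?eqxx.
split=> [/gradingP xg i c ic xic|xg]; first exact/(E _ _ ic)/xg.
apply/gradingP => i c xic; have ic : i != c by apply: contraNneq xic => ->;
  rewrite so_diag0.
exact/E/xg.
Qed.

Lemma graded_modules (p q : int) : (p, q) \in [:: (0, 1); (1, 0); (1, 1)] ->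
  exists T U : {vspace so C N}, [/\ (T + U)%VS = grading s0 s1 p q, (T :&: U)%VS = 0%VS,
    \dim T = 1%N /\ adj_trivial g00 T & \dim U = (2 * l + 1)%N /\ adj_irreducible g00
      U].
Proof.
have N1 : (2 * l + 1 < N)%N by rewrite ltn_add2l.
have N2 : (2 * l + 2 < N)%N by rewrite ltn_add2l.
have N3 : (2 * l + 3 < N)%N by rewrite ltn_add2l.
pose o1 := Ordinal N1; pose o2 := Ordinal N2; pose o3 := Ordinal N3.
have out1 : ~~ (o1 < n)%N by rewrite /=; lia.
have out2 : ~~ (o2 < n)%N by rewrite /=; lia.
have out3 : ~~ (o3 < n)%N by rewrite /=; lia.
have o12 : o1 != o2 by rewrite -val_eqE /= eqn_add2l.
have o13 : o1 != o3 by rewrite -val_eqE /= eqn_add2l.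
have o23 : o2 != o3 by rewrite -val_eqE /= eqn_add2l.
rewrite !inE => /or3P[] /eqP[-> ->].
- apply: (@grading_split _ _ o1 o2 o3); rewrite ?out1 ?out2 ?out3 //.
    by rewrite /e0 /= leq_add2l.
  by rewrite /e1 /= !eqn_add2l.
- apply: (@grading_split _ _ o2 o1 o3); rewrite ?out1 ?out2 ?out3 // 1?eq_sym //.
    by rewrite /e0 /= leq_add2l.
  by rewrite /e1 /= !eqn_add2l.
- apply: (@grading_split _ _ o3 o1 o2); rewrite ?out1 ?out2 ?out3 // 1?eq_sym //.
    by rewrite /e0 /= leq_add2l.
  by rewrite /e1 /= !eqn_add2l.
Qed.

Lemma outside_index (p q : int) : ~~ (~~ odd `|p|%N && ~~ odd `|q|%N) ->
  exists k : 'I_N, [/\ ~~ (k < n)%N, e0 l k = odd `|p|%N & e1 l k = odd `|q|%N].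
Proof.
clear hl.
have N1 : (2 * l + 1 < N)%N by rewrite ltn_add2l.
have N2 : (2 * l + 2 < N)%N by rewrite ltn_add2l.
have N3 : (2 * l + 3 < N)%N by rewrite ltn_add2l.
case: (odd `|p|%N) (odd `|q|%N) => [] [] // _;
  [exists (Ordinal N3)|exists (Ordinal N2)|exists (Ordinal N1)];
  by split; rewrite /e0 /e1 /= ?eqn_add2l ?leq_add2l //; lia.
Qed.

Variables (h : {vspace so C N}) (v : hidx l -> 'cV[C]_N).
Variables (eps : hidx l -> 'Hom(subvs_of h, C^o)) (F : split_frame g00 v eps).

Lemma swedge_grading (p q : int) a (k : 'I_N) : ~~ (k < n)%N ->
    e0 l k = odd `|p|%N -> e1 l k = odd `|q|%N ->
  swedge (v a) (unitv C k) \in grading s0 s1 p q.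
Proof.
move=> kN k0 k1; apply/gradingP => i c.
have vout (j : 'I_N) : ~~ (j < n)%N -> v a j 0 = 0.
  move=> jN; rewrite -(frame_blk F a) mul_diag_mx mxE mxE (negPf jN).
  by rewrite mul0r.
rewrite swedgeE /wedge mxE; move: vout; move: (v a) => w wout.
rewrite !mxE !big_ord1 !mxE !andbT => ne0.
have [[iN ck]|[cN ik]] : ((i < n)%N /\ c = k) \/ ((c < n)%N /\ i = k).
  case: (boolP (i < n)%N) => iN; case: (boolP (c < n)%N) => cN.
  - move: ne0; rewrite (_ : (c == k) = false); last by apply: contraNF kN => /eqP<-.
    rewrite (_ : (i == k) = false); last by apply: contraNF kN => /eqP<-.
    by rewrite mulr0 mul0r subrr eqxx.
  - left; split=> //; apply/eqP; apply: contraNT ne0 => /negPf->.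
    by rewrite (wout c) // !mulr0 subrr.
  - right; split=> //; apply/eqP; apply: contraNT ne0 => /negPf->.
    by rewrite (wout i) // !mul0r subrr.
  - by move: ne0; rewrite (wout i) // (wout c) // mul0r mulr0 subrr eqxx.
- by rewrite ck (e_small iN).1 (e_small iN).2 k0 k1.
- by rewrite ik (e_small cN).1 (e_small cN).2 !addbF k0 k1.
Qed.

End GradedPieces.

(** * The non-isotropic roots of the twisted toroidal algebra *)

Local Open Scope classical_set_scope.
Local Open Scope ring_scope.

Section NonisotropicRoots.
Variables (R : realType) (l : nat).
Hypothesis hl : (2 <= l)%N.
Local Notation C := R[i].
Local Notation N := (2 * l + 4)%N.
Local Notation s0 := (sigma0 R l).
Local Notation s1 := (sigma1 R l).
Local Notation g00 := (grading s0 s1 0 0).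
Variables (h : {vspace so C N}) (v : hidx l -> 'cV[C]_N).
Variables (eps : hidx l -> 'Hom(subvs_of h, C^o)) (F : split_frame g00 v eps).

Lemma weightE (al : 'Hom(subvs_of h, C^o)) (a b : C) :
  inV al + a *: delta0 h + b *: delta1 h = (al, (a : C^o, b : C^o)) :> weightV h.
Proof.
have scale1E (x : C) : x *: (1 : C^o) = x by exact: mulr1.
apply: injective_projections; first by rewrite /= !scaler0 !addr0.
by apply: injective_projections; rewrite /= scale1E !scaler0 ?addr0 ?add0r.
Qed.

Lemma even_grading (p q : int) x :
  x \in g00 -> odd `|p|%N = false -> odd `|q|%N = false -> x \in grading s0 s1 p q.
Proof. by move=> /gradingP xg p0 q0; apply/gradingP => i j /xg; rewrite p0 q0. Qed.

Lemma nonisotropic_intro (al : 'Hom(subvs_of h, C^o)) (p q : int) u :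
    lie_root g00 al -> u \in grading s0 s1 p q -> u <> 0 ->
    (forall t : subvs_of h, lie (vsval t) u = (al t : C) *: u) ->
  nonisotropic_roots s0 s1 h (al, (p%:~R : C^o, q%:~R : C^o)).
Proof.
move=> al_root ug u0 ue; split.
  by apply/eqP; apply: (root_nonisotropic F hl al_root).
exists (mono (p, q) u, 0, 0); split; last first.
  move=> X0; apply: u0.
  have := congr1 (fun Y : toroidal _ => (Y.1.1 : laurent _) (p, q)) X0.
  by rewrite /= eqxx.
split.
  split; last by exists [::]; split=> //; rewrite big_nil.
  by move=> m n /=; case: eqP => [[-> ->]//|_]; rewrite mem0v.
move=> t a0 a1 c0 c1.
exact: (mono_weight_vector (p, q) ue t (a0, a1) (c0, c1)).
Qed.

Theorem nonisotropic_rootsE : nonisotropic_roots s0 s1 h =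
  [set beta | exists (alpha : 'Hom(subvs_of h, R[i]^o)) (m n : int),
     short_root g00 alpha /\
     beta = inV alpha + m%:~R *: delta0 h + n%:~R *: delta1 h]
  `|`
  [set beta | exists (alpha : 'Hom(subvs_of h, R[i]^o)) (m n : int),
     long_root g00 alpha /\
     beta = inV alpha + (2 * m)%:~R *: delta0 h + (2 * n)%:~R *: delta1 h].
Proof.
apply/seteqP; split=> beta.
  case: beta => al [b0 b1] [nz [X [[[Xg _] Xw] X0]]].
  (* A combination of delta_0 and delta_1 alone lies in the radical and is isotropic. *)
  have al0 : al <> 0.
    move=> al0; apply: nz; rewrite /formV /= al0 (full_dual_form F hl).
    by rewrite big1 ?mulr0 // => k _; rewrite lfunE mul0r.
  have [|[m n] [[-> ->] Xr Xe]] := @toroidal_weight_vector _ _ h al (b0, b1) X _ al0 X0.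
    by move=> t a; apply: (Xw t a.1 a.2 0 0).
  have xg := Xg m n; rewrite -weightE.
  have short_case : short_eps eps al -> exists (alpha : 'Hom(subvs_of h, R[i]^o)) (m'
    n' : int),
      short_root g00 alpha /\ inV al + m%:~R *: delta0 h + n%:~R *: delta1 h
        = inV alpha + m'%:~R *: delta0 h + n'%:~R *: delta1 h.
    by move=> al_short; exists al, m, n; split=> //; apply/(short_rootP F hl).
  have [al_short|[al_root [i [j [iN jN xij]]]]] := eigen_root F al0 Xr Xe.
    by left; apply: short_case.
  have [|al_long] := (root_cases F al).1 al_root; first by move=> al_short; left;
    apply: short_case.
  (* Both indices lie in the block and carry trivial signs, so m and n are even. *)
  right; have := (gradingP m n _).1 xg i j xij.
  rewrite !(e_small iN) !(e_small jN) => -[m0 n0].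
  have half (k : int) : false = odd `|k|%N -> exists k', k = 2 * k'.
    move=> k0; exists (k %/ 2)%Z; rewrite mulrC divzK //.
    by rewrite dvdzE dvdn2 -k0.
  have [m' ->] := half m m0; have [n' ->] := half n n0.
  by exists al, m', n'; split=> //; apply/(long_rootP F hl).
case=> -[al [m [n [al_root ->]]]]; rewrite weightE.
  have [a a0 alE] := (short_rootP F hl al).1 al_root.
  have [mn|mn] := boolP (~~ odd `|m|%N && ~~ odd `|n|%N); last first.
    have [k [kN k0 k1]] := outside_index l mn.
    have [w0 we] := outside_eigen F a0 kN.
    apply: (nonisotropic_intro al_root.1 (u := swedge (v a) (unitv C k))).
    - exact: swedge_grading F _ _ a k kN k0 k1.
    - exact/eqP.
    - by move=> t; rewrite we alE.
  have /andP[/negbTE m0 /negbTE n0] := mn.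
  have [w0 we] := frame_eigen F a0.
  apply: (nonisotropic_intro al_root.1 (u := swedge (v a) (v None))).
  - by apply: even_grading => //; apply: (swedge_block (@g00P R l));
    apply: (frame_blk F).
  - exact/eqP.
  - by move=> t; rewrite we alE (eps_None F) lfunE addr0.
have [a [b [a0 b0 ab ba alE]]] := (long_rootP F hl al).1 al_root.
have [w0 we] := frame_eigen F ab.
have even (k : int) : odd `|(2 * k)%R|%N = false by rewrite abszM oddM.
apply: (nonisotropic_intro al_root.1 (u := swedge (v a) (v b))).
- by apply: even_grading => //; apply: (swedge_block (@g00P R l)); apply: (frame_blk F).
- exact/eqP.
- by move=> t; rewrite we alE add_lfunE.
Qed.

End NonisotropicRoots.

Theorem mainTheorem5 (R : realType) (l : nat) (hl : (2 <= l)%N) :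
  let s0 : 'End(so R[i] (2 * l + 4)) := sigma0 R l in
  let s1 : 'End(so R[i] (2 * l + 4)) := sigma1 R l in
  let g00 := grading s0 s1 0 0 in
  [/\ simple_lie_of_type g00 (cartanB l),
      (forall p q : int, (p, q) \in [:: (0, 1); (1, 0); (1, 1)] ->
        exists T U : {vspace so R[i] (2 * l + 4)},
          [/\ (T + U)%VS = grading s0 s1 p q, (T :&: U)%VS = 0%VS,
              \dim T = 1%N /\ adj_trivial g00 T &
              \dim U = (2 * l + 1)%N /\ adj_irreducible g00 U])
    & forall h : {vspace so R[i] (2 * l + 4)}, cartan_subalgebra g00 h ->
        has_cartan_matrix g00 h (cartanB l) /\
        nonisotropic_roots s0 s1 h =
          [set beta | exists (alpha : 'Hom(subvs_of h, R[i]^o)) (m n : int),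
            short_root g00 alpha /\
            beta = inV alpha + m%:~R *: delta0 h + n%:~R *: delta1 h]
          `|`
          [set beta | exists (alpha : 'Hom(subvs_of h, R[i]^o)) (m n : int),
            long_root g00 alpha /\
            beta = inV alpha + (2 * m)%:~R *: delta0 h
                             + (2 * n)%:~R *: delta1 h]].
Proof.
move=> s0 s1 g00; have gP : forall X, _ := @g00P R l; split.
- split; first exact: (block_simple hl gP).
  (* The type of g_(0,0) asks for some Cartan subalgebra, so a standard one is built; the last claim
     starts from an arbitrary one. Both supply a split frame, from which the Cartan matrix follows
     alike. *)
  have [h [v [eps [F ch]]]] := standard_cartan gP.
  by exists h => //; apply: (block_cartan_matrix F hl).
- by move=> p q pq; apply: graded_modules.
move=> h ch; have [v [eps F]] := cartan_split_frame gP ch.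
by split; [exact: (block_cartan_matrix F hl) | exact: (nonisotropic_rootsE hl F)].
Qed.
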